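(* Let $\mathcal{G}$ be a quantum graph consisting of a finite compact metric graph $\mathcal{G}_0$ with leads attached at its external vertices, and let $H=-\frac{d^2}{dx^2}$ be the self-adjoint operator in $L^2(\mathcal{G})$ with continuity and Kirchhoff boundary conditions at every vertex. (i) If $k\in\mathbb{R}$, $k\neq0$, is a resonance of $H$, then the algebraic and geometric multiplicities of $k$ coincide. (ii) Any $k\in\mathbb{R}$, $k\neq0$, is a resonance of $H$ if and only if $k^2$ is an eigenvalue of $H$, and in this case the multiplicity of the resonance $k$ coincides with the multiplicity of the eigenvalue $k^2$ of $H$.
   Context: **Graph.** $\mathcal{G}_0$ is a finite compact metric graph: it has finitely many edges, each edge $e$ being identified with a bounded interval $[0,\rho(e)]$ whose endpoints are vertices. A subset $V^{\mathrm{ext}}$ of the vertices of $\mathcal{G}_0$ is chosen (the external vertices), and one or more (finitely many) copies of $[0,\infty)$, called leads, are attached to each external vertex, the point $0$ of a lead being identified with the vertex. The resulting graph is $\mathcal{G}$. The edges of $\mathcal{G}_0$ are called internal edges. No edge starts and ends at the same vertex; multiple edges between two vertices are allowed; every vertex is attached to at least one internal edge or lead. $V$ is the set of all vertices, $V^{\mathrm{int}}=V\setminus V^{\mathrm{ext}}$, and $\mathcal{G}_\infty$ denotes the union of the (open) leads. **Operator $H$.** $\mathrm{Dom}\,H$ consists of all continuous $f:\mathcal{G}\to\mathbb{C}$ whose restriction to every internal edge or lead $e$ is in the Sobolev space $W^2_2(e)$ and which satisfy $N_vf=0$ at every vertex $v$, where $N_vf$ is the sum of the outgoing derivatives of $f$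 at $v$ over all internal edges and leads attached to $v$. $H$ acts as $Hf=-f''$. **Resonances.** $k\in\mathbb{C}$, $k\ne0$, is a resonance of $H$ if there is $f\in L^2_{\mathrm{loc}}(\mathcal{G})$, $f\not\equiv0$, such that $-f''=k^2f$ on each internal edge and lead, $f$ is continuous on $\mathcal{G}$, $N_vf=0$ at every vertex $v$, and $f(x)=f(0)e^{ikx}$ on each lead. All resonances satisfy $\mathrm{Im}\,k\le0$. **Complex scaling and multiplicities.** For $v\in V^{\mathrm{ext}}$ let $D_v^{\mathrm{int}}f$ (resp. $D_v^{\mathrm{ext}}f$) be the common limit of $f$ at $v$ along internal edges (resp. leads), and $N_v^{\mathrm{int}}f$ (resp. $N_v^{\mathrm{ext}}f$) the sum of the outgoing derivatives of $f$ at $v$ over the internal edges (resp. leads) attached to $v$. For $\varkappa\in\mathbb{C}$ the operator $H(\varkappa)$ in $L^2(\mathcal{G})$ acts by $-f''$ on $\mathcal{G}_0$ and by $-e^{-2\varkappa}f''$ on $\mathcal{G}_\infty$. Its domain is the set of $f$ that are in $W_2^2(e)$ on each internal edge or lead $e$, are continuous on $\mathcal{G}\setminus V^{\mathrm{ext}}$ with limits $D_v^{\mathrm{int}}f$, $D_v^{\mathrm{ext}}f$ existing at each $v\in V^{\mathrm{ext}}$, satisfy $N_vf=0$ at each $v\in V^{\mathrm{int}}$, and satisfy $D_v^{\mathrm{int}}f-e^{-\varkappa/2}D_v^{\mathrm{ext}}f=0$ and $N_v^{\mathrm{int}}f+e^{-3\varkappa/2}N_v^{\mathrm{ext}}f=0$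 at each $v\in V^{\mathrm{ext}}$. For a resonance $k$, the number $k^2$ is an eigenvalue of $H(i\theta)$, isolated from the essential spectrum $e^{-2i\theta}[0,\infty)$ (empty if there are no leads), for every $\theta\in(0,\pi)$ with $\mathrm{Im}(ke^{i\theta})>0$ (for every $\theta\in(0,\pi)$ if $k$ is real). The algebraic (resp. geometric) multiplicity of the resonance $k$ is the algebraic multiplicity, i.e. the rank of the Riesz projection (resp. the geometric multiplicity, i.e. $\dim\mathrm{Ker}(H(i\theta)-k^2I)$) of the eigenvalue $k^2$ of $H(i\theta)$; neither depends on the choice of such $\theta$. *)

(* Defs.v *)
From mathcomp Require Import all_boot all_order all_algebra.
From mathcomp Require Import all_classical all_reals all_analysis.
From mathcomp Require Import complex.

Set Implicit Arguments.
Unset Strict Implicit.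
Unset Printing Implicit Defensive.

Import Order.TTheory GRing.Theory Num.Theory.
Import numFieldNormedType.Exports.

Local Open Scope classical_set_scope.
Local Open Scope ring_scope.
Local Open Scope complex_scope.

(* [R[i]] carries no topology or sigma-algebra in the libraries used here, so
   integrals, continuity, measurability and limits of complex-valued functions
   are taken componentwise. *)

Section Functions.
Variable R : realType.
Implicit Types (D : set R) (f g : R -> R[i]).

Local Notation mu := (@lebesgue_measure R).

Definition re f : R -> R := fun x => complex.Re (f x).
Definition im f : R -> R := fun x => complex.Im (f x).

Definition cexp (z : R[i]) : R[i] :=
  (expR (complex.Re z) * cos (complex.Im z)) +i*
  (expR (complex.Re z) * sin (complex.Im z)).

Definition cint D f : R[i] := Rintegral mu D (re f) +i* Rintegral mu D (im f).

Definition ccontinuous_on D f : Prop :=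
  {within D, continuous (re f)} /\ {within D, continuous (im f)}.

(* The right derivative at [0]; it exists for the functions it is used on. *)
Definition rderiv0 f : R[i] :=
  lim ((h^-1 * (re f h - re f 0)) @[h --> (0 : R)^'+]) +i*
  lim ((h^-1 * (im f h - im f 0)) @[h --> (0 : R)^'+]).

Definition L2 D f : Prop :=
  [/\ measurable_fun D (re f), measurable_fun D (im f) &
      mu.-integrable D (fun x => (re f x ^+ 2 + im f x ^+ 2)%:E)].

Definition L2loc D f : Prop := forall a b : R, L2 (`[a, b] `&` D) f.

(* Test functions are C^1 with compact support in the interior of [D]; for
   locally square-integrable functions C^1 and C^infinity test functions define
   the same weak derivative. *)
Definition test_fun D (phi : R -> R) : Prop :=
  [/\ forall x, derivable phi x 1, continuous (derive1 phi) &
      exists a b : R, `[a, b] `<=` D° /\ forall x, ~~ (a <= x <= b) -> phi x = 0].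

Definition weak_deriv D f g : Prop :=
  [/\ L2loc D f, L2loc D g &
      forall phi, test_fun D phi ->
        cint D (fun x => f x * ((derive1 phi) x)%:C) =
        - cint D (fun x => g x * (phi x)%:C)].

(* [f] lies in the Sobolev space W^2_2 on D, and [h] represents [f'']. *)
Definition W22_deriv2 D f h : Prop :=
  [/\ L2 D f, L2 D h &
      exists g, [/\ L2 D g, weak_deriv D f g & weak_deriv D g h]].

End Functions.

(* [lead] indexes the half-lines; [src e] and [tgt e] are the vertices
   identified with the points [0] and [len e] of the internal edge [e]. *)
Record qgraph (R : realType) := QGraph {
  vtx : finType;
  iedge : finType;
  lead : finType;
  src : iedge -> vtx;
  tgt : iedge -> vtx;
  len : iedge -> R;
  root : lead -> vtx;
  ext : {set vtx};
  len_gt0 : forall e, 0 < len e;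
  no_loop : forall e, src e != tgt e;
  root_ext : forall l, root l \in ext;
  ext_root : forall v, v \in ext -> exists l, root l = v;
  attached : forall v, (exists e, src e = v \/ tgt e = v) \/
                       (exists l, root l = v)
}.

Section Graph.
Variables (R : realType) (G : qgraph R).

Local Notation mu := (@lebesgue_measure R).

Definition edge : finType := (iedge G + lead G)%type.

Definition edom (e : edge) : set R :=
  match e with
  | inl i => `[0, len i]
  | inr _ => `[0, +oo[
  end.

(* A function on the disjoint union of the edges; only the values of [f e] on
   [edom e] matter. *)
Definition gfun : Type := edge -> R -> R[i].

Implicit Types (f g h u w p : gfun) (v : vtx G) (z lam kap : R[i]).

Definition gscale z f : gfun := fun e x => z * f e x.
Definition gsub f g : gfun := fun e x => f e x - g e x.
Definition gopp f : gfun := fun e x => - f e x.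
Definition glin n (c : 'I_n -> R[i]) (b : 'I_n -> gfun) : gfun :=
  fun e x => \sum_(i < n) c i * b i e x.

Definition ae_eq f g : Prop :=
  forall e, {ae mu, forall x, edom e x -> f e x = g e x}.

Definition gL2 f : Prop := forall e, L2 (edom e) (f e).

Definition inner f g : R[i] :=
  \sum_(e : edge) cint (edom e) (fun x => f e x * conjc (g e x)).

Definition normsq f : R := complex.Re (inner f f).

(* The end [(i, false)] of an internal edge is at the point [0], the end
   [(i, true)] at the point [len i]. *)
Definition iend : finType := (iedge G * bool)%type.

Definition end_vtx (a : iend) : vtx G := if a.2 then tgt a.1 else src a.1.

Definition end_val f (a : iend) : R[i] :=
  f (inl a.1) (if a.2 then len a.1 else 0).

Definition end_deriv f (a : iend) : R[i] :=
  rderiv0 (fun t => f (inl a.1) (if a.2 then len a.1 - t else t)).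

Definition N_int f v : R[i] := \sum_(a : iend | end_vtx a == v) end_deriv f a.

Definition N_ext f v : R[i] :=
  \sum_(l : lead G | root l == v) rderiv0 (f (inr l)).

Definition N f v : R[i] := N_int f v + N_ext f v.

(* The functions [f] below are continuous on the closed edges, so values at
   the end points are the limits along the edges. *)
Definition D_int f v z : Prop := forall a, end_vtx a = v -> end_val f a = z.
Definition D_ext f v z : Prop :=
  forall l : lead G, root l = v -> f (inr l) 0 = z.

Definition continuous_on_edges f : Prop :=
  forall e, ccontinuous_on (edom e) (f e).

Definition gcontinuous f : Prop :=
  continuous_on_edges f /\ forall v, exists z, D_int f v z /\ D_ext f v z.

(* An operator in L^2 is given by its graph: [A f h] means that [f] is in the
   domain of [A] and [A f = h].  Here [f] is a representative of its L^2 class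
   that is continuous on every closed edge, and [h] is any representative. *)

Definition operator : Type := gfun -> gfun -> Prop.

Definition op_H : operator := fun f h =>
  [/\ forall e, W22_deriv2 (edom e) (f e) (gopp h e),
      gcontinuous f &
      forall v, N f v = 0].

(* The complex-scaled operator H(kap). *)
Definition op_Hs kap : operator := fun f h =>
  [/\ forall i : iedge G, W22_deriv2 (edom (inl i)) (f (inl i)) (gopp h (inl i)),
      forall l : lead G, exists q,
        W22_deriv2 (edom (inr l)) (f (inr l)) q /\
        {ae mu, forall x, edom (inr l) x ->
           h (inr l) x = - cexp (- (2%:R * kap)) * q x},
      continuous_on_edges f,
      forall v, v \notin ext G ->
        (exists z, D_int f v z) /\ N f v = 0 &
      forall v, v \in ext G ->
        (exists z z1, [/\ D_int f v z, D_ext f v z1 &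
                         z - cexp (- (kap / 2%:R)) * z1 = 0]) /\
        N_int f v + cexp (- (3%:R * kap / 2%:R)) * N_ext f v = 0].

(* Dimension modulo almost everywhere equality of a linear subspace of L^2. *)
Definition has_dim (S : gfun -> Prop) (n : nat) : Prop :=
  exists b : 'I_n -> gfun,
    [/\ forall i, S (b i),
        forall c, ae_eq (glin c b) (fun _ _ => 0) -> forall i, c i = 0 &
        forall f, S f -> exists c, ae_eq f (glin c b)].

Definition kernel (A : operator) lam : gfun -> Prop :=
  fun f => A f (gscale lam f).

Definition is_eigenvalue (A : operator) lam : Prop :=
  exists f, kernel A lam f /\ ~ ae_eq f (fun _ _ => 0).

Definition geo_mult (A : operator) lam (n : nat) : Prop :=
  has_dim (kernel A lam) n.

(* (z - A) u = f *)
Definition resolves (A : operator) z f u : Prop := A u (gsub (gscale z u) f).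

Definition in_resolvent_set (A : operator) z : Prop :=
  [/\ forall f, gL2 f -> exists u, resolves A z f u,
      forall u, kernel A z u -> ae_eq u (fun _ _ => 0) &
      exists C : R, forall f u, gL2 f -> resolves A z f u ->
        normsq u <= C * normsq f].

Definition circle lam (r t : R) : R[i] := lam + r%:C * cexp (0 +i* t).

(* [p = (2 pi i)^-1 \oint (z - A)^-1 f dz] over the circle of centre [lam] and
   radius [r], the L^2-valued integral being taken weakly;
   [dz = i * r * exp (i t) dt]. *)
Definition riesz (A : operator) lam (r : R) f p : Prop :=
  gL2 p /\
  exists u : R -> gfun,
    (forall t, 0 <= t <= 2%:R * pi -> resolves A (circle lam r t) f (u t)) /\
    forall g, gL2 g ->
      inner p g =
      (2%:R * pi%:C * (0 +i* 1))^-1 *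
      cint `[0, 2%:R * pi]
        (fun t => inner (u t) g * ((0 +i* 1) * r%:C * cexp (0 +i* t))).

Definition alg_mult (A : operator) lam (n : nat) : Prop :=
  exists r : R,
    [/\ 0 < r,
        forall z, 0 < `|z - lam| <= r%:C -> in_resolvent_set A z &
        has_dim (fun p => exists f, gL2 f /\ riesz A lam r f p) n].

Definition is_resonance (k : R[i]) : Prop :=
  k != 0 /\
  exists f,
    [/\ exists e x, edom e x /\ f e x != 0,
        forall e, exists q, weak_deriv (edom e) (f e) q /\
          weak_deriv (edom e) q (fun x => - (k ^+ 2 * f e x)),
        gcontinuous f,
        forall v, N f v = 0 &
        forall (l : lead G) x, 0 <= x ->
          f (inr l) x = f (inr l) 0 * cexp ((0 +i* 1) * k * x%:C)].

Definition admissible (k : R[i]) (theta : R) : Prop :=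
  0 < theta < pi /\
  (complex.Im k = 0 \/ 0 < complex.Im (k * cexp (0 +i* theta))).

Definition res_alg_mult (k : R[i]) (n : nat) : Prop :=
  forall theta, admissible k theta -> alg_mult (op_Hs (0 +i* theta)) (k ^+ 2) n.

Definition res_geo_mult (k : R[i]) (n : nat) : Prop :=
  forall theta, admissible k theta -> geo_mult (op_Hs (0 +i* theta)) (k ^+ 2) n.

End Graph.

(* Main.v *)
Require Import Defs.
From mathcomp Require Import all_boot all_order all_algebra.
From mathcomp Require Import all_classical all_reals all_analysis.
From mathcomp Require Import complex.
From mathcomp Require Import measurable_realfun ring lra.

Set Implicit Arguments.
Unset Strict Implicit.
Unset Printing Implicit Defensive.
Import Order.TTheory GRing.Theory Num.Theory.
Import numFieldNormedType.Exports.
Local Open Scope classical_set_scope.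
Local Open Scope ring_scope.
Local Open Scope complex_scope.

(* On a lead, for real nonzero [k], a resonance state is [f(0) e^{ikx}] and an L^2 solution for
   [H(i theta)] is [f(0) exp(i |k| e^{i theta} x)]. The imaginary part of the Lagrange identity on
   [G_0] then shows that the sum of [|f(0)|^2] over the leads vanishes. Hence resonance states and
   eigenfunctions of [H] and of all the [H(i theta)] for [k^2] vanish on the leads, where alone the
   problems differ, and they form one and the same finite-dimensional space [E].
   By Green's formula [E] is orthogonal to the range of [H(i theta) - k^2], so [E] reduces
   [H(i theta)]. On the orthogonal complement of [E] the operator [H(i theta) - z] is boundedly
   invertible for [z] near [k^2]: solving the equation on every edge by variation of constants
   turns this into a finite square linear system, bordered by a basis of [E]. The resolvent is thus
   [(z - k^2)^{-1}] on [E] and a convergent power series in [z - k^2] on the complement, whose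
   integral over a small circle is zero, so the Riesz projection has range [E]. *)

(** * Absolutely continuous functions on an interval *)

Section RealAC.
Variable R : realType.
Local Notation mu := (@lebesgue_measure R).
Local Notation mset D := (measurable (D : set (measurableTypeR R))).
Local Notation mfn D f := (measurable_fun (D : set (measurableTypeR R)) f).
Implicit Types (D : set R) (f g h : R -> R) (a b x y : R).

(** The operators are defined through weak derivatives and C^1 test functions, whereas the vertex
    conditions need end values of [f] and [f']. The du Bois-Reymond lemma bridges this: every
    function of a domain is an integral of its derivative, and then the product rule, the energy
    identities and Green's formula are available.

    [H(i theta)] is not symmetric, and only the vanishing of [E] on the leads removes the
    non-symmetric terms from Green's formula; as [k^2] is real, [E] then lies in the kernel of the
    adjoint too, which excludes generalized eigenvectors.

    The resolvent has no bound near [k^2], so the estimate is proved at [k^2] itself for the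
    bordered problem and then perturbed on the complement of [E]. For [z] near [k^2] the root of [z]
    close to [|k|] keeps the exponentials on the leads decaying.

    The integrand of a Riesz integral is any family of preimages, with no prescribed dependence on
    the parameter; its measurability and the value of the integral both come from uniform
    approximation by Taylor polynomials. All estimates concern squared norms, and each splitting of
    a sum costs a factor 2; this is the origin of the constants 4 and 8. *)

Definition rint D f := mu.-integrable D (EFin \o f).

Lemma rint_measurable D f : rint D f -> mfn D f.
Proof. by move=> /integrableP[/measurable_EFinP]. Qed.

Lemma rint_eq D f g : mset D -> (forall x, D x -> f x = g x) -> rint D f -> rint D g.
Proof.
move=> mD fg; apply: eq_integrable => // x /[!inE] Dx /=.
by rewrite fg.
Qed.

Lemma Rint_eq D f g : (forall x, D x -> f x = g x) ->
  \int[mu]_(x in D) f x = \int[mu]_(x in D) g x.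
Proof. by move=> fg; apply: eq_Rintegral => x; rewrite inE; exact: fg. Qed.

Lemma rintD D f g : mset D -> rint D f -> rint D g -> rint D (fun x => f x + g x).
Proof. by move=> mD fi gi; exact: (integrableD mD fi gi). Qed.

Lemma rintZ D (c : R) f : mset D -> rint D f -> rint D (fun x => c * f x).
Proof. by move=> mD fi; exact: (integrableZl mD c fi). Qed.

Lemma rintN D f : mset D -> rint D f -> rint D (fun x => - f x).
Proof.
move=> mD /(rintZ (-1) mD); apply: rint_eq => // x _; by rewrite mulN1r.
Qed.

Lemma rintB D f g : mset D -> rint D f -> rint D g -> rint D (fun x => f x - g x).
Proof. by move=> mD fi gi; apply: rintD => //; apply: rintN. Qed.

Lemma rintS D D' f : mset D -> mset D' -> D' `<=` D -> rint D f -> rint D' f.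
Proof. by move=> mD mD' sub; apply: integrableS. Qed.

Lemma rint0 D : rint D (fun=> 0).
Proof. exact: integrable0. Qed.

Lemma rint_dom D f g : mset D -> mfn D f -> rint D g ->
  (forall x, D x -> `|f x| <= g x) -> rint D f.
Proof.
move=> mD mf gi fg; apply: (le_integrable mD _ _ gi); first exact/measurable_EFinP.
move=> x Dx /=; rewrite lee_fin; apply: (le_trans (fg x Dx)); exact: ler_norm.
Qed.

Lemma rint_abs D f : rint D f -> rint D (fun x => `|f x|).
Proof. by move=> H; exact: (integrable_abse H). Qed.

Lemma rintM_bdd D f g (M : R) : mset D -> mfn D g ->
  (forall x, D x -> `|g x| <= M) -> rint D f -> rint D (fun x => f x * g x).
Proof.
move=> mD mg gM fi; apply: (@rint_dom _ _ (fun x => M * `|f x|)) => //.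
- by apply: measurable_funM => //; exact: rint_measurable.
- by apply: rintZ => //; exact: rint_abs.
- by move=> x Dx; rewrite normrM mulrC ler_wpM2r ?gM.
Qed.

Lemma rint_cst a b (c : R) : rint `[a, b] (fun=> c).
Proof.
apply: continuous_compact_integrable; first exact: segment_compact.
by move=> x; apply: cvg_cst.
Qed.

Lemma rint_cont a b f : {within `[a, b], continuous f} -> rint `[a, b] f.
Proof. by apply: continuous_compact_integrable; exact: segment_compact. Qed.

Lemma rint_restrict D f : mset D -> rint D f <-> rint setT (f \_ D).
Proof.
move=> mD; have := @integrable_mkcond _ _ _ mu D (EFin \o f) mD.
by rewrite restrict_EFin.
Qed.

Lemma rint_patch D f : mset D -> rint setT f -> rint setT (f \_ D).
Proof.
by move=> mD fi; apply: (rint_restrict f mD).1; apply: (rintS measurableT mD _ fi).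
Qed.

(** The two iterated integrals of this kernel, cut off at the diagonal, are the two sides of
    integration by parts. *)
Definition lower_ker f g (z : R * R) := f z.1 * g z.2 * (z.2 <= z.1)%R%:R.

(** Tonelli: without the indicator the inner integral is at most [|f x|] times the L^1 norm of
    [g]. *)
Lemma integrable_lower_ker f g : rint setT f -> rint setT g ->
  (mu \x mu)%E.-integrable setT (EFin \o lower_ker f g).
Proof.
move=> fi gi.
set h := lower_ker f g.
have mf := rint_measurable fi; have mg := rint_measurable gi.
have mh : measurable_fun setT h.
  apply: measurable_funM; first apply: measurable_funM.
  - by apply: measurableT_comp.
  - by apply: measurableT_comp.
  - have := @measurable_fun_ler _ _ _ setT (fun z : R * R => z.2) (fun z => z.1)
      (@measurable_snd _ _ R R) (@measurable_fst _ _ R R).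
    move=> H; rewrite (_ : (fun z : R * R => _) = (fun b : bool => b%:R : R) \o (fun z : R * R => z.2 <= z.1)) //.
    by apply: measurableT_comp => //; exact: measurable_fun_bool.
apply/integrable12ltyP; first exact/measurable_EFinP.
have /integrableP[_ fI] := fi; have /integrableP[_ gI] := gi.
pose I := fine (\int[mu]_y `|(g y)%:E|).
have IE : (\int[mu]_y `|(g y)%:E|)%E = I%:E.
  by rewrite fineK// ge0_fin_numE// integral_ge0.
have I0 : 0 <= I by rewrite fine_ge0// integral_ge0.
have mabs (k : R -> R) : mfn setT k -> measurable_fun (setT : set (measurableTypeR R)) (fun x => `|(k x)%:E|%E).
  by move=> mk; apply: measurableT_comp => //; exact/measurable_EFinP.
have bd x : (\int[mu]_y `|(EFin \o h) (x, y)| <= `|(f x)%:E| * I%:E)%E.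
  rewrite -IE -ge0_integralZl//; last exact: mabs.
  apply: ge0_le_integral => //.
  - apply: measurableT_comp => //; apply/measurable_EFinP.
    by apply: (measurableT_comp mh); exact: measurable_pair1.
  - by apply: measurable_funeM; exact: mabs.
  - move=> y _; rewrite /h /lower_ker /= -EFinM lee_fin !normrM.
    by rewrite ler_piMr ?mulr_ge0 //; case: (y <= x)%R => /=; rewrite ?normr1 ?normr0 ?ler01 ?lexx.
apply: (@le_lt_trans _ _ (\int[mu]_x (`|(f x)%:E| * I%:E))%E).
  apply: ge0_le_integral => //.
  - by move=> x _; apply: integral_ge0.
  - apply: (@measurable_fun_fubini_tonelli_F _ _ _ _ R mu (fun z => `|(EFin \o h) z|%E)) => //.
    by apply: measurableT_comp => //; exact/measurable_EFinP.
  - have mi : mfn setT (fun x => `|f x| * I).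
      by apply: measurable_funM => //; apply: measurableT_comp.
    by apply/measurable_EFinP.
rewrite ge0_integralZr//; last exact: mabs.
by rewrite muleC lte_mul_pinfty ?lee_fin.
Qed.

Lemma lower_kerE f g : rint setT g -> (fun x => \int[mu]_y (lower_ker f g (x, y))%:E)%E =
    (fun x => (f x * \int[mu]_(t in `]-oo, x]) g t)%:E).
Proof.
move=> gi; apply/funext => x.
rewrite (Rintegral_mkcond).
rewrite -RintegralZl//; last first.
  by exact: rint_patch.
rewrite fineK; last first.
  apply: integrable_fin_num => //.
  by apply: rintZ => //; exact: rint_patch.
apply: eq_integral => y _; rewrite /= /lower_ker /= patchE mem_setE /= in_itv /=.
by case: ifP => yx; rewrite ?mulr1 ?mulr0.
Qed.

(* Fubini on the half-plane [y <= x]. *)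
Lemma fubini_ibp f g : rint setT f -> rint setT g ->
  [/\ rint setT (fun x => f x * \int[mu]_(t in `]-oo, x]) g t),
      rint setT (fun x => g x * \int[mu]_(t in `]-oo, x]) f t) &
  \int[mu]_x (f x * \int[mu]_(t in `]-oo, x]) g t) =
  (\int[mu]_x f x) * (\int[mu]_x g x) -
  \int[mu]_x (g x * \int[mu]_(t in `]-oo, x]) f t)].
Proof.
move=> fi gi; set h := lower_ker f g.
have hi := integrable_lower_ker fi gi.
have fG : rint setT (fun x => f x * \int[mu]_(t in `]-oo, x]) g t).
  by have := integrable_fubini_F hi; rewrite /fubini_F lower_kerE.
have gF : rint setT (fun x => g x * \int[mu]_(t in `]-oo, x]) f t).
  by have := integrable_fubini_F (integrable_lower_ker gi fi); rewrite /fubini_F lower_kerE.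
split => //; have := Fubini hi; rewrite lower_kerE//.
have -> : (fun y => \int[mu]_x (EFin \o lower_ker f g) (x, y))%E =
    (fun y => (g y * (\int[mu]_x f x - \int[mu]_(t in `]-oo, y]) f t))%:E).
  apply/funext => y.
  have -> : \int[mu]_x f x - \int[mu]_(t in `]-oo, y]) f t =
      \int[mu]_(t in `[y, +oo[) f t.
    rewrite -Rintegral_itv_obnd_cbnd; last by apply: (@rintS setT) fi.
    have := @Rintegral_itvB R f -oo%O +oo%O y.
    rewrite set_itvNyy => ->//.
  rewrite (Rintegral_mkcond).
  rewrite -RintegralZl//; last first.
    by exact: rint_patch.
  rewrite fineK; last first.
    apply: integrable_fin_num => //.
    by apply: rintZ => //; exact: rint_patch.
  apply: eq_integral => x _; rewrite /= /lower_ker /= patchE mem_setE /= in_itv /= andbT.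
  by case: ifP => yx; rewrite ?mulr1 ?mulr0// mulrC.
move=> /(congr1 fine) E.
transitivity (\int[mu]_x (g x * (\int[mu]_x f x - \int[mu]_(t in `]-oo, x]) f t))) => //.
under eq_Rintegral do rewrite mulrBr.
rewrite RintegralB//; last first.
  by apply: (rint_eq _ _ (rintZ (\int[mu]_x f x) measurableT gi)) => // x _; rewrite mulrC.
by rewrite RintegralZr// mulrC.
Qed.

(** For the extensions by zero, the primitive from [-oo] agrees on [[0, b]] with the primitive from
    0, so this is [fubini_ibp]. *)
Lemma parts_from0 f g b : rint `[0, b] f -> rint `[0, b] g ->
  let F x := \int[mu]_(t in `[0, x]) f t in
  let G x := \int[mu]_(t in `[0, x]) g t in
  [/\ rint `[0, b] (fun x => f x * G x), rint `[0, b] (fun x => g x * F x) &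
      \int[mu]_(x in `[0, b]) (f x * G x) + \int[mu]_(x in `[0, b]) (g x * F x)
      = F b * G b].
Proof.
move=> fi gi F G.
have fi' := (rint_restrict f (measurable_itv `[0, b])).1 fi.
have gi' := (rint_restrict g (measurable_itv `[0, b])).1 gi.
have E (k : R -> R) x : 0 <= x <= b -> \int[mu]_(t in `]-oo, x]) (k \_ `[0, b]) t = \int[mu]_(t in `[0, x]) k t.
  move=> /andP[x0 xb]; rewrite Rintegral_mkcond [RHS]Rintegral_mkcond.
  apply: eq_Rintegral => t _; rewrite !patchE !mem_setE !in_itv /=.
  case: (leP t x) => tx /=; last by rewrite andbF.
  by rewrite (le_trans tx xb).
have P (k l : R -> R) : (fun x => (k \_ `[0, b]) x * \int[mu]_(t in `]-oo, x]) (l \_ `[0, b]) t) =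
      (fun x => k x * \int[mu]_(t in `[0, x]) l t) \_ `[0, b].
  apply/funext => x; rewrite !patchE mem_setE in_itv /=.
  by case: ifPn => [xb|]; rewrite ?mul0r ?E.
have [A B C] := fubini_ibp fi' gi'.
move: A B C; rewrite !P -!Rintegral_mkcond => A B C; split.
- exact: (rint_restrict _ (measurable_itv `[0, b])).2 A.
- exact: (rint_restrict _ (measurable_itv `[0, b])).2 B.
- by rewrite C subrK.
Qed.

(* [f] is absolutely continuous on [D], an interval starting at [0], with derivative [g] a.e. *)
Definition acR D f g := forall x, D x ->
  rint `[0, x] g /\ f x = f 0 + \int[mu]_(t in `[0, x]) g t.

(** An extended-real right end lets internal edges and leads share one theory. *)
Definition hdom D := exists L : \bar R, (0 < L)%E /\ D = [set x | 0 <= x /\ (x%:E <= L)%E].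

Lemma hdom_cc b : 0 < b -> hdom `[0, b].
Proof.
move=> b0; exists b%:E; split => //.
by apply/seteqP; split => x /=; rewrite in_itv /= lee_fin; [move/andP|move=> [-> ->]].
Qed.

Lemma hdom_cy : hdom `[0, +oo[.
Proof.
exists +oo%E; split => //.
by apply/seteqP; split => x /=; rewrite in_itv /= leey andbT => // -[].
Qed.

Lemma hdom0 D : hdom D -> D 0.
Proof. by move=> [L [L0 ->]]; split => //; exact: ltW. Qed.

Lemma hdom_ge0 D x : hdom D -> D x -> 0 <= x.
Proof. by move=> [L [L0 ->]] []. Qed.

Lemma hdom_down D x y : hdom D -> D y -> 0 <= x -> x <= y -> D x.
Proof.
move=> [L [L0 ->]] [y0 yL] x0 xy; split => //.
by apply: le_trans yL; rewrite lee_fin.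
Qed.

Lemma hdom_sub D y : hdom D -> D y -> `[0, y] `<=` D.
Proof. by move=> hD Dy x /=; rewrite in_itv /= => /andP[]; exact: hdom_down. Qed.

Lemma hdom_pos D : hdom D -> exists b, 0 < b /\ D b.
Proof.
move=> [L [L0 ->]]; case: L L0 => [r r0| _|//].
- by exists r; rewrite -lte_fin; split => //; split => //; apply: ltW.
- by exists 1; split => //; split => //; rewrite leey.
Qed.

Lemma hdom_itv D : hdom D -> (exists b, 0 < b /\ D = `[0, b]%classic) \/ D = `[0, +oo[%classic.
Proof.
move=> [[r| |] [L0 ->]] //.
- left; exists r; rewrite -lte_fin; split => //.
  by apply/seteqP; split => x /=; rewrite in_itv /= lee_fin; [move=> [-> ->]|move/andP].
- right; apply/seteqP; split => x /=; rewrite in_itv /= ?leey andbT => // -[]//.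
Qed.

Lemma hdom_meas D : hdom D -> mset D.
Proof. by move=> /hdom_itv[[b [_ ->]]|->]; exact: measurable_itv. Qed.

Lemma hdom_int D : hdom D -> forall x, D° x <-> 0 < x /\ exists y, D y /\ x < y.
Proof.
move=> /hdom_itv[[b [b0 ->]]|->] x; rewrite ?interior_itv_bnd ?interior_itv_bndy //= !in_itv /= ?andbT; split.
- by move=> /andP[x0 xb]; split => //; exists b; rewrite in_itv /= lexx ltW.
- by move=> [-> [y []]]; rewrite in_itv /= => /andP[_ yb] xy; exact: lt_le_trans xy yb.
- by move=> x0; split => //; exists (x + 1); rewrite in_itv /= andbT addr_ge0 ?ltW //= ?ltr_pwDr.
- by case.
Qed.

Lemma acR_intg D f g x : acR D f g -> D x -> rint `[0, x] g.
Proof. by move=> H /H[]. Qed.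

Lemma acRD D f g f' g' : acR D f g -> acR D f' g' ->
  acR D (fun x => f x + f' x) (fun x => g x + g' x).
Proof.
move=> H H' x Dx; have [gi fE] := H x Dx; have [gi' fE'] := H' x Dx.
split; first exact: rintD.
by rewrite fE fE' RintegralD// addrACA.
Qed.

Lemma acRZ D (c : R) f g : acR D f g -> acR D (fun x => c * f x) (fun x => c * g x).
Proof.
move=> H x Dx; have [gi fE] := H x Dx.
split; first exact: rintZ.
by rewrite fE RintegralZl// mulrDr.
Qed.

Lemma acRN D f g : acR D f g -> acR D (fun x => - f x) (fun x => - g x).
Proof.
have E k : (fun x => -1 * k x) = (fun x => - k x) :> (R -> R).
  by apply/funext => x; rewrite mulN1r.
by move=> /(acRZ (-1)); rewrite !E.
Qed.

Lemma acRB D f g f' g' : acR D f g -> acR D f' g' ->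
  acR D (fun x => f x - f' x) (fun x => g x - g' x).
Proof. by move=> H H'; apply: acRD => //; exact: acRN. Qed.

Lemma acR_cst D (c : R) : acR D (fun=> c) (fun=> 0).
Proof. by move=> x Dx; split; [exact: rint0|rewrite Rintegral_cst// mul0r addr0]. Qed.

Lemma acR_eq D f g f' g' : hdom D -> (forall x, D x -> f x = f' x) -> (forall x, D x -> g x = g' x) ->
  acR D f g -> acR D f' g'.
Proof.
move=> hD ff gg H x Dx; have [gi fE] := H x Dx.
have gg' : forall t, `[0, x]%classic t -> g t = g' t.
  by move=> t xt; apply: gg; apply: (hdom_sub hD Dx).
split; first exact: (rint_eq (measurable_itv _) gg').
by rewrite -(ff x Dx) -(ff 0 (hdom0 hD)) fE (Rint_eq gg').
Qed.

(** Each factor is its value at 0 plus a primitive: the product of the primitives is [parts_from0],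
    and the remaining terms are linear. *)
Lemma acRM D f g f' g' : hdom D -> acR D f g -> acR D f' g' ->
  acR D (fun x => f x * f' x) (fun x => g x * f' x + f x * g' x).
Proof.
move=> hD H H' x Dx; have [gi fE] := H x Dx; have [gi' fE'] := H' x Dx.
have [A B C] := parts_from0 gi gi'.
have EE t : `[0, x]%classic t -> g t * f' t + f t * g' t =
   g t * (\int[mu]_(s in `[0, t]) g' s) + g' t * (\int[mu]_(s in `[0, t]) g s) + (f' 0 * g t + f 0 * g' t).
  move=> xt; have Dt := hdom_sub hD Dx xt.
  have [_ ->] := H t Dt; have [_ ->] := H' t Dt; ring.
have I1 := rintD (measurable_itv _) A B.
have I2 := rintD (measurable_itv _) (rintZ (f' 0) (measurable_itv _) gi) (rintZ (f 0) (measurable_itv _) gi').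
split.
  by apply: (rint_eq _ (fun t xt => esym (EE t xt))) => //; apply: rintD.
rewrite (Rint_eq EE).
rewrite (RintegralD _ I1 I2)// (RintegralD _ A B)// C.
rewrite (RintegralD _ (rintZ (f' 0) (measurable_itv _) gi) (rintZ (f 0) (measurable_itv _) gi'))//.
rewrite !RintegralZl// fE fE'; ring.
Qed.

Lemma acR_C1 D f g : hdom D -> (forall x, is_derive x 1 f (g x)) -> continuous g -> acR D f g.
Proof.
move=> hD df cg x Dx.
have cgw : {within `[0, x], continuous g} by apply: continuous_subspaceT.
split; first exact: rint_cont.
have := hdom_ge0 hD Dx; rewrite le_eqVlt => /predU1P[<-|x0].
  by rewrite set_itv1 Rintegral_set1 addr0.
have cf : continuous f.
  by move=> y; apply: differentiable_continuous; apply/derivable1_diffP; apply: ex_derive.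
rewrite /Rintegral (@continuous_FTC2 _ g f _ _ x0 cgw).
- by rewrite -EFinB /= addrC subrK.
- split; first by move=> y _; apply: ex_derive.
  + by apply: cvg_at_right_filter; exact: cf.
  + by apply: cvg_at_left_filter; exact: cf.
- by move=> y _; rewrite derive1E; apply: derive_val.
Qed.

Lemma acR_cont D f g : hdom D -> acR D f g -> {within D, continuous f}.
Proof.
move=> hD H.
have K b : 0 < b -> D b -> {within `[0, b], continuous f}.
  move=> b0 Db.
  have c1 := parameterized_integral_continuous (ltW b0) (acR_intg H Db).
  apply: (@subspace_eq_continuous _ _ _ (fun x => f 0 + \int[mu]_(t in `[0, x]) g t)).
    by move=> x; rewrite inE => xb; have [_ <-] := H x (hdom_sub hD Db xb).
  by move=> x; apply: cvgD; [exact: cvg_cst|exact: c1].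
have [[b [b0 E]]|E] := hdom_itv hD; rewrite E.
  by apply: K => //; rewrite E /= in_itv /= ltW //=.
have K' x : 0 < x -> {within `[0, x], continuous f}.
  by move=> x0; apply: K => //; rewrite E /= in_itv /= ltW.
apply/continuous_within_itvcyP; split.
  move=> x; rewrite in_itv /= andbT => x0.
  have x1 : 0 < x + 1 by rewrite addr_gt0.
  have /(continuous_within_itvP _ x1)[+ _ _] := K' _ x1.
  by apply; rewrite in_itv /= x0 ltrDl ltr01.
by have /(continuous_within_itvP _ ltr01)[] := K' _ ltr01.
Qed.

Lemma acR_diff D f g x y : hdom D -> acR D f g -> D y -> 0 <= x -> x <= y ->
  rint `]x, y] g /\ f y - f x = \int[mu]_(t in `]x, y]) g t.
Proof.
move=> hD H Dy x0 xy; have [gi ->] := H y Dy; have [_ ->] := H x (hdom_down hD Dy x0 xy).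
split.
  apply: rintS gi => // t /=; rewrite !in_itv /= => /andP[xt ->]; rewrite andbT.
  exact: ltW (le_lt_trans x0 xt).
rewrite -(Rintegral_itvB (f:=g) (a:=BLeft 0) (b:=BRight y)) //.
by rewrite opprD addrACA subrr add0r.
Qed.

Lemma Rint_cst_oc (k x y : R) : x <= y -> \int[mu]_(t in `]x, y]) k = k * (y - x).
Proof.
move=> xy.
have E : mu `]x, y]%classic = (y - x)%:E.
  by rewrite lebesgue_measure_itv /= lte_fin; case: ltgtP xy => // ->; rewrite subrr.
rewrite (@Rintegral_cst _ _ _ mu `]x, y]%classic (measurable_itv _) k).
by transitivity (k * fine (mu `]x, y]%classic)) => //; rewrite E.
Qed.

(** Replaces the mean value theorem: [c] is the value of a continuous derivative at some point, and
    [e] its oscillation nearby. *)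
Lemma acR_incr D f g (c e : R) x y : hdom D -> acR D f g -> D y -> 0 <= x -> x <= y ->
  (forall t, x <= t <= y -> `|g t - c| <= e) ->
  `|f y - f x - c * (y - x)| <= e * (y - x).
Proof.
move=> hD H Dy x0 xy ge.
have [gi ->] := acR_diff hD H Dy x0 xy.
have ci (k : R) : rint `]x, y] (fun=> k).
  apply: rintS (rint_cst x y k) => // t /=.
  by rewrite !in_itv /= => /andP[/ltW -> ->].
rewrite -(Rint_cst_oc c xy) -RintegralB//; last exact: ci.
apply: le_trans (le_normr_Rintegral _ _) _ => //; first exact: rintB.
rewrite -(Rint_cst_oc e xy); apply: le_Rintegral => //.
- by apply: rint_abs; apply: rintB.
- exact: ci.
- by move=> t /=; rewrite in_itv /= => /andP[/ltW xt ty]; apply: ge; rewrite xt.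
Qed.

Lemma within_near D f x (e : R) : {within D, continuous f} -> D x -> 0 < e ->
  exists d : R, 0 < d /\ forall t, D t -> `|t - x| < d -> `|f t - f x| <= e.
Proof.
move=> cf Dx e0.
have : f t @[t --> within D (nbhs x)] --> f x by move: (cf x); rewrite nbhs_subspace_in.
move=> /cvgrPdist_le /(_ e e0); rewrite near_withinE => -[d /= d0 H].
exists d; split => // t Dt td; rewrite distrC.
by apply: H => //=; rewrite distrC.
Qed.

Lemma acR_rderiv D f g : hdom D -> acR D f g -> {within D, continuous g} ->
  (h^-1 * (f h - f 0)) @[h --> (0 : R)^'+] --> g 0.
Proof.
move=> hD H cg; apply/cvgrPdist_le => e e0.
have [d [d0 K]] := within_near cg (hdom0 hD) e0.
have [b [b0 Db]] := hdom_pos hD.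
near=> h.
have h0 : 0 < h by near: h; exact: nbhs_right_gt.
have hb : h <= b by near: h; exact: nbhs_right_le.
have hd : h < d by near: h; exact: nbhs_right_lt.
have K' t : 0 <= t <= h -> `|g t - g 0| <= e.
  move=> /andP[t0 th]; apply: K; first by apply: hdom_down Db t0 (le_trans th hb).
  by rewrite subr0 ger0_norm// (le_lt_trans th).
have := acR_incr hD H (hdom_down hD Db (ltW h0) hb) (lexx _) (ltW h0) K'.
rewrite subr0 => H1.
rewrite distrC -[g 0](mulfK (lt0r_neq0 h0)) [_ / h]mulrC -mulrBr normrM gtr0_norm ?invr_gt0//.
by rewrite mulrC ler_pdivrMr.
Unshelve. all: by end_near.
Qed.

Lemma acR_lderiv b f g : 0 < b -> acR `[0, b] f g -> {within `[0, b], continuous g} ->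
  (h^-1 * (f (b - h) - f b)) @[h --> (0 : R)^'+] --> - g b.
Proof.
move=> b0 H cg; apply/cvgrPdist_le => e e0.
have hD := hdom_cc b0.
have Db : `[0, b]%classic b by rewrite /= in_itv /= lexx ltW.
have [d [d0 K]] := within_near cg Db e0.
near=> h.
have h0 : 0 < h by near: h; exact: nbhs_right_gt.
have hb : h <= b by near: h; exact: nbhs_right_le.
have hd : h < d by near: h; exact: nbhs_right_lt.
have bh0 : 0 <= b - h by rewrite subr_ge0.
have K' t : b - h <= t <= b -> `|g t - g b| <= e.
  move=> /andP[t0 tb]; apply: K; first by apply: hdom_down Db _ tb => //; apply: le_trans t0.
  by rewrite distrC ger0_norm ?subr_ge0//; apply: le_lt_trans hd; rewrite lerBlDl -lerBlDr.
have bhb : b - h <= b by rewrite gerBl ltW.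
have := acR_incr hD H Db bh0 bhb K'.
rewrite opprB addrCA subrr addr0 => H1.
rewrite -opprD normrN.
rewrite -[g b](mulfK (lt0r_neq0 h0)) [_ / h]mulrC -mulrDr normrM gtr0_norm ?invr_gt0//.
rewrite mulrC ler_pdivrMr// (_ : _ + _ = - (f b - f (b - h) - g b * h)) ?normrN //; ring.
Unshelve. all: by end_near.
Qed.

End RealAC.

(** * Weak derivatives *)

Section WeakDeriv.
Variable R : realType.
Local Notation mu := (@lebesgue_measure R).
Local Notation mset D := (measurable (D : set (measurableTypeR R))).
Local Notation mfn D f := (measurable_fun (D : set (measurableTypeR R)) f).
Implicit Types (D : set R) (f g h phi psi : R -> R) (a b x y : R).

Lemma Rdominated_cvg D (u : nat -> R -> R) f g : mset D ->
  (forall n, mfn D (u n)) -> rint D g -> (forall n x, D x -> `|u n x| <= g x) ->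
  (forall x, D x -> u n x @[n --> \oo] --> f x) ->
  rint D f /\ \int[mu]_(x in D) u n x @[n --> \oo] --> \int[mu]_(x in D) f x.
Proof.
move=> mD mu_ gi ug uf.
have mf : mfn D f by apply: measurable_fun_cvg uf.
have [] := @dominated_convergence _ _ _ mu D mD (fun n x => (u n x)%:E) (EFin \o f) (EFin \o g).
- by move=> n; exact/measurable_EFinP.
- exact/measurable_EFinP.
- by apply: aeW => x Dx /=; apply: cvg_EFin; [exact: nearW|exact: uf].
- exact: gi.
- by apply: aeW => x n Dx /=; rewrite lee_fin; exact: ug.
move=> fi _ lim; split => //.
apply: fine_cvg; rewrite fineK//.
exact: integrable_fin_num.
Qed.

Lemma derive1_cst_near phi x (c : R) : (\forall y \near x, phi y = c) -> derive1 phi x = 0.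
Proof.
move=> H; rewrite derive1E (@near_eq_derive _ _ _ phi (cst c)) ?oner_neq0 //.
exact: derive_cst.
Qed.

(** The support is compact in the interior, so after a slight enlargement [phi] vanishes in a
    neighbourhood of every point outside, and its derivative vanishes there too. *)
Lemma test_fun_out D phi : hdom D -> test_fun D phi ->
  exists a b, [/\ 0 < a, D b & forall x, ~ (a <= x < b) -> phi x = 0 /\ derive1 phi x = 0].
Proof.
move=> hD [dphi cphi [a [b [ab phi0]]]].
have [b0 [b00 Db0]] := hdom_pos hD.
(* If the given interval is empty, [phi] is identically zero and any bounds will do. *)
have [ba|ab'] := ltP b a.
  have z x : phi x = 0.
    by apply: phi0; apply/negP => /andP[/le_trans H /H]; rewrite leNgt ba.
  exists 1, b0; split => // x _; split => //.
  by apply: (@derive1_cst_near _ _ 0); near do exact: z.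
have /(hdom_int hD)[a0 _] : D° a by apply: ab; rewrite /= in_itv /= lexx.
have /(hdom_int hD)[_ [e [De be]]] : D° b by apply: ab; rewrite /= in_itv /= lexx ab'.
exists (a / 2), e; split => //; first by rewrite divr_gt0.
move=> x xn.
have xo : x < a \/ b < x.
  have [xa|ax] := ltP x a; first by left.
  right; rewrite ltNge; apply/negP => xb; apply: xn.
  by rewrite (le_lt_trans xb be) andbT (le_trans _ ax)// ler_pdivrMr// ler_pMr// ler1n.
split.
  by apply: phi0; apply/negP => /andP[ax xb]; case: xo; rewrite ltNge ?ax ?xb.
apply: (@derive1_cst_near _ _ 0); case: xo => xo.
- near=> y; apply: phi0; apply/negP => /andP[ay _].
  by move: ay; rewrite leNgt => /negP; apply; near: y; exact: lt_nbhsl.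
- near=> y; apply: phi0; apply/negP => /andP[_ ay].
  by move: ay; rewrite leNgt => /negP; apply; near: y; exact: lt_nbhsr.
Unshelve. all: by end_near.
Qed.

Definition weakR D f g := forall phi, test_fun D phi ->
  \int[mu]_(x in D) (f x * derive1 phi x) = - \int[mu]_(x in D) (g x * phi x).

Lemma Rint_trunc D b f : hdom D -> D b -> (forall x, b < x -> f x = 0) ->
  \int[mu]_(x in D) f x = \int[mu]_(x in `[0, b]) f x.
Proof.
move=> hD Db f0; rewrite Rintegral_mkcond [RHS]Rintegral_mkcond.
apply: Rint_eq => x _; rewrite !patchE mem_setE in_itv /=.
case: ifPn => [|/negP xD]; first rewrite inE => Dx.
  by rewrite (hdom_ge0 hD Dx) /=; case: leP => // /f0.
case: ifPn => // xb; exfalso; apply: xD; rewrite inE.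
by apply: (hdom_sub hD Db); rewrite /= in_itv.
Qed.

Lemma test_fun_cont D phi : test_fun D phi -> continuous phi.
Proof. by case=> H _ _ y; apply: differentiable_continuous; apply/derivable1_diffP; exact: H. Qed.

Lemma cont_bdd b g : {within `[0, b], continuous g} -> exists M, forall x, `[0, b]%classic x -> `|g x| <= M.
Proof.
move=> cg; have [b0|b0] := leP 0 b; last first.
  by exists 0 => x /=; rewrite in_itv /= => /andP[x0 xb]; move: (lt_le_trans b0 x0); rewrite ltNge xb.
have cn : {within `[0, b], continuous (fun x => `|g x|)}.
  by move=> x; apply: cvg_norm; exact: cg.
have [c _ H] := EVT_max b0 cn.
by exists `|g c| => x; apply: H.
Qed.

Lemma rintM_cont b f g : rint `[0, b] f -> {within `[0, b], continuous g} -> rint `[0, b] (fun x => f x * g x).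
Proof.
move=> fi cg; have [M HM] := cont_bdd cg.
apply: rintM_bdd HM fi => //.
exact: subspace_continuous_measurable_fun.
Qed.

(** The product rule for [f * phi] on [[0, b]], where [phi] vanishes at both ends. *)
Lemma acR_weak D f g : hdom D -> acR D f g -> weakR D f g.
Proof.
move=> hD H phi tphi.
have [a [b [a0 Db out]]] := test_fun_out hD tphi.
have cphi := test_fun_cont tphi.
have [dphi cphi' _] := tphi.
have outb x : b < x -> phi x = 0 /\ derive1 phi x = 0.
  by move=> bx; apply: out => /andP[_ xb]; move: (lt_trans bx xb); rewrite ltxx.
rewrite (Rint_trunc hD Db) => [|x /outb[_ ->]]; last by rewrite mulr0.
rewrite (Rint_trunc hD Db) => [|x /outb[-> _]]; last by rewrite mulr0.
have aphi : acR D phi (derive1 phi).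
  by apply: acR_C1 => // x; rewrite derive1E; apply: derivableP; exact: dphi.
have [I E] := acRM hD H aphi Db.
have [p0 _] : phi 0 = 0 /\ derive1 phi 0 = 0.
  by apply: out => /andP[H0 _]; move: a0; rewrite ltNge H0.
have [pb _] : phi b = 0 /\ derive1 phi b = 0 by apply: out => /andP[_]; rewrite ltxx.
have gi := acR_intg H Db.
have I1 : rint `[0, b] (fun x => g x * phi x).
  by apply: rintM_cont => //; exact: continuous_subspaceT.
have I2 : rint `[0, b] (fun x => f x * derive1 phi x).
  apply: rintM_cont; last exact: continuous_subspaceT.
  apply: rint_cont; apply: continuous_subspaceW (acR_cont hD H).
  exact: hdom_sub.
move: E; rewrite RintegralD// p0 pb !mulr0 add0r => E.
by apply/eqP; rewrite -subr_eq0 opprK addrC -E.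
Qed.

(** The zero mean makes the primitive vanish to the right of [b], which gives it compact support. *)
Lemma test_fun_primitive D psi a b : continuous psi -> `[a, b] `<=` D° ->
  (forall x, ~~ (a <= x <= b) -> psi x = 0) -> \int[mu]_x psi x = 0 ->
  exists phi, test_fun D phi /\ derive1 phi = psi.
Proof.
move=> cpsi sub psi0 int0.
have pi : rint setT psi.
  have := (rint_restrict psi (measurable_itv `[a, b])).1 (rint_cont (@continuous_subspaceT _ _ _ _ cpsi)).
  apply: rint_eq => // x _; rewrite patchE mem_setE in_itv /=.
  by case: ifPn => // /psi0.
pose phi x := \int[mu]_(t in `]-oo, x]) psi t.
have piS (A : set R) : mset A -> rint A psi by move=> mA; apply: rintS pi.
have dphi x : derivable phi x 1 /\ derive1 phi x = psi x.
  have xx : x < x + 1 by rewrite ltrDl.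
  exact: (@continuous_FTC1 R psi -oo%O x _ xx (piS _ (measurable_itv _)) (ltNyr _) (cpsi x)).
have dE : derive1 phi = psi by apply/funext => x; have [] := dphi x.
exists phi; split => //; split => //.
- by move=> x; have [] := dphi x.
- by rewrite dE.
exists a, b; split => // x.
rewrite negb_and -!ltNge => /orP[xa|bx].
- rewrite /phi (@Rint_eq _ _ _ (fun=> 0)); first by rewrite Rintegral_cst// mul0r.
  move=> t /=; rewrite in_itv /= => tx; apply: psi0.
  by apply/negP => /andP[/le_trans /(_ tx)]; rewrite leNgt xa.
- have := @Rintegral_itvB R psi -oo%O +oo%O x.
  rewrite set_itvNyy int0 sub0r => /(_ pi erefl erefl) E.
  apply/eqP; rewrite -oppr_eq0 /phi E; apply/eqP.
  rewrite (@Rint_eq _ _ _ (fun=> 0)); first by rewrite Rintegral_cst// mul0r.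
  move=> t /=; rewrite in_itv /= andbT => xt; apply: psi0.
  by apply/negP => /andP[_ tb]; move: (lt_trans bx xt); rewrite ltNge tb.
Qed.

End WeakDeriv.

(** * The du Bois-Reymond lemma *)

Section DuBoisReymond.
Variable R : realType.
Local Notation mu := (@lebesgue_measure R).
Local Notation mset D := (measurable (D : set (measurableTypeR R))).
Local Notation mfn D f := (measurable_fun (D : set (measurableTypeR R)) f).
Implicit Types (D : set R) (f g h phi psi F : R -> R) (a b c d e x y : R).

Lemma ae_imp (P Q : R -> Prop) : (forall x, P x -> Q x) ->
  {ae mu, forall x, P x} -> {ae mu, forall x, Q x}.
Proof. by move=> PQ; apply: filterS => //; exact: (ae_filter_ringOfSetsType mu). Qed.

Lemma ae_imp2 (P Q S : R -> Prop) : (forall x, P x -> Q x -> S x) ->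
  {ae mu, forall x, P x} -> {ae mu, forall x, Q x} -> {ae mu, forall x, S x}.
Proof. by move=> PQ; apply: filterS2 => //; exact: (ae_filter_ringOfSetsType mu). Qed.

(** A trapezoid with sides of slope [n], increasing to the indicator of []a, b[]. It is continuous,
    so its primitives are C^1. *)
Definition trap (n : nat) a b x : R := Num.min 1 (n%:R * Num.max 0 (Num.min (x - a) (b - x))).

Lemma trap_cont n a b : continuous (trap n a b).
Proof.
move=> x.
apply: (@continuous_min R R (fun=> 1) (fun x => n%:R * Num.max 0 (Num.min (x - a) (b - x))) x).
  exact: cvg_cst.
apply: cvgM; first exact: cvg_cst.
apply: (@continuous_max R R (fun=> 0) (fun x => Num.min (x - a) (b - x)) x); first exact: cvg_cst.
apply: (@continuous_min R R (fun x => x - a) (fun x => b - x) x).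
- by apply: cvgB; [exact: cvg_id|exact: cvg_cst].
- by apply: cvgB; [exact: cvg_cst|exact: cvg_id].
Qed.

Lemma trap_ge0 n a b x : 0 <= trap n a b x.
Proof. by rewrite /trap le_min ler01 mulr_ge0 // le_max lexx. Qed.

Lemma trap_le1 n a b x : trap n a b x <= 1.
Proof. by rewrite /trap ge_min lexx. Qed.

Lemma trap_out n a b x : ~~ (a < x < b) -> trap n a b x = 0.
Proof.
move=> H; rewrite /trap.
have -> : Num.max 0 (Num.min (x - a) (b - x)) = 0.
  apply/max_idPl; rewrite ge_min subr_le0 subr_le0.
  by move: H; rewrite negb_and -!leNgt.
by rewrite mulr0; apply/min_idPr.
Qed.

Lemma trap_cvg a b x : trap n a b x @[n --> \oo] --> ((a < x < b)%R%:R : R).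
Proof.
case: (boolP (a < x < b)) => [/andP[ax xb]|H] /=; last first.
  by under eq_fun do rewrite (trap_out _ H); exact: cvg_cst.
have m0 : 0 < Num.min (x - a) (b - x) by rewrite lt_min !subr_gt0 ax xb.
apply: cvg_near_cst; near=> n; rewrite /trap.
have -> : Num.max 0 (Num.min (x - a) (b - x)) = Num.min (x - a) (b - x).
  by apply/max_idPr; apply: ltW.
apply/min_idPl; rewrite -(ler_pdivrMr _ _ m0) mul1r.
by near: n; exact: nbhs_infty_ger.
Unshelve. all: by end_near.
Qed.

Lemma trap_int_cvg F a b e : rint `[0, e] F -> 0 <= a -> a < b -> b <= e ->
  \int[mu]_(x in `[0, e]) (F x * trap n a b x) @[n --> \oo] -->
  \int[mu]_(t in `]a, b]) F t.
Proof.
move=> Fi a0 ab be.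
have [] := @Rdominated_cvg R `[0, e] (fun n x => F x * trap n a b x) (fun x => F x * (a < x < b)%R%:R) (fun x => `|F x|).
- exact: measurable_itv.
- move=> n; apply: measurable_funM; first exact: rint_measurable.
  by apply: subspace_continuous_measurable_fun => //; apply: continuous_subspaceT; exact: trap_cont.
- exact: rint_abs.
- by move=> n x _; rewrite normrM ler_piMr// ger0_norm ?trap_ge0 ?trap_le1.
- by move=> x _; apply: cvgM; [exact: cvg_cst|exact: trap_cvg].
move=> _; rewrite -(@Rintegral_itv_bndo_bndc _ (BRight a)); last first.
  apply: rintS Fi => // t /=; rewrite !in_itv /= => /andP[at_ tb].
  by rewrite (ltW (le_lt_trans a0 at_)) (ltW (lt_le_trans tb be)).
rewrite [X in _ --> X -> _]Rintegral_mkcond [X in _ -> _ --> X]Rintegral_mkcond.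
rewrite (@Rint_eq _ _ _ (F \_ `]a, b[)) // => x _; rewrite !patchE !mem_setE !in_itv /=.
case: ifPn => x0e; case: ifPn => axb; rewrite ?axb ?mulr1 ?mulr0 //.
exfalso; move/negP: x0e; apply; move/andP: axb => [ax xb].
by rewrite (ltW (le_lt_trans a0 ax)) (ltW (lt_le_trans xb be)).
Qed.

(** A combination of two trapezoids with mean zero is the derivative of a test function. In the
    limit of steep sides, the mean of [F] is the same over any two intervals in the interior. *)
Lemma du_bois_reymond_int D F : hdom D -> (forall x, D x -> rint `[0, x] F) ->
  (forall phi, test_fun D phi -> \int[mu]_(x in D) (F x * derive1 phi x) = 0) ->
  forall a b c d, 0 < a -> a < b -> D° b -> 0 < c -> c < d -> D° d ->
  (d - c) * \int[mu]_(t in `]a, b]) F t = (b - a) * \int[mu]_(t in `]c, d]) F t.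
Proof.
move=> hD Fi H a b c d a0 ab ib c0 cd id'.
pose e := Num.max b d.
have ie : D° e by rewrite /e; case: leP.
have De : D e by apply: interior_subset.
have be : b <= e by rewrite le_max lexx.
have de : d <= e by rewrite le_max lexx orbT.
have e0 : 0 <= e by apply: le_trans be; rewrite ltW// (lt_trans a0).
pose m n x y := \int[mu]_(t in `[0, e]) (1 * trap n x y t).
pose J n x y := \int[mu]_(t in `[0, e]) (F t * trap n x y t).
have mc x y : 0 < x -> x < y -> y <= e -> m n x y @[n --> \oo] --> y - x.
  move=> x0 xy ye; have := @trap_int_cvg (fun=> 1) x y e (rint_cst _ _ _) (ltW x0) xy ye.
  by rewrite (Rint_cst_oc _ (ltW xy)) mul1r.
have ti n x y : rint `[0, e] (trap n x y).
  by apply: rint_cont; apply: continuous_subspaceT; exact: trap_cont.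
have Fti n x y : rint `[0, e] (fun t => F t * trap n x y t).
  by apply: rintM_cont; [exact: Fi|apply: continuous_subspaceT; exact: trap_cont].
(* Each trapezoid is weighted by the mass of the other, so that [psi] has mean zero. *)
have K n : m n c d * J n a b = m n a b * J n c d.
  pose psi t := m n c d * trap n a b t - m n a b * trap n c d t.
  pose l := Num.min a c.
  have psi0 t : ~~ (l <= t <= e) -> psi t = 0.
    move=> H0; rewrite /psi !trap_out ?mulr0 ?subr0 //; apply/negP => /andP[ct td];
      move/negP: H0; apply; rewrite /l ge_min /e le_max (ltW ct) (ltW td) ?orbT //.
  have cpsi : continuous psi.
    by move=> t; apply: cvgB; apply: cvgM; [exact: cvg_cst|exact: trap_cont|exact: cvg_cst|exact: trap_cont].
  have psi0e t : ~~ (0 <= t <= e) -> psi t = 0.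
    move=> H0; apply: psi0; apply: contra H0 => /andP[lt ->]; rewrite andbT.
    by apply: le_trans lt; rewrite /l le_min !ltW.
  have pint : \int[mu]_x psi x = 0.
    rewrite (@Rint_eq _ _ _ (psi \_ `[0, e])); last first.
      by move=> t _; rewrite patchE mem_setE in_itv /=; case: ifPn => // /psi0e.
    rewrite -Rintegral_mkcond /psi RintegralB// ?RintegralZl//.
    - rewrite /m; under eq_Rintegral do rewrite mul1r.
      under [X in _ - X * _]eq_Rintegral do rewrite mul1r.
      by rewrite mulrC subrr.
    - exact: ti.
    - exact: ti.
    - exact: (rintZ _ (measurable_itv _) (ti _ _ _)).
    - exact: (rintZ _ (measurable_itv _) (ti _ _ _)).
  have sub : `[l, e]%classic `<=` D°.
    move=> t /=; rewrite in_itv /= => /andP[lt te].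
    have /(hdom_int hD)[_ [y [Dy ey]]] := ie.
    apply/(hdom_int hD); split; first by apply: lt_le_trans lt; rewrite lt_min a0.
    by exists y; split => //; apply: le_lt_trans ey.
  have [phi [tphi dphi]] := test_fun_primitive cpsi sub psi0 pint.
  have := H phi tphi; rewrite dphi (Rint_trunc hD De); last first.
    move=> t et; rewrite psi0e ?mulr0 //; apply/negP => /andP[_ te].
    by move: et; rewrite ltNge te.
  have EE t : F t * psi t = m n c d * (F t * trap n a b t) - m n a b * (F t * trap n c d t).
    by rewrite /psi; ring.
  under eq_Rintegral do rewrite EE.
  rewrite RintegralB// ?RintegralZl//.
  - by move/eqP; rewrite subr_eq0 => /eqP.
  - exact: Fti.
  - exact: Fti.
  - exact: (rintZ _ (measurable_itv _) (Fti _ _ _)).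
  - exact: (rintZ _ (measurable_itv _) (Fti _ _ _)).
have L1 : m n c d * J n a b @[n --> \oo] --> (d - c) * \int[mu]_(t in `]a, b]) F t.
  by apply: cvgM; [exact: mc|apply: trap_int_cvg => //; [exact: Fi|exact: ltW]].
have L2 : m n c d * J n a b @[n --> \oo] --> (b - a) * \int[mu]_(t in `]c, d]) F t.
  under eq_fun do rewrite K.
  by apply: cvgM; [exact: mc|apply: trap_int_cvg => //; [exact: Fi|exact: ltW]].
by apply: (cvg_unique _ L1 L2); exact: Rhausdorff.
Qed.

Lemma du_bois_reymond D F : hdom D -> (forall x, D x -> rint `[0, x] F) ->
  (forall phi, test_fun D phi -> \int[mu]_(x in D) (F x * derive1 phi x) = 0) ->
  exists k : R, {ae mu, forall x, D x -> F x = k}.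
Proof.
move=> hD Fi H.
have [b0 [b00 Db0]] := hdom_pos hD.
(* A fixed reference interval in the interior; the mean of [F] over it is the constant [k]. *)
pose c := b0 / 3; pose d := b0 / 2.
have c0 : 0 < c by rewrite divr_gt0.
have cd : c < d by rewrite /c /d; lra.
have id' : D° d by apply/(hdom_int hD); split; [lra|exists b0; split => //; rewrite /d; lra].
pose k := (\int[mu]_(t in `]c, d]) F t) / (d - c).
exists k.
have J a b : 0 < a -> a < b -> D° b -> \int[mu]_(t in `]a, b]) F t = k * (b - a).
  move=> a0 ab ib; have := du_bois_reymond_int hD Fi H a0 ab ib c0 cd id'.
  have dc : d - c != 0 by rewrite subr_eq0 gt_eqF.
  by rewrite /k => E; apply: (mulfI dc); rewrite E; field.
have ae1 b : D b -> {ae mu, forall x, 0 < x < b -> F x = k}.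
  move=> Db.
  pose G := F \_ `[0, b].
  have Gi : rint setT G := (rint_restrict F (measurable_itv `[0, b])).1 (Fi b Db).
  (* Lebesgue differentiation: almost everywhere [F] is the derivative of its primitive, which is
     affine of slope [k] on []0, b[]. The base point [x / 2] below is chosen because [J] requires a
     positive left end. *)
  apply: (ae_imp _ (@FTC1 R G (BLeft 0)
    (fun y => rintS measurableT (measurable_itv _) (@subsetT _ _) Gi)
    (@integrable_locally R F `[0, b] (measurable_itv _) (Fi b Db)))).
  move=> x /= + /andP[x0 xb] => /(_ _)[|_].
    by rewrite lte_fin.
  rewrite {2}/G patchE mem_setE in_itv /= (ltW x0) (ltW xb) /= => <-.
  have x20 : 0 < x / 2 by rewrite divr_gt0.
  rewrite derive1E (@near_eq_derive _ _ _ _ (fun y => \int[mu]_(t in `[0, x/2]) F t + k * (y - x / 2))).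
  - by rewrite derive_val; rewrite /GRing.scale /=; ring.
  - near=> y.
    have xy : x / 2 < y by near: y; apply: lt_nbhsr; rewrite ltr_pdivrMr// ltr_pMr// ltr1n.
    have yb : y < b by near: y; exact: lt_nbhsl.
    have y0 : 0 < y by apply: lt_trans xy.
    have -> : \int[mu]_(t in [set` Interval (BLeft 0) (BRight y)]) G t = \int[mu]_(t in `[0, y]) F t.
      apply: Rint_eq => t /=; rewrite in_itv /= => /andP[t0 ty].
      by rewrite /G patchE mem_setE in_itv /= t0 (le_trans ty (ltW yb)).
    have Dy : D y by apply: (hdom_down hD Db); rewrite ltW.
    apply/eqP; rewrite addrC -subr_eq; apply/eqP.
    rewrite (@Rintegral_itvB R F (BLeft 0) (BRight y)) ?bnd_simp ?ltW//; last exact: Fi.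
    by rewrite J//; apply/(hdom_int hD); split => //; exists b.
(* On the half-line, countably many intervals []0, n[] exhaust the interior, so one null set serves
   for all of them. *)
have sub : {ae mu, forall x, forall n : nat, D n%:R -> 0 < x < n%:R -> F x = k}.
  apply/ae_foralln => n; have [Dn|nDn] := pselect (D n%:R).
    by apply: ae_imp (ae1 _ Dn) => x + _.
  by apply: aeW => x /nDn.
have ae0 y : {ae mu, forall x, x <> y}.
  exists [set y]; split => //; first exact: lebesgue_measure_set1.
  by move=> x /= /contrapT.
have [[b [b0' E]]|E] := hdom_itv hD.
  have Db : D b by rewrite E /= in_itv /= lexx ltW.
  have : {ae mu, forall x, x <> 0 /\ x <> b /\ (0 < x < b -> F x = k)}.
    have H1 : {ae mu, forall x, x <> b /\ (0 < x < b -> F x = k)}.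
      by apply: ae_imp2 (ae0 b) (ae1 b Db).
    by apply: ae_imp2 (ae0 0) H1.
  apply: ae_imp => x [xn0 [xnb +]]; rewrite E /= in_itv /= => + /andP[x0 xb]; apply.
  by rewrite !lt_neqAle x0 xb !andbT eq_sym; apply/andP; split; apply/eqP.
apply: ae_imp2 (ae0 0) sub => x xn0 xn; rewrite E /= in_itv /= andbT => x0.
apply: (xn (Num.truncn x).+1).
  by rewrite E /= in_itv /= andbT.
by rewrite Num.Theory.truncnS_gt ?andbT lt_neqAle x0 andbT eq_sym; apply/eqP.
Unshelve. all: by end_near.
Qed.

End DuBoisReymond.

(** * Complex-valued absolutely continuous and square-integrable functions *)

Section ComplexAC.
Variable R : realType.
Local Notation mu := (@lebesgue_measure R).
Local Notation C := R[i].
Local Notation mset D := (measurable (D : set (measurableTypeR R))).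
Local Notation mfn D f := (measurable_fun (D : set (measurableTypeR R)) f).
Implicit Types (D : set R) (a b x y : R).

(** The difference of [g] and the primitive of [h] has weak derivative zero, hence is constant
    almost everywhere. *)
Lemma weakR_ac D (g h : R -> R) : hdom D -> (forall x, D x -> rint `[0, x] g) ->
  (forall x, D x -> rint `[0, x] h) -> weakR D g h ->
  exists g', {ae mu, forall x, D x -> g x = g' x} /\ acR D g' h.
Proof.
move=> hD gi hi W.
pose H x := \int[mu]_(t in `[0, x]) h t.
have aH : acR D H h.
  move=> x Dx; split; first exact: hi.
  by rewrite {2}/H set_itv1 Rintegral_set1 add0r.
have Hi x : D x -> rint `[0, x] H.
  move=> Dx; apply: rint_cont; apply: continuous_subspaceW (acR_cont hD aH); exact: hdom_sub.
have [k ae] : exists k : R, {ae mu, forall x, D x -> g x - H x = k}.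
  apply: (@du_bois_reymond R D (fun x => g x - H x)) => //.
    by move=> x Dx; apply: rintB => //; [exact: gi|exact: Hi].
  move=> phi tphi.
  have [a [b [a0 Db out]]] := test_fun_out hD tphi.
  have [_ cphi' _] := tphi.
  have E1 := W phi tphi; have E2 := acR_weak hD aH tphi.
  have outb k x : b < x -> k x * derive1 phi x = 0.
    move=> bx; have [_ ->] : phi x = 0 /\ derive1 phi x = 0; last by rewrite mulr0.
    by apply: out => /andP[_ xb]; move: (lt_trans bx xb); rewrite ltxx.
  have I k : rint `[0, b] k -> rint `[0, b] (fun x => k x * derive1 phi x).
    by move=> ki; apply: rintM_cont => //; exact: continuous_subspaceT.
  rewrite (Rint_trunc hD Db); last by move=> x bx; exact: (outb (fun x => g x - H x) x bx).
  rewrite (@Rint_eq _ _ _ (fun x => g x * derive1 phi x - H x * derive1 phi x)); last first.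
    by move=> x _; rewrite mulrBl.
  rewrite RintegralB//; [|exact: I (gi _ Db)|exact: I (Hi _ Db)].
  rewrite -(Rint_trunc hD Db (outb g)) -(Rint_trunc hD Db (outb H)).
  by rewrite E1 E2 subrr.
exists (fun x => H x + k); split.
  by apply: ae_imp ae => x E /E <-; rewrite addrC subrK.
have := acRD aH (@acR_cst R D k).
by apply: acR_eq => // x _; rewrite addr0.
Qed.

Lemma acR_ae D (f g g' : R -> R) : hdom D -> acR D f g -> (forall x, D x -> rint `[0, x] g') ->
  {ae mu, forall x, D x -> g x = g' x} -> acR D f g'.
Proof.
move=> hD H gi' ae x Dx; have [gi fE] := H x Dx; split; first exact: gi'.
rewrite fE; congr (_ + fine _); apply: ae_eq_integral => //.
- by apply/measurable_EFinP; apply: rint_measurable.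
- by apply/measurable_EFinP; apply: rint_measurable; exact: gi'.
- apply: ae_imp ae => t E xt /=; rewrite E//; exact: (hdom_sub hD Dx).
Qed.

(** Such a [k] is an almost-everywhere derivative of the constant 0. If [k x] were nonzero,
    [acR_incr] with slope [k x] on a short interval at [x] would produce a nonzero increment. *)
Lemma ae_cont_eq0 D (k : R -> R) : hdom D -> {within D, continuous k} ->
  {ae mu, forall x, D x -> k x = 0} -> forall x, D x -> k x = 0.
Proof.
move=> hD ck ae x Dx; apply/eqP; apply: contraT => kx0.
have A : acR D (fun=> 0) k.
  apply: (acR_ae hD (@acR_cst R D 0)); last by apply: ae_imp ae => y E /E.
  by move=> y Dy; apply: rint_cont; apply: continuous_subspaceW ck; exact: hdom_sub.
have e0 : 0 < `|k x| / 2 by rewrite divr_gt0 ?normr_gt0.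
have [d [d0 Hd]] := within_near ck Dx e0.
(* The interval ends at [x], except for [x = 0], where it starts there; this keeps it inside [D]. *)
have [u [v [u0 uv Dv uvx]]] : exists u v : R,
    [/\ 0 <= u, u < v, D v & forall t, u <= t <= v -> `|t - x| < d].
  have [x0|x0] := ltP 0 x.
    exists (Num.max 0 (x - d / 2)), x; split => //; first by rewrite le_max lexx.
      by rewrite gt_max x0 ltrBlDr ltrDl divr_gt0.
    by move=> t; rewrite ge_max ltr_norml => /andP[/andP[_ ?] ?]; apply/andP; split; lra.
  have xE : x = 0 by apply/eqP; rewrite eq_le x0 (hdom_ge0 hD Dx).
  have [b [b0 Db]] := hdom_pos hD.
  have v0 : 0 < Num.min b (d / 2) by rewrite lt_min b0 divr_gt0.
  exists 0, (Num.min b (d / 2)); split => //.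
    by apply: (hdom_down hD Db); [exact: ltW|rewrite ge_min lexx].
  by move=> t; rewrite le_min xE subr0 ltr_norml => /and3P[? _ ?]; apply/andP; split; lra.
have bd t : u <= t <= v -> `|k t - k x| <= `|k x| / 2.
  move=> /[dup] /andP[ut tv] /uvx; apply: Hd.
  exact: hdom_down hD Dv (le_trans u0 ut) tv.
have := acR_incr hD A Dv u0 (ltW uv) bd.
have vu : 0 < v - u by rewrite subr_gt0.
rewrite subrr sub0r normrN normrM (gtr0_norm vu) ler_pM2r//.
by rewrite leNgt ltr_pdivrMr// ltr_pMr ?normr_gt0// ltr1n.
Qed.

Lemma weakR_ac_cont D (g h : R -> R) : hdom D -> {within D, continuous g} ->
  (forall x, D x -> rint `[0, x] h) -> weakR D g h -> acR D g h.
Proof.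
move=> hD cg hi W.
have gi x : D x -> rint `[0, x] g.
  move=> Dx; apply: rint_cont; apply: continuous_subspaceW cg; exact: hdom_sub.
have [g' [ae ag']] := weakR_ac hD gi hi W.
have E : forall x, D x -> g' x - g x = 0.
  apply: ae_cont_eq0 => //.
    move=> x; apply: cvgB; [exact: (acR_cont hD ag')|exact: cg].
  by apply: ae_imp ae => x E /E ->; rewrite subrr.
by apply: acR_eq ag' => // x Dx; apply/eqP; rewrite -subr_eq0 E.
Qed.

Lemma complex_ext (z w : C) : complex.Re z = complex.Re w -> complex.Im z = complex.Im w -> z = w.
Proof. by case: z w => [a b] [c d] /= -> ->. Qed.

(* The norm of [R[i]] takes its values in [R[i]]; estimates use the real-valued squared modulus. *)
Definition csq (z : C) : R := complex.Re z ^+ 2 + complex.Im z ^+ 2.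

Lemma csq_ge0 z : 0 <= csq z.
Proof. by rewrite addr_ge0 ?sqr_ge0. Qed.

Lemma csqM z w : csq (z * w) = csq z * csq w.
Proof. by case: z w => [a b] [c d]; rewrite /csq /=; ring. Qed.

Lemma csq_eq0 z : csq z = 0 -> z = 0.
Proof.
case: z => a b; rewrite /csq /= => /eqP; rewrite paddr_eq0 ?sqr_ge0// !sqrf_eq0.
by move=> /andP[/eqP -> /eqP ->].
Qed.

Lemma csq0 : csq 0 = 0.
Proof. by rewrite /csq /= expr0n addr0. Qed.

Lemma csq1 : csq 1 = 1.
Proof. by rewrite /csq /= expr1n expr0n addr0. Qed.

Lemma csqi : csq (0 +i* 1) = 1.
Proof. by rewrite /csq /= expr1n expr0n add0r. Qed.

Lemma csqD_le z w : csq (z + w) <= 2 * csq z + 2 * csq w.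
Proof.
case: z w => [a b] [c d]; rewrite /csq /= -subr_ge0.
by rewrite (_ : _ - _ = (a - c) ^+ 2 + (b - d) ^+ 2) ?addr_ge0 ?sqr_ge0//; ring.
Qed.

Lemma csqN z : csq (- z) = csq z.
Proof. by case: z => a b; rewrite /csq /= !sqrrN. Qed.

Lemma csq_conj z : csq (conjc z) = csq z.
Proof. by case: z => a b; rewrite /csq /= sqrrN. Qed.

Lemma reD (f g : R -> C) : re (fun x => f x + g x) = (fun x => re f x + re g x).
Proof. by apply/funext => x; rewrite /re; case: (f x) (g x) => [a b] [c d]. Qed.

Lemma imD (f g : R -> C) : im (fun x => f x + g x) = (fun x => im f x + im g x).
Proof. by apply/funext => x; rewrite /im; case: (f x) (g x) => [a b] [c d]. Qed.

Lemma reN (f : R -> C) : re (fun x => - f x) = (fun x => - re f x).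
Proof. by apply/funext => x; rewrite /re; case: (f x) => a b. Qed.

Lemma imN (f : R -> C) : im (fun x => - f x) = (fun x => - im f x).
Proof. by apply/funext => x; rewrite /im; case: (f x) => a b. Qed.

Lemma reM (f g : R -> C) : re (fun x => f x * g x) = (fun x => re f x * re g x - im f x * im g x).
Proof. by apply/funext => x; rewrite /re /im; case: (f x) (g x) => [a b] [c d]. Qed.

Lemma imM (f g : R -> C) : im (fun x => f x * g x) = (fun x => re f x * im g x + im f x * re g x).
Proof. by apply/funext => x; rewrite /re /im; case: (f x) (g x) => [a b] [c d]. Qed.

Lemma reJ (f : R -> C) : re (fun x => conjc (f x)) = re f.
Proof. by apply/funext => x; rewrite /re; case: (f x) => a b. Qed.

Lemma imJ (f : R -> C) : im (fun x => conjc (f x)) = (fun x => - im f x).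
Proof. by apply/funext => x; rewrite /im; case: (f x) => a b. Qed.

Definition AC D (f g : R -> C) := acR D (re f) (re g) /\ acR D (im f) (im g).

Lemma ACD D (f g f' g' : R -> C) : AC D f g -> AC D f' g' ->
  AC D (fun x => f x + f' x) (fun x => g x + g' x).
Proof. by move=> [A B] [A' B']; rewrite /AC !reD !imD; split; apply: acRD. Qed.

Lemma ACN D (f g : R -> C) : AC D f g -> AC D (fun x => - f x) (fun x => - g x).
Proof. by move=> [A B]; rewrite /AC !reN !imN; split; apply: acRN. Qed.

Lemma AC_conj D (f g : R -> C) : AC D f g -> AC D (fun x => conjc (f x)) (fun x => conjc (g x)).
Proof. by move=> [A B]; rewrite /AC !reJ !imJ; split => //; apply: acRN. Qed.

Lemma AC_cst D (c : C) : AC D (fun=> c) (fun=> 0).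
Proof. by split; exact: acR_cst. Qed.

Lemma AC_eq D (f g f' g' : R -> C) : hdom D -> (forall x, D x -> f x = f' x) ->
  (forall x, D x -> g x = g' x) -> AC D f g -> AC D f' g'.
Proof.
move=> hD ff gg [A B]; split; [apply: acR_eq A|apply: acR_eq B] => // x Dx; rewrite /re /im ?ff ?gg//.
Qed.

Lemma ACM D (f g f' g' : R -> C) : hdom D -> AC D f g -> AC D f' g' ->
  AC D (fun x => f x * f' x) (fun x => g x * f' x + f x * g' x).
Proof.
move=> hD [A B] [A' B']; rewrite /AC !reD !imD !reM !imM; split.
- by apply: acR_eq (acRB (acRM hD A A') (acRM hD B B')) => // x _; ring.
- by apply: acR_eq (acRD (acRM hD A B') (acRM hD B A')) => // x _; ring.
Qed.

Lemma ACZ D (c : C) (f g : R -> C) : hdom D -> AC D f g -> AC D (fun x => c * f x) (fun x => c * g x).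
Proof.
move=> hD H; apply: AC_eq (ACM hD (AC_cst D c) H) => // x _.
by rewrite mul0r add0r.
Qed.

Lemma ACB D (f g f' g' : R -> C) : AC D f g -> AC D f' g' ->
  AC D (fun x => f x - f' x) (fun x => g x - g' x).
Proof. by move=> H H'; apply: ACD => //; exact: ACN. Qed.

Lemma AC_sum D n (f g : 'I_n -> R -> C) : hdom D -> (forall i, AC D (f i) (g i)) ->
  AC D (fun x => \sum_(i < n) f i x) (fun x => \sum_(i < n) g i x).
Proof.
elim: n f g => [|n IH] f g hD H.
  by apply: AC_eq (AC_cst D 0) => // x _; rewrite big_ord0.
apply: AC_eq (ACD (IH (fun i => f (lift ord_max i)) (fun i => g (lift ord_max i)) hD _) (H ord_max)) => //.
- move=> x _; rewrite big_ord_recr /=; congr (_ + _); apply: eq_bigr => i _.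
  by congr (f _ x); apply: val_inj; rewrite /= /bump leqNgt ltn_ord.
- move=> x _; rewrite big_ord_recr /=; congr (_ + _); apply: eq_bigr => i _.
  by congr (g _ x); apply: val_inj; rewrite /= /bump leqNgt ltn_ord.
Qed.

Lemma AC_cexp D (z : C) : hdom D ->
  AC D (fun x => cexp (z * x%:C)) (fun x => z * cexp (z * x%:C)).
Proof.
move=> hD; case: z => a b.
have E x : cexp ((a +i* b) * x%:C) = (expR (a * x) * cos (b * x)) +i* (expR (a * x) * sin (b * x)).
  by rewrite /cexp /= !mulr0 subr0 add0r.
have ce : continuous (fun x : R => expR (a * x)).
  move=> x; apply: continuous_comp; last exact: continuous_expR.
  by apply: cvgM; [exact: cvg_cst|exact: cvg_id].
have cc : continuous (fun x : R => cos (b * x)).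
  move=> x; apply: continuous_comp; last exact: continuous_cos.
  by apply: cvgM; [exact: cvg_cst|exact: cvg_id].
have cs : continuous (fun x : R => sin (b * x)).
  move=> x; apply: continuous_comp; last exact: continuous_sin.
  by apply: cvgM; [exact: cvg_cst|exact: cvg_id].
split.
- apply: (acR_C1 hD) => [x|].
    rewrite (_ : re _ = fun x => expR (a * x) * cos (b * x)); last first.
      by apply/funext => y; rewrite /re E.
    apply: is_derive_eq; rewrite /re E /=.
    by rewrite /GRing.scale /=; ring.
  rewrite (_ : re _ = fun x => a * (expR (a * x) * cos (b * x)) - b * (expR (a * x) * sin (b * x))); last first.
    by apply/funext => y; rewrite /re E.
  by move=> x; apply: cvgB; apply: cvgM; (try exact: cvg_cst); apply: cvgM; [exact: ce|exact: cc|exact: ce|exact: cs].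
- apply: (acR_C1 hD) => [x|].
    rewrite (_ : im _ = fun x => expR (a * x) * sin (b * x)); last first.
      by apply/funext => y; rewrite /im E.
    apply: is_derive_eq; rewrite /im E /=.
    by rewrite /GRing.scale /=; ring.
  rewrite (_ : im _ = fun x => a * (expR (a * x) * sin (b * x)) + b * (expR (a * x) * cos (b * x))); last first.
    by apply/funext => y; rewrite /im E.
  by move=> x; apply: cvgD; apply: cvgM; (try exact: cvg_cst); apply: cvgM; [exact: ce|exact: cs|exact: ce|exact: cc].
Qed.

Implicit Types (f g h u : R -> C).

Definition cinteg D f := rint D (re f) /\ rint D (im f).

Lemma L2_csq D f : L2 D f -> rint D (fun x => csq (f x)).
Proof. by case. Qed.

Lemma L2_intro D f : mfn D (re f) -> mfn D (im f) -> rint D (fun x => csq (f x)) -> L2 D f.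
Proof. by []. Qed.

Lemma csq_meas D f : mfn D (re f) -> mfn D (im f) -> mfn D (fun x => csq (f x)).
Proof.
move=> mr mi; rewrite (_ : (fun x => _) = fun x => re f x * re f x + im f x * im f x) //.
by apply: measurable_funD; apply: measurable_funM.
Qed.

Lemma L2_eq D f g : mset D -> (forall x, D x -> f x = g x) -> L2 D f -> L2 D g.
Proof.
move=> mD fg [mr mi ii]; apply: L2_intro.
- by apply: eq_measurable_fun mr => x; rewrite inE => Dx; rewrite /re fg.
- by apply: eq_measurable_fun mi => x; rewrite inE => Dx; rewrite /im fg.
- by apply: rint_eq ii => // x Dx; rewrite /re /im fg.
Qed.

Lemma L2D D f g : mset D -> L2 D f -> L2 D g -> L2 D (fun x => f x + g x).
Proof.
move=> mD [mr mi fi] [mr' mi' gi].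
have m1 : mfn D (re (fun x => f x + g x)) by rewrite reD; apply: measurable_funD.
have m2 : mfn D (im (fun x => f x + g x)) by rewrite imD; apply: measurable_funD.
apply: L2_intro => //.
apply: (@rint_dom _ _ _ (fun x => 2 * csq (f x) + 2 * csq (g x))) => //.
- exact: csq_meas.
- by apply: rintD => //; apply: rintZ.
- by move=> x _; rewrite ger0_norm ?csq_ge0// csqD_le.
Qed.

Lemma L2Z D (c : C) f : mset D -> L2 D f -> L2 D (fun x => c * f x).
Proof.
move=> mD [mr mi fi].
have m0 (k : R) : mfn D (fun=> k) by exact: measurable_cst.
apply: L2_intro.
- by rewrite reM; apply: measurable_funB; apply: measurable_funM => //; exact: m0.
- by rewrite imM; apply: measurable_funD; apply: measurable_funM => //; exact: m0.
- have := rintZ (csq c) mD fi; apply: rint_eq => // x _; rewrite csqM//.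
Qed.

Lemma L2N D f : mset D -> L2 D f -> L2 D (fun x => - f x).
Proof. by move=> mD /(L2Z (-1) mD); apply: L2_eq => // x _; rewrite mulN1r. Qed.

Lemma L2B D f g : mset D -> L2 D f -> L2 D g -> L2 D (fun x => f x - g x).
Proof. by move=> mD fi gi; apply: L2D => //; apply: L2N. Qed.

Lemma L2_0 D : mset D -> L2 D (fun=> 0).
Proof.
move=> mD; apply: L2_intro; try exact: measurable_cst.
by apply: rint_eq (rint0 D) => // x _; rewrite csq0.
Qed.

Lemma L2J D f : mset D -> L2 D f -> L2 D (fun x => conjc (f x)).
Proof.
move=> mD [mr mi fi]; apply: L2_intro.
- by rewrite reJ.
- by rewrite imJ; apply: measurableT_comp.
- by apply: rint_eq fi => // x _; rewrite csq_conj.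
Qed.

Lemma L2S D D' f : mset D -> mset D' -> D' `<=` D -> L2 D f -> L2 D' f.
Proof.
move=> mD mD' sub [mr mi fi]; apply: L2_intro.
- exact: measurable_funS mr.
- exact: measurable_funS mi.
- exact: rintS fi.
Qed.

Lemma L2_cont b f : ccontinuous_on `[0, b] f -> L2 `[0, b] f.
Proof.
move=> [cr ci]; apply: L2_intro.
- exact: subspace_continuous_measurable_fun.
- exact: subspace_continuous_measurable_fun.
- apply: (@rint_eq _ _ (fun x => re f x * re f x + im f x * im f x)) => //.
  by apply: rintD => //; apply: rintM_cont => //; apply: rint_cont.
Qed.

Lemma csq_mul_le (z w : C) : `|complex.Re (z * w)| <= csq z + csq w /\ `|complex.Im (z * w)| <= csq z + csq w.
Proof.
case: z w => [a b] [c d]; rewrite /csq /= !ler_norml.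
have [[[h1 h2] h3] h4] := (sqr_ge0 (a - c), sqr_ge0 (a + c), sqr_ge0 (b - d), sqr_ge0 (b + d)).
have [[[h5 h6] h7] h8] := (sqr_ge0 (a - d), sqr_ge0 (a + d), sqr_ge0 (b - c), sqr_ge0 (b + c)).
have [[[h9 h10] h11] h12] := (sqr_ge0 a, sqr_ge0 b, sqr_ge0 c, sqr_ge0 d).
by split; apply/andP; split; nra.
Qed.

Lemma L2_mul D f g : mset D -> L2 D f -> L2 D g -> cinteg D (fun x => f x * g x).
Proof.
move=> mD [mr mi fi] [mr' mi' gi].
have gi' := rintD mD fi gi.
split; apply: rint_dom gi' _ => //.
- by rewrite reM; apply: measurable_funB; apply: measurable_funM.
- by move=> x _; have [] := csq_mul_le (f x) (g x).
- by rewrite imM; apply: measurable_funD; apply: measurable_funM.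
- by move=> x _; have [] := csq_mul_le (f x) (g x).
Qed.

Lemma L2_cinteg b f : L2 `[0, b] f -> cinteg `[0, b] f.
Proof.
move=> fi; have [] : cinteg `[0, b] (fun x => f x * 1).
  apply: L2_mul => //; apply: L2_cont.
  by split; apply: continuous_subspaceT => x; exact: cvg_cst.
by rewrite /cinteg (_ : (fun x => f x * 1) = f) //; apply/funext => x; rewrite mulr1.
Qed.

Lemma cintD D f g : mset D -> cinteg D f -> cinteg D g ->
  cint D (fun x => f x + g x) = cint D f + cint D g.
Proof. by move=> mD [fr fi] [gr gi]; rewrite /cint reD imD !RintegralD. Qed.

Lemma cintegD D f g : mset D -> cinteg D f -> cinteg D g -> cinteg D (fun x => f x + g x).
Proof. by move=> mD [fr fi] [gr gi]; rewrite /cinteg reD imD; split; apply: rintD. Qed.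

Lemma cintegZ D (c : C) f : mset D -> cinteg D f -> cinteg D (fun x => c * f x).
Proof.
move=> mD [fr fi]; rewrite /cinteg reM imM; split.
- by apply: rintB => //; apply: rintZ.
- by apply: rintD => //; apply: rintZ.
Qed.

Lemma cintZ D (c : C) f : mset D -> cinteg D f -> cint D (fun x => c * f x) = c * cint D f.
Proof.
move=> mD [fr fi]; rewrite /cint reM imM.
rewrite RintegralB//; [|exact: rintZ|exact: rintZ].
rewrite RintegralD//; [|exact: rintZ|exact: rintZ].
by rewrite !RintegralZl//; case: c.
Qed.

Lemma cint_eq D f g : (forall x, D x -> f x = g x) -> cint D f = cint D g.
Proof.
move=> fg; rewrite /cint; congr (_ +i* _); apply: Rint_eq => x Dx; rewrite /re /im fg//.
Qed.

Lemma cintJ D f : mset D -> cinteg D f -> cint D (fun x => conjc (f x)) = conjc (cint D f).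
Proof.
move=> mD [fr fi]; rewrite /cint reJ imJ /=; congr (_ +i* _).
transitivity (\int[mu]_(x in D) (-1 * im f x)); first by apply: Rint_eq => x _; rewrite mulN1r.
by rewrite RintegralZl// mulN1r.
Qed.

Lemma L2loc_rint D f x : hdom D -> L2loc D f -> D x -> rint `[0, x] (re f) /\ rint `[0, x] (im f).
Proof.
move=> hD H Dx; have := H 0 x; rewrite (setIidl (hdom_sub hD Dx)) => fi.
exact: L2_cinteg.
Qed.

Lemma L2_loc D f : hdom D -> L2 D f -> L2loc D f.
Proof.
move=> hD fi a b; have mD := hdom_meas hD; apply: L2S fi => //.
exact: measurableI.
Qed.

Lemma cont_L2loc D f : hdom D -> ccontinuous_on D f -> L2loc D f.
Proof.
move=> hD [cr ci] a b.
have [c [Dc sub]] : exists c, D c /\ `[a, b] `&` D `<=` `[0, c].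
  have [[L [L0 E]]|E] := hdom_itv hD.
    by exists L; rewrite E; split; [rewrite /= in_itv /= lexx ltW|exact: subIsetr].
  exists (Num.max 0 b); rewrite E /= in_itv /= andbT; split; first by rewrite le_max lexx.
  by move=> x [] /=; rewrite !in_itv /= andbT => /andP[_ xb] ->; rewrite le_max xb orbT.
apply: (L2S (measurable_itv `[0, c])) sub _.
  by apply: measurableI => //; exact: hdom_meas.
by apply: L2_cont; split; [apply: continuous_subspaceW cr|apply: continuous_subspaceW ci]; exact: hdom_sub.
Qed.

Lemma re_real f (phi : R -> R) : re (fun x => f x * (phi x)%:C) = (fun x => re f x * phi x).
Proof. by rewrite reM; apply/funext => x; rewrite /re /im /= mulr0 subr0. Qed.

Lemma im_real f (phi : R -> R) : im (fun x => f x * (phi x)%:C) = (fun x => im f x * phi x).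
Proof. by rewrite imM; apply/funext => x; rewrite /re /im /= mulr0 add0r. Qed.

Lemma weak_derivR D f g : weak_deriv D f g -> weakR D (re f) (re g) /\ weakR D (im f) (im g).
Proof.
move=> [_ _ H]; split => phi /H; rewrite /cint !re_real !im_real => -[] //.
Qed.

Lemma AC_cont D f g : hdom D -> AC D f g -> ccontinuous_on D f.
Proof. by move=> hD [A B]; split; [exact: acR_cont A|exact: acR_cont B]. Qed.

Lemma AC_weak D f g : hdom D -> AC D f g -> L2loc D g -> weak_deriv D f g.
Proof.
move=> hD H gi; split => //; first by apply: cont_L2loc => //; exact: AC_cont H.
move=> phi tphi; rewrite /cint !re_real !im_real.
by case: H => A B; rewrite (acR_weak hD A tphi) (acR_weak hD B tphi).
Qed.

(** Only the first derivative changes its representative: [f] is already continuous, and [g'] then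
    becomes its derivative in the integral sense. *)
Lemma weak_AC2 D f g h : hdom D -> ccontinuous_on D f -> weak_deriv D f g -> weak_deriv D g h ->
  exists g', [/\ {ae mu, forall x, D x -> g x = g' x}, AC D f g' & AC D g' h].
Proof.
move=> hD [cr ci] Wf Wg.
have [_ gl _] := Wf; have [_ hl _] := Wg.
have [Wfr Wfi] := weak_derivR Wf; have [Wgr Wgi] := weak_derivR Wg.
have gr x (Dx : D x) := (L2loc_rint hD gl Dx).1.
have gi x (Dx : D x) := (L2loc_rint hD gl Dx).2.
have [r [aer acr]] := weakR_ac hD gr (fun x Dx => (L2loc_rint hD hl Dx).1) Wgr.
have [i [aei aci]] := weakR_ac hD gi (fun x Dx => (L2loc_rint hD hl Dx).2) Wgi.
exists (fun x => r x +i* i x).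
have cint' (k l : R -> R) : acR D k l -> forall x, D x -> rint `[0, x] k.
  move=> a x Dx; apply: rint_cont; apply: continuous_subspaceW (acR_cont hD a).
  exact: hdom_sub.
split => //.
- apply: ae_imp2 aer aei => x E1 E2 Dx; apply/eqP; rewrite eq_complex.
  by rewrite /= -E1// -E2// !eqxx.
- split.
  + exact: (acR_ae hD (weakR_ac_cont hD cr gr Wfr) (cint' _ _ acr) aer).
  + exact: (acR_ae hD (weakR_ac_cont hD ci gi Wfi) (cint' _ _ aci) aei).
Qed.

Lemma cont_meas D (k : R -> R) : hdom D -> {within D, continuous k} -> mfn D k.
Proof. by move=> hD ck; apply: subspace_continuous_measurable_fun => //; exact: hdom_meas. Qed.

Lemma L2_ae D f g : mset D -> mfn D (re g) -> mfn D (im g) ->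
  {ae mu, forall x, D x -> f x = g x} -> L2 D f -> L2 D g.
Proof.
move=> mD mr mi ae [mr' mi' fi]; apply: L2_intro => //.
apply/integrableP; split; first by apply/measurable_EFinP; exact: csq_meas.
have /integrableP[_] := fi; congr (_ < _)%E; apply: ae_eq_integral => //.
- by do 2 apply: measurableT_comp => //; exact: csq_meas.
- by do 2 apply: measurableT_comp => //; exact: csq_meas.
- by apply: ae_imp ae => x E Dx; rewrite /= /re /im E.
Qed.

Lemma ae_cont0 D f : hdom D -> ccontinuous_on D f ->
  {ae mu, forall x, D x -> f x = 0} -> forall x, D x -> f x = 0.
Proof.
move=> hD [cr ci] ae x Dx; apply: complex_ext => /=.
- by apply: (ae_cont_eq0 hD cr _ Dx); apply: ae_imp ae => y E Dy; rewrite /re E.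
- by apply: (ae_cont_eq0 hD ci _ Dx); apply: ae_imp ae => y E Dy; rewrite /im E.
Qed.

Definition W2 D u u1 h := AC D u u1 /\ AC D u1 h.

(** The passage from the Sobolev domain to pairs of absolutely continuous functions. The derivative
    [u1] is continuous, so its end values make sense. *)
Lemma W22_AC D u h : hdom D -> ccontinuous_on D u -> W22_deriv2 D u h ->
  exists u1, W2 D u u1 h /\ [/\ L2 D u, L2 D u1 & L2 D h].
Proof.
move=> hD cu [u2 h2 [g [g2 Wu Wg]]].
have [g' [ae A B]] := weak_AC2 hD cu Wu Wg.
exists g'; split => //; split => //.
have [cr ci] := AC_cont hD B.
by apply: L2_ae ae g2; [exact: hdom_meas|exact: cont_meas|exact: cont_meas].
Qed.

Lemma AC_W22 D u u1 h : hdom D -> W2 D u u1 h -> L2 D u -> L2 D u1 -> L2 D h ->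
  ccontinuous_on D u /\ W22_deriv2 D u h.
Proof.
move=> hD [A B] u2 u12 h2; split; first exact: AC_cont A.
by split => //; exists u1; split => //; apply: AC_weak => //; exact: L2_loc.
Qed.

Lemma AC_rderiv0 D u u1 : hdom D -> AC D u u1 -> ccontinuous_on D u1 -> rderiv0 u = u1 0.
Proof.
move=> hD [A B] [cr ci]; rewrite /rderiv0 (cvg_lim _ (acR_rderiv hD A cr))//.
by rewrite (cvg_lim _ (acR_rderiv hD B ci))//; rewrite /re /im; case: (u1 0).
Qed.

Lemma AC_rderivL b u u1 : 0 < b -> AC `[0, b] u u1 -> ccontinuous_on `[0, b] u1 ->
  rderiv0 (fun t => u (b - t)) = - u1 b.
Proof.
move=> b0 [A B] [cr ci]; rewrite /rderiv0.
have -> : re (fun t => u (b - t)) = (fun t => re u (b - t)) by [].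
have -> : im (fun t => u (b - t)) = (fun t => im u (b - t)) by [].
rewrite !subr0 (cvg_lim _ (acR_lderiv b0 A cr))//.
by rewrite (cvg_lim _ (acR_lderiv b0 B ci))//; rewrite /re /im; case: (u1 b).
Qed.

End ComplexAC.

(** * Solutions of the edge equation *)

Section FirstOrder.
Variable R : realType.
Local Notation mu := (@lebesgue_measure R).
Local Notation C := R[i].
Local Notation mset D := (measurable (D : set (measurableTypeR R))).
Local Notation mfn D f := (measurable_fun (D : set (measurableTypeR R)) f).
Implicit Types (D : set R) (a b x y : R) (f g h p q : R -> C) (lam c : C).

Lemma cexp0 : cexp 0 = 1 :> C.
Proof. by rewrite /cexp /= expR0 cos0 sin0 mul1r mulr0. Qed.

Lemma cexpD (z w : C) : cexp (z + w) = cexp z * cexp w.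
Proof.
case: z w => [a b] [c d]; rewrite /cexp /= expRD cosD sinD.
by congr (_ +i* _); ring.
Qed.

Lemma cexpN (z : C) : cexp z * cexp (- z) = 1.
Proof. by rewrite -cexpD subrr cexp0. Qed.

Lemma cexp_neq0 (z : C) : cexp z != 0.
Proof. by apply/eqP => E; have := cexpN z; rewrite E mul0r => /esym/eqP; rewrite oner_eq0. Qed.

Lemma csq_cexp (z : C) : csq (cexp z) = expR (2 * complex.Re z).
Proof.
case: z => a b; rewrite /csq /cexp /= !exprMn -mulrDr cos2Dsin2 mulr1.
by rewrite expRM_natl.
Qed.

Lemma ReMr (z : C) x : complex.Re (z * x%:C) = complex.Re z * x.
Proof. by case: z => a b /=; rewrite mulr0 subr0. Qed.

Lemma cinteg_prim D f : (forall x, D x -> cinteg `[0, x] f) ->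
  AC D (fun x => cint `[0, x] f) f.
Proof.
move=> fi; split => x Dx; (split; first by have [] := fi x Dx);
  by rewrite /re /im /= set_itv1 Rintegral_set1 add0r.
Qed.

(* Variation of constants for [p' = lam p - f], [p 0 = c]. *)
Definition fo_sol lam c f x := cexp (lam * x%:C) * (c - cint `[0, x] (fun y => cexp (- lam * y%:C) * f y)).

Lemma cexp_cont lam D : hdom D -> ccontinuous_on D (fun x : R => cexp (lam * x%:C)).
Proof. by move=> hD; apply: AC_cont => //; exact: AC_cexp. Qed.

Lemma cexp_L2 lam b : L2 `[0, b] (fun x : R => cexp (lam * x%:C)).
Proof.
have [b0|b0] := ltP 0 b; first by apply: L2_cont; apply: cexp_cont; exact: hdom_cc.
apply: (L2S (measurable_itv `[0, 1])) (@L2_cont _ _ _ (cexp_cont lam (hdom_cc ltr01))) => //.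
move=> x /=; rewrite !in_itv /= => /andP[x0 xb]; rewrite x0 /=.
by rewrite (le_trans xb)// (le_trans b0).
Qed.

Lemma L2loc_sub D f x : hdom D -> L2loc D f -> D x -> L2 `[0, x] f.
Proof. by move=> hD H Dx; have := H 0 x; rewrite (setIidl (hdom_sub hD Dx)). Qed.

Lemma fo_AC D lam c f : hdom D -> L2loc D f ->
  AC D (fo_sol lam c f) (fun x => lam * fo_sol lam c f x - f x) /\ fo_sol lam c f 0 = c.
Proof.
move=> hD fi; split; last first.
  rewrite /fo_sol mulr0 cexp0 mul1r /cint set_itv1 !Rintegral_set1.
  by rewrite (_ : 0 +i* 0 = 0) ?subr0.
have I x : D x -> cinteg `[0, x] (fun y => cexp (- lam * y%:C) * f y).
  by move=> Dx; apply: L2_mul => //; [exact: cexp_L2|exact: L2loc_sub Dx].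
apply: AC_eq (ACM hD (AC_cexp lam hD) (ACB (AC_cst D c) (cinteg_prim I))) => // x _.
by rewrite sub0r mulrN mulrA mulNr cexpN mul1r -mulrA.
Qed.

Lemma AC_deriv0 D f : AC D f (fun=> 0) -> forall x, D x -> f x = f 0.
Proof.
move=> [A B] x Dx; have [_ E1] := A x Dx; have [_ E2] := B x Dx.
move: E1 E2; rewrite !Rintegral_cst// !mul0r !addr0 /re /im.
by case: (f x) (f 0) => [a b] [a' b'] /= -> ->.
Qed.

Lemma fo_hom D lam p : hdom D -> AC D p (fun x => lam * p x) ->
  forall x, D x -> p x = p 0 * cexp (lam * x%:C).
Proof.
move=> hD H x Dx.
have A : AC D (fun x => p x * cexp (- lam * x%:C)) (fun=> 0).
  by apply: AC_eq (ACM hD H (AC_cexp (- lam) hD)) => // y _; ring.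
have := AC_deriv0 A Dx; rewrite mulr0 cexp0 mulr1 => <-.
by rewrite -mulrA [X in _ * X]mulrC mulNr cexpN mulr1.
Qed.

(** The real inner product on the plane, the real part of [z] times the conjugate of [w]; it occurs
    in the derivative of [csq p]. *)
Definition rdot (z w : C) := complex.Re z * complex.Re w + complex.Im z * complex.Im w.

(** Young's inequality with weight [m], by completing squares in each component, for both signs. *)
Lemma rdot_le (m : R) (z w : C) : 0 < m -> - (2 * rdot z w) <= m * csq w + m^-1 * csq z /\
  2 * rdot z w <= m * csq w + m^-1 * csq z.
Proof.
move=> m0; rewrite /rdot /csq; case: z w => [a b] [c d] /=.
have m1 : m * m^-1 = 1 by rewrite divff ?gt_eqF.
have mi : 0 < m^-1 by rewrite invr_gt0.
have E s (u v : R) : s ^+ 2 = 1 -> 0 <= m * v ^+ 2 + m^-1 * u ^+ 2 + 2 * s * (u * v).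
  move=> s1; have -> : m * v ^+ 2 + m^-1 * u ^+ 2 + 2 * s * (u * v) =
     m * (v + s * m^-1 * u) ^+ 2 + (1 - s ^+ 2) * m^-1 * u ^+ 2; last first.
    by rewrite s1 subrr !mul0r addr0 mulr_ge0 ?sqr_ge0 // ltW.
  by field; rewrite gt_eqF.
have h1 := E 1 a c (expr1n _ _); have h2 := E 1 b d (expr1n _ _).
have sq : (-1 : R) ^+ 2 = 1 by rewrite sqrrN expr1n.
have h3 := E _ a c sq; have h4 := E _ b d sq.
by split; lra.
Qed.

Section Energy.
Variables (D : set R) (lam : C) (f p : R -> C).
Hypotheses (hD : hdom D) (fl : L2loc D f) (Hp : AC D p (fun x => lam * p x - f x)).

Lemma AC_L2 x : D x -> L2 `[0, x] p.
Proof.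
move=> Dx; have [cr ci] := AC_cont hD Hp; apply: L2_cont.
by split; [apply: continuous_subspaceW cr|apply: continuous_subspaceW ci]; exact: hdom_sub.
Qed.

Lemma rdot_int x : D x -> rint `[0, x] (fun y => rdot (f y) (p y)).
Proof.
move=> Dx.
have [H _] := L2_mul (measurable_itv `[0, x]) (L2loc_sub hD fl Dx) (L2J (measurable_itv `[0, x]) (AC_L2 Dx)).
apply: rint_eq H => // y _; rewrite /re /rdot; case: (f y) (p y) => [a b] [c d] /=.
by rewrite mulrN opprK.
Qed.

(** The derivative of [csq p] is twice the real inner product of [p'] and [p], with
    [p' = lam p - f]. *)
Lemma energy x : D x -> csq (p x) = csq (p 0) + 2 * complex.Re lam * (\int[mu]_(y in `[0, x]) csq (p y)) -
  \int[mu]_(y in `[0, x]) (2 * rdot (f y) (p y)).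
Proof.
move=> Dx; have [A B] := Hp.
have A2 := acRM hD A A; have B2 := acRM hD B B.
have [_] := acRD A2 B2 Dx.
have I1 := rintZ (2 * complex.Re lam) (measurable_itv _) (L2_csq (AC_L2 Dx)).
have I2 := rintZ 2 (measurable_itv _) (rdot_int Dx).
rewrite /= (@Rint_eq _ _ _ (fun y => 2 * complex.Re lam * csq (p y) - 2 * rdot (f y) (p y))); last first.
  move=> y _; rewrite /csq /rdot /re /im; case: lam (p y) (f y) => [a b] [c d] [k l] /=; ring.
rewrite (RintegralB _ I1 I2)// RintegralZl//; last exact: L2_csq (AC_L2 Dx).
by rewrite /csq /re /im /= !expr2 addrA.
Qed.

(** Young's inequality with weight [m] consumes half of the dissipation [2 * m] times the integral
    of [csq p]; the other half stays on the left. *)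
Lemma energy_decay m x : 0 < m -> complex.Re lam = - m -> D x ->
  csq (p x) + m * (\int[mu]_(y in `[0, x]) csq (p y)) <=
  csq (p 0) + m^-1 * \int[mu]_(y in `[0, x]) csq (f y).
Proof.
move=> m0 lm Dx; rewrite (energy Dx) lm.
have I1 := rintZ m (measurable_itv _) (L2_csq (AC_L2 Dx)).
have I2 := rintZ m^-1 (measurable_itv _) (L2_csq (L2loc_sub hD fl Dx)).
have I3 := rintN (measurable_itv _) (rintZ 2 (measurable_itv _) (rdot_int Dx)).
have : \int[mu]_(y in `[0, x]) - (2 * rdot (f y) (p y)) <=
   \int[mu]_(y in `[0, x]) (m * csq (p y) + m^-1 * csq (f y)).
  apply: le_Rintegral => //; first exact: rintD.
  by move=> y _; have [] := rdot_le (f y) (p y) m0.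
rewrite (RintegralD _ I1 I2)// (RintegralZl m)//; last exact: L2_csq (AC_L2 Dx).
rewrite (RintegralZl m^-1)//; last exact: L2_csq (L2loc_sub hD fl Dx).
rewrite (@Rint_eq _ _ _ (fun y => -1 * (2 * rdot (f y) (p y)))); last by move=> y _; rewrite mulN1r.
rewrite (RintegralZl (-1))//; last exact: rintZ (rdot_int Dx).
by move=> H; lra.
Qed.

(** The same balance read backwards from a zero at [x], which controls the initial value of a
    growing solution. *)
Lemma energy_grow m x : 0 < m -> complex.Re lam = m -> D x -> p x = 0 ->
  csq (p 0) + m * (\int[mu]_(y in `[0, x]) csq (p y)) <=
  m^-1 * \int[mu]_(y in `[0, x]) csq (f y).
Proof.
move=> m0 lm Dx px; have := energy Dx; rewrite px csq0 lm.
have I1 := rintZ m (measurable_itv _) (L2_csq (AC_L2 Dx)).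
have I2 := rintZ m^-1 (measurable_itv _) (L2_csq (L2loc_sub hD fl Dx)).
have I3 := rintZ 2 (measurable_itv _) (rdot_int Dx).
have : \int[mu]_(y in `[0, x]) (2 * rdot (f y) (p y)) <=
   \int[mu]_(y in `[0, x]) (m * csq (p y) + m^-1 * csq (f y)).
  apply: le_Rintegral => //; first exact: rintD.
  by move=> y _; have [] := rdot_le (f y) (p y) m0.
rewrite (RintegralD _ I1 I2)// (RintegralZl m)//; last exact: L2_csq (AC_L2 Dx).
rewrite (RintegralZl m^-1)//; last exact: L2_csq (L2loc_sub hD fl Dx).
move: (\int[mu]_(y in `[0, x]) csq (p y)) (\int[mu]_(y in `[0, x]) (2 * rdot (f y) (p y))) (m^-1 * _) (csq (p 0)).
by move=> A B F E H1 H2; lra.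
Qed.

End Energy.

Local Notation Iy := (`[0, +oo[%classic : set R).

Lemma Iy_bigcup : Iy = \bigcup_n (`[0, n%:R]%classic : set R).
Proof.
apply/seteqP; split => x /=.
  rewrite in_itv /= andbT => x0; exists (Num.truncn x).+1 => //=.
  by rewrite in_itv /= x0 ltW// Num.Theory.truncnS_gt.
by move=> [n _ /=]; rewrite !in_itv /= andbT => /andP[].
Qed.

Lemma L2_bound p B : ccontinuous_on Iy p ->
  (forall n : nat, \int[mu]_(x in `[0, n%:R]) csq (p x) <= B) ->
  L2 Iy p /\ \int[mu]_(x in Iy) csq (p x) <= B.
Proof.
move=> [cr ci] pB.
have mr : mfn Iy (re p) := cont_meas (@hdom_cy R) cr.
have mi : mfn Iy (im p) := cont_meas (@hdom_cy R) ci.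
have mc := csq_meas mr mi.
have sub n : `[0, n%:R]%classic `<=` Iy by move=> x /=; rewrite !in_itv /= andbT => /andP[].
have ii n : rint `[0, n%:R] (fun x => csq (p x)).
  by apply: L2_csq; apply: L2_cont; split; [apply: continuous_subspaceW cr|apply: continuous_subspaceW ci]; exact: sub.
have cv : (\int[mu]_(x in `[0%R, n%:R]) (csq (p x))%:E)%E @[n --> \oo] --> (\int[mu]_(x in Iy) (csq (p x))%:E)%E.
  rewrite Iy_bigcup; apply: ge0_nondecreasing_set_cvg_integral => //.
  - move=> n m nm; rewrite subsetEset => x /=; rewrite !in_itv /= => /andP[-> xn] /=.
    by rewrite (le_trans xn)// ler_nat.
  - by move=> n; apply/measurable_EFinP; exact: rint_measurable (ii n).
  - by move=> n x _; rewrite lee_fin csq_ge0.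
have le : (\int[mu]_(x in Iy) (csq (p x))%:E <= B%:E)%E.
  rewrite -(cvg_lim _ cv)//; apply: lime_le; first by apply/cvg_ex; eexists; exact: cv.
  apply: nearW => n; rewrite -(fineK (integrable_fin_num _ (ii n)))// lee_fin; exact: pB.
have fin : (\int[mu]_(x in Iy) (csq (p x))%:E < +oo)%E by apply: le_lt_trans le _; rewrite ltry.
split.
  apply: L2_intro => //; apply/integrableP; split; first exact/measurable_EFinP.
  by under eq_integral do rewrite gee0_abs ?lee_fin ?csq_ge0//.
by rewrite -lee_fin fineK// ge0_fin_numE// integral_ge0// => x _; rewrite lee_fin csq_ge0.
Qed.

Lemma Rint_cvg_Iy (g : R -> R) : rint Iy g ->
  \int[mu]_(x in `[0, n%:R]) g x @[n --> \oo] --> \int[mu]_(x in Iy) g x.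
Proof.
move=> gi.
have [] := @Rdominated_cvg R Iy (fun n x => (g \_ `[0, n%:R]) x) g (fun x => `|g x|) _ _ _ _ _.
- exact: measurable_itv.
- move=> n; apply: measurable_funS (@subsetT _ _) _; first by [].
  apply/(measurable_restrictT _ _).1 => //.
  apply: measurable_funS (rint_measurable gi) => //.
  by move=> x /=; rewrite !in_itv /= andbT => /andP[].
- exact: rint_abs.
- by move=> n x _; rewrite patchE; case: ifP => _; rewrite ?normr0.
- move=> x x0; apply: cvg_near_cst; near=> n; rewrite patchE mem_setE in_itv /=.
  move: x0; rewrite /= in_itv /= andbT => -> /=.
  rewrite ifT//; near: n; exact: nbhs_infty_ger.
move=> _; under eq_fun do rewrite -Rintegral_mkcondr.
rewrite (_ : (fun n : nat => _) = (fun n : nat => \int[mu]_(x in `[0, n%:R]) g x)) //.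
apply/funext => n; rewrite setIidr// => x /=; rewrite !in_itv /= andbT => /andP[//].
Unshelve. all: by end_near.
Qed.

End FirstOrder.

(** * The second-order equation on an edge: uniqueness and bounds *)

Section SecondOrder.
Variable R : realType.
Local Notation mu := (@lebesgue_measure R).
Local Notation C := R[i].
Local Notation mset D := (measurable (D : set (measurableTypeR R))).
Local Notation Iy := (`[0, +oo[%classic : set R).
Implicit Types (D : set R) (a b x y L : R) (f g h p q u : R -> C) (lam c nu : C).
Let hIy : hdom Iy := @hdom_cy R.

Lemma Iy0n (n : nat) : Iy n%:R.
Proof. by rewrite /= in_itv /= andbT. Qed.

Lemma csq_int_le D D' f : mset D -> mset D' -> D' `<=` D -> L2 D f ->
  \int[mu]_(x in D') csq (f x) <= \int[mu]_(x in D) csq (f x).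
Proof.
move=> mD mD' sub fi.
rewrite Rintegral_mkcond [leRHS]Rintegral_mkcond; apply: le_Rintegral => //.
- apply: (rint_restrict _ mD').1; exact: rintS (L2_csq fi).
- exact: (rint_restrict _ mD).1 (L2_csq fi).
- move=> x _; rewrite !patchE; case: ifPn; last by case: ifP; rewrite ?csq_ge0.
  by rewrite inE => /sub Dx; rewrite mem_set.
Qed.

Lemma csq_int_ge0 D f : 0 <= \int[mu]_(x in D) csq (f x).
Proof. by apply: Rintegral_ge0 => x _; exact: csq_ge0. Qed.

Lemma sub0n (n : nat) : `[0, n%:R] `<=` Iy.
Proof. by move=> x /=; rewrite !in_itv /= andbT => /andP[]. Qed.

Lemma decay_L2 (m : R) lam f q : 0 < m -> complex.Re lam = - m -> L2 Iy f ->
  AC Iy q (fun x => lam * q x - f x) ->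
  L2 Iy q /\ \int[mu]_(x in Iy) csq (q x) <= m^-1 * (csq (q 0) + m^-1 * \int[mu]_(x in Iy) csq (f x)).
Proof.
move=> m0 lm f2 H; apply: L2_bound; first exact: AC_cont H.
move=> n; have := energy_decay hIy (L2_loc hIy f2) H m0 lm (Iy0n n).
have := csq_int_le (hdom_meas hIy) (measurable_itv _) (@sub0n n) f2.
have mi : 0 < m^-1 by rewrite invr_gt0.
move=> /(ler_wpM2l (ltW mi)) H1 H2; rewrite mulrC ler_pdivlMr// mulrC.
by have := csq_ge0 (q n%:R); lra.
Qed.

Lemma cexp_decay (m : R) lam : 0 < m -> complex.Re lam = - m -> L2 Iy (fun x => cexp (lam * x%:C)).
Proof.
move=> m0 lm; have [] := decay_L2 m0 lm (L2_0 (hdom_meas hIy)) (q := fun x => cexp (lam * x%:C)) => //.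
by apply: AC_eq (AC_cexp lam hIy) => // x _; rewrite subr0.
Qed.

Lemma cvg_le_mul (K : R) (t : nat -> R) (A B : R) : t n @[n --> \oo] --> 0 ->
  (forall n, A <= B + K * t n) -> A <= B.
Proof.
move=> t0 H; have cv : B + K * t n @[n --> \oo] --> B + K * 0.
  by apply: cvgD; [exact: cvg_cst|apply: cvgM => //; exact: cvg_cst].
rewrite mulr0 addr0 in cv; rewrite -(cvg_lim _ cv)//.
by apply: limr_ge; [apply/cvg_ex; eexists; exact: cv|exact: nearW].
Qed.

(* The solution is [fo_sol] with [p 0] the integral of [exp (- lam y) f y] over the half-line; the
   bounds come from the solutions vanishing at [n], which converge to it. *)
Lemma grow_exists (m : R) lam f : 0 < m -> complex.Re lam = m -> L2 Iy f ->
  exists p, [/\ AC Iy p (fun x => lam * p x - f x), L2 Iy p,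
    csq (p 0) <= 2 * (m^-1 * \int[mu]_(x in Iy) csq (f x)) &
    \int[mu]_(x in Iy) csq (p x) <= 2 * (m^-1 * (m^-1 * \int[mu]_(x in Iy) csq (f x)))].
Proof.
move=> m0 lm f2; pose k y : C := cexp (- lam * y%:C) * f y.
have ki : cinteg Iy k.
  apply: L2_mul => //; apply: (cexp_decay m0).
  by case: lam lm {k} => r s /= ->.
have fl := L2_loc hIy f2.
pose P := cint Iy k.
pose cn (n : nat) := cint `[0, n%:R] k.
(* The half-line solution and the one vanishing at [n] differ by [P - cn n] times the exponential;
   this factor tends to zero because [k] is integrable. *)
pose t n := csq (P - cn n).
have t0 : t n @[n --> \oo] --> (0 : R).
  rewrite /t (_ : (fun n => _) = fun n => (\int[mu]_(y in Iy) re k y - \int[mu]_(y in `[0, n%:R]) re k y) ^+ 2 +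
     (\int[mu]_(y in Iy) im k y - \int[mu]_(y in `[0, n%:R]) im k y) ^+ 2) //.
  have [kr kim] := ki.
  have sq (A : R) (B : nat -> R) : B n @[n --> \oo] --> A -> (A - B n) ^+ 2 @[n --> \oo] --> (0 : R).
    move=> cB; rewrite -(_ : (A - A) ^+ 2 = 0); last by rewrite subrr expr0n.
    by rewrite !expr2; apply: cvgM; apply: cvgB => //; exact: cvg_cst.
  by have := cvgD (sq _ _ (Rint_cvg_Iy kr)) (sq _ _ (Rint_cvg_Iy kim)); rewrite addr0; exact.
have [Hp p0] := fo_AC lam P hIy fl.
have tE n x : Iy x -> fo_sol lam P f x - fo_sol lam (cn n) f x = (P - cn n) * cexp (lam * x%:C).
  by move=> _; rewrite /fo_sol; ring.
pose F := \int[mu]_(x in Iy) csq (f x).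
have mi : 0 < m^-1 by rewrite invr_gt0.
have En n : csq (fo_sol lam (cn n) f 0) + m * (\int[mu]_(y in `[0, n%:R]) csq (fo_sol lam (cn n) f y)) <= m^-1 * F.
  have [Hn _] := fo_AC lam (cn n) hIy fl.
  have pn : fo_sol lam (cn n) f n%:R = 0 by rewrite /fo_sol -/k /cn subrr mulr0.
  apply: le_trans (energy_grow hIy fl Hn m0 lm (Iy0n n) pn) _.
  apply: ler_wpM2l; first exact: ltW.
  exact: csq_int_le (hdom_meas hIy) (measurable_itv _) (@sub0n n) f2.
have split2 n x : Iy x -> csq (fo_sol lam P f x) <= 2 * csq (fo_sol lam (cn n) f x) + 2 * (t n * csq (cexp (lam * x%:C))).
  move=> Ix; rewrite -csqM -tE//; have -> : fo_sol lam P f x = fo_sol lam (cn n) f x + (fo_sol lam P f x - fo_sol lam (cn n) f x).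
    by rewrite addrC subrK.
  rewrite [X in _ <= _ + 2 * csq (X - _)]addrC subrK.
  exact: csqD_le.
exists (fo_sol lam P f).
have B2 : forall n : nat, \int[mu]_(x in `[0, n%:R]) csq (fo_sol lam P f x) <= 2 * (m^-1 * (m^-1 * F)).
  move=> n.
  pose K := \int[mu]_(x in `[0, n%:R]) csq (cexp (lam * x%:C)).
  (* The shift by [n] puts the zero [j + n] of the approximating solution to the right of [[0, n]],
     so that its energy bound covers this interval. *)
  apply: (@cvg_le_mul (2 * K) (fun j => t (j + n)%N)).
    exact: (cvg_comp _ _ (cvg_addnr n) t0).
  move=> j.
  pose q := fo_sol lam (cn (j + n)%N) f.
  have [Hq _] := fo_AC lam (cn (j + n)%N) hIy fl.
  have q2 : L2 `[0, n%:R] q := AC_L2 hIy Hq (Iy0n n).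
  have I1 := rintZ 2 (measurable_itv _) (L2_csq q2).
  have I2 := rintZ (t (j + n)%N) (measurable_itv _) (L2_csq (cexp_L2 lam n%:R)).
  have I3 := rintZ 2 (measurable_itv _) I2.
  have H1 : \int[mu]_(x in `[0, n%:R]) csq (fo_sol lam P f x) <=
     \int[mu]_(x in `[0, n%:R]) (2 * csq (q x) + 2 * (t (j + n)%N * csq (cexp (lam * x%:C)))).
    apply: le_Rintegral => //.
    - exact: L2_csq (AC_L2 hIy Hp (Iy0n n)).
    - exact: rintD.
    - by move=> x xn; apply: split2; exact: sub0n xn.
  apply: (le_trans H1); rewrite (RintegralD _ I1 I3)//.
  rewrite (RintegralZl 2)//; last exact: L2_csq q2.
  have -> : \int[mu]_(x in `[0, n%:R]) (2 * (t (j + n)%N * csq (cexp (lam * x%:C)))) = 2 * (t (j + n)%N * K).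
    rewrite /K -RintegralZl//; last exact: L2_csq (cexp_L2 lam n%:R).
    by rewrite -RintegralZl.
  have H2 : \int[mu]_(x in `[0, n%:R]) csq (q x) <= m^-1 * (m^-1 * F).
    rewrite mulrC ler_pdivlMr// mulrC.
    apply: le_trans (En (j + n)%N); apply: ler_wpDl; first exact: csq_ge0.
    apply: ler_wpM2l; first exact: ltW.
    apply: csq_int_le => //; last exact: (AC_L2 hIy Hq (Iy0n (j + n)%N)).
    move=> x /=; rewrite !in_itv /= => /andP[-> xn] /=; apply: (le_trans xn).
    by rewrite ler_nat leq_addl.
  rewrite (_ : 2 * K * t (j + n)%N = 2 * (t (j + n)%N * K)); last by ring.
  by rewrite lerD2r ler_pM2l.
have [A B] := L2_bound (AC_cont hIy Hp) B2; split => //.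
apply: (@cvg_le_mul 2 t) => // n.
have := split2 n 0 (hdom0 hIy); rewrite mulr0 cexp0 csq1.
rewrite mulr1 => H; apply: (le_trans H); rewrite lerD2r ler_pM2l//.
apply: le_trans (En n); apply: ler_wpDr => //.
by apply: mulr_ge0; [exact: ltW|exact: csq_int_ge0].
Qed.

(** A solution with non-decaying exponential satisfies [csq (p x) >= csq (p 0)], so its integral
    over [[0, n]] is at least [n * csq (p 0)]. The purely oscillating case is included. *)
Lemma grow_L2_eq0 lam p : 0 <= complex.Re lam -> AC Iy p (fun x => lam * p x) -> L2 Iy p ->
  forall x, Iy x -> p x = 0.
Proof.
move=> l0 H p2 x Ix; have E := fo_hom hIy H; rewrite E//.
suff /csq_eq0 -> : csq (p 0) = 0 by rewrite mul0r.
pose B := \int[mu]_(x in Iy) csq (p x).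
have le n : csq (p 0) * n%:R <= B.
  apply: le_trans (csq_int_le (hdom_meas hIy) (measurable_itv _) (@sub0n n) p2).
  have sub : `]0%R, (n%:R : R)] `<=` `[0, n%:R].
    by move=> y /=; rewrite !in_itv /= => /andP[/ltW -> ->].
  have n0 : (0 : R) <= n%:R by [].
  have p2n : L2 `[0, n%:R] p by apply: L2S p2 => //; exact: sub0n.
  rewrite -[X in _ * X]subr0 -(Rint_cst_oc _ n0).
  apply: le_trans (csq_int_le (measurable_itv _) (measurable_itv _) sub p2n).
  apply: le_Rintegral => //.
  - by apply: rintS (rint_cst 0 n%:R (csq (p 0))).
  - by apply: rintS (L2_csq p2n).
  move=> y /= yn; rewrite (E y (sub0n (sub y yn))) csqM csq_cexp ReMr.
  rewrite ler_peMr ?csq_ge0// -expR0 ler_expR mulr_ge0// mulr_ge0//.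
  by move: yn; rewrite in_itv /= => /andP[/ltW].
apply/eqP; rewrite eq_le csq_ge0 andbT leNgt; apply/negP => c0.
have := le (Num.truncn (B / csq (p 0))).+1.
by rewrite leNgt mulrC -ltr_pdivrMr// Num.Theory.truncnS_gt.
Qed.

Lemma fo_bound L lam : 0 < L -> exists M, 0 <= M /\ forall f, L2 `[0, L] f ->
  forall x, `[0, L]%classic x -> csq (fo_sol lam 0 f x) <= M * \int[mu]_(y in `[0, L]) csq (f y).
Proof.
move=> L0; have hL := hdom_cc L0.
(* Multiplication by [exp (- s y)] brings the real part of the rate to -1, where [energy_decay]
   applies. [E] bounds the squared modulus of [exp (s y)] and [exp (- s y)] on [[0, L]]; it enters
   once for the data and once for undoing the twist. *)
pose s := complex.Re lam + 1; pose E := expR (2 * (`|s| * L)).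
exists (E * E); split; first by rewrite mulr_ge0 ?expR_ge0.
move=> f f2 x xL.
have [Hp p0] := fo_AC lam 0 hL (L2_loc hL f2).
set p := fo_sol lam 0 f in Hp p0 *.
pose e y : C := cexp ((- s)%:C * y%:C).
have Ee y : `[0, L]%classic y -> csq (e y) <= E.
  rewrite /= in_itv /= => /andP[y0 yL]; rewrite /e csq_cexp ReMr /= ler_expR ler_pM2l//.
  apply: le_trans (ler_norm _) _; rewrite normrM normrN (ger0_norm y0).
  by apply: ler_wpM2l.
have Hs : AC `[0, L] (fun y => p y * e y) (fun y => (lam - s%:C) * (p y * e y) - f y * e y).
  apply: AC_eq (ACM hL Hp (AC_cexp (- s)%:C hL)) => // y _.
  by rewrite /e rmorphN; move: (cexp _) => w; ring.
have fe2 : L2 `[0, L] (fun y => f y * e y).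
  have [mr mi ff] := f2.
  have [er ei] := cexp_cont (- s)%:C hL.
  apply: L2_intro.
  - by rewrite reM; apply: measurable_funB; apply: measurable_funM => //; exact: cont_meas.
  - by rewrite imM; apply: measurable_funD; apply: measurable_funM => //; exact: cont_meas.
  - have [er2 ei2 e2] := L2_cont (conj er ei).
    apply: (@rint_eq _ _ (fun y => csq (f y) * csq (e y))) => //.
      by move=> y _; rewrite csqM.
    apply: (@rintM_bdd _ _ _ _ E) => //; first exact: csq_meas.
    by move=> y yL; rewrite ger0_norm ?csq_ge0 ?Ee.
have R1 : complex.Re (lam - s%:C) = -1 by rewrite /s; case: lam {p Hp p0 s E e Ee Hs fe2} => r t /=; ring.
have := energy_decay hL (L2_loc hL fe2) Hs ltr01 R1 xL.
rewrite p0 mul0r csq0 add0r invr1 !mul1r csqM => H.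
have H1 : csq (p x) * csq (e x) <= E * \int[mu]_(y in `[0, L]) csq (f y).
  apply: le_trans _ (_ : \int[mu]_(y in `[0, x]) csq (f y * e y) <= _); last first.
    apply: le_trans (csq_int_le (measurable_itv _) (measurable_itv _) (hdom_sub hL xL) fe2) _.
    rewrite -RintegralZl//; last exact: L2_csq.
    apply: le_Rintegral => //; [exact: L2_csq|by apply: rintZ => //; exact: L2_csq|].
    by move=> y yL; rewrite csqM mulrC ler_wpM2r ?csq_ge0 ?Ee.
  by apply: le_trans H; rewrite lerDl csq_int_ge0.
have ex : csq (cexp (s%:C * x%:C)) <= E.
  move: xL; rewrite /= in_itv /= => /andP[x0 xL]; rewrite csq_cexp ReMr /= ler_expR ler_pM2l//.
  apply: le_trans (ler_norm _) _; rewrite normrM (ger0_norm x0).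
  by apply: ler_wpM2l.
have -> : csq (p x) = csq (cexp (s%:C * x%:C)) * (csq (p x) * csq (e x)).
  by rewrite mulrCA -csqM /e rmorphN mulNr cexpN csq1 mulr1.
rewrite -mulrA; apply: ler_pM => //; first exact: csq_ge0.
by rewrite mulr_ge0 ?csq_ge0.
Qed.

(* [u'' = nu^2 u - f] factors through the first-order equations for [u' -+ nu u]. *)
Lemma W2_fo D u u1 f nu : hdom D -> W2 D u u1 (fun x => nu ^+ 2 * u x - f x) ->
  AC D (fun x => u1 x - nu * u x) (fun x => (- nu) * (u1 x - nu * u x) - f x) /\
  AC D (fun x => u1 x + nu * u x) (fun x => nu * (u1 x + nu * u x) - f x).
Proof.
move=> hD [A B]; have A' := ACZ nu hD A; split.
- by apply: AC_eq (ACB B A') => // x _; ring.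
- by apply: AC_eq (ACD B A') => // x _; ring.
Qed.

Lemma fo_W2 D p q f nu : hdom D -> nu != 0 ->
  AC D p (fun x => (- nu) * p x - f x) -> AC D q (fun x => nu * q x - f x) ->
  W2 D (fun x => (2 * nu)^-1 * (q x - p x)) (fun x => 2^-1 * (q x + p x))
   (fun x => nu ^+ 2 * ((2 * nu)^-1 * (q x - p x)) - f x).
Proof.
move=> hD nu0 A B; split.
- apply: AC_eq (ACZ (2 * nu)^-1 hD (ACB B A)) => // x _; by field.
- apply: AC_eq (ACZ 2^-1 hD (ACD B A)) => // x _; by field.
Qed.

Definition exp_sol nu x : C := cexp (nu * x%:C).

Lemma exp_W2 D nu : hdom D ->
  W2 D (exp_sol nu) (fun x => nu * exp_sol nu x) (fun x => nu ^+ 2 * exp_sol nu x).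
Proof.
move=> hD; split; first exact: AC_cexp.
by apply: AC_eq (ACZ nu hD (AC_cexp nu hD)) => // x _; rewrite mulrA -expr2.
Qed.

Lemma hom_sol D u u1 nu : hdom D -> nu != 0 -> W2 D u u1 (fun x => nu ^+ 2 * u x) ->
  forall x, D x ->
  u x = (2 * nu)^-1 * (u1 0 + nu * u 0) * exp_sol nu x - (2 * nu)^-1 * (u1 0 - nu * u 0) * exp_sol (- nu) x /\
  u1 x = (2 * nu)^-1 * (u1 0 + nu * u 0) * (nu * exp_sol nu x) - (2 * nu)^-1 * (u1 0 - nu * u 0) * (- nu * exp_sol (- nu) x).
Proof.
move=> hD nu0 H x Dx.
have H' : W2 D u u1 (fun x => nu ^+ 2 * u x - 0).
  by case: H => A B; split => //; apply: AC_eq B => // y _; rewrite subr0.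
have [A B] := W2_fo hD H'.
have Ea : u1 x - nu * u x = (u1 0 - nu * u 0) * exp_sol (- nu) x.
  by apply: (@fo_hom R D (- nu) (fun x => u1 x - nu * u x) hD _ x Dx); apply: AC_eq A => // y _; rewrite subr0.
have Eb : u1 x + nu * u x = (u1 0 + nu * u 0) * exp_sol nu x.
  by apply: (@fo_hom R D nu (fun x => u1 x + nu * u x) hD _ x Dx); apply: AC_eq B => // y _; rewrite subr0.
split.
- rewrite -mulrA -Eb -mulrA -Ea; by field.
- rewrite (_ : _ * (nu * _) = 2^-1 * ((u1 0 + nu * u 0) * exp_sol nu x)); last by field.
  rewrite (_ : _ * (- nu * _) = - (2^-1 * ((u1 0 - nu * u 0) * exp_sol (- nu) x))); last by field.
  rewrite -Ea -Eb; by field.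
Qed.

(** The combination [u1 - nu * u] is a square-integrable solution with the non-decaying rate [- nu],
    hence zero. *)
Lemma lead_hom u u1 nu : nu != 0 -> complex.Re nu <= 0 -> W2 Iy u u1 (fun x => nu ^+ 2 * u x) ->
  L2 Iy u -> L2 Iy u1 -> forall x, Iy x -> u x = u 0 * exp_sol nu x /\ u1 x = u 0 * (nu * exp_sol nu x).
Proof.
move=> nu0 re0 H u2 u12 x Ix.
have H' : W2 Iy u u1 (fun x => nu ^+ 2 * u x - 0).
  by case: H => A B; split => //; apply: AC_eq B => // y _; rewrite subr0.
have [A _] := W2_fo hIy H'.
have z : forall x, Iy x -> u1 x - nu * u x = 0.
  apply: (@grow_L2_eq0 (- nu)).
  - by case: nu re0 {nu0 H H' A} => r s /=; rewrite oppr_ge0.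
  - by apply: AC_eq A => // y _; rewrite subr0.
  - by apply: L2B => //; apply: L2Z.
have z0 := z 0 (hdom0 hIy).
have [-> ->] := hom_sol hIy nu0 H Ix; rewrite z0 mulr0 !mul0r !subr0.
have -> : u1 0 = nu * u 0 by apply/eqP; rewrite -subr_eq0 z0.
by split; field.
Qed.

(** Both [nu] and [- nu] are admissible in [lead_hom], so [u1 = nu * u = - nu * u]. This is what
    makes eigenfunctions of [H] vanish on the leads. *)
Lemma lead_hom_real u u1 nu : nu != 0 -> complex.Re nu = 0 -> W2 Iy u u1 (fun x => nu ^+ 2 * u x) ->
  L2 Iy u -> L2 Iy u1 -> forall x, Iy x -> u x = 0 /\ u1 x = 0.
Proof.
move=> nu0 re0 H u2 u12 x Ix.
have r1 : complex.Re nu <= 0 by rewrite re0.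
have r2 : complex.Re (- nu) <= 0 by case: nu re0 {nu0 H r1} => r s /= ->; rewrite oppr0.
have H' : W2 Iy u u1 (fun x => (- nu) ^+ 2 * u x) by rewrite sqrrN.
have nu0' : - nu != 0 by rewrite oppr_eq0.
have e y : Iy y -> u1 y = nu * u y.
  by move=> /(lead_hom nu0 r1 H u2 u12)[-> ->]; ring.
have e' y : Iy y -> u1 y = - nu * u y.
  by move=> /(lead_hom nu0' r2 H' u2 u12)[-> ->]; ring.
have u0 : u x = 0.
  have := e' x Ix; rewrite e// => /eqP; rewrite -subr_eq0 mulNr opprK -mulr2n.
  by rewrite mulrn_eq0 /= mulf_eq0 (negbTE nu0) /= => /eqP.
by rewrite e// u0 mulr0.
Qed.

Lemma csq_comb (c z w : C) (A B : R) : csq z <= A -> csq w <= B ->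
  csq (c * (z + w)) <= csq c * (2 * (A + B)).
Proof.
move=> zA wB; rewrite csqM; apply: ler_wpM2l; first exact: csq_ge0.
by apply: le_trans (csqD_le _ _) _; rewrite (mulrDr 2 A B); apply: lerD; rewrite ler_pM2l.
Qed.

Lemma csq_int_comb D (c : C) p q (A B : R) : mset D -> L2 D p -> L2 D q ->
  \int[mu]_(x in D) csq (p x) <= A -> \int[mu]_(x in D) csq (q x) <= B ->
  \int[mu]_(x in D) csq (c * (p x + q x)) <= csq c * (2 * (A + B)).
Proof.
move=> mD p2 q2 pA qB.
have pi := L2_csq p2; have qi := L2_csq q2.
have I : rint D (fun x => 2 * csq (p x) + 2 * csq (q x)) by apply: rintD => //; apply: rintZ.
apply: (@le_trans _ _ (\int[mu]_(x in D) (csq c * (2 * csq (p x) + 2 * csq (q x))))).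
  apply: le_Rintegral => //; [by apply: L2_csq; apply: L2Z => //; exact: L2D|exact: rintZ|].
  by move=> x _; rewrite csqM ler_wpM2l ?csq_ge0 ?csqD_le.
rewrite RintegralZl//; apply: ler_wpM2l; first exact: csq_ge0.
rewrite (RintegralD _ (rintZ 2 mD pi) (rintZ 2 mD qi))//.
rewrite (RintegralZl 2 mD pi) (RintegralZl 2 mD qi).
by rewrite (mulrDr 2 A B); apply: lerD; rewrite ler_pM2l.
Qed.

(** [B] contains the points where traces of [u] and [u'] are taken: a whole internal edge, but only
    the origin of a lead. *)
Definition edge_bound D (B : set R) nu (M : R) := forall f, L2 D f -> exists u u1,
  [/\ W2 D u u1 (fun x => nu ^+ 2 * u x - f x), L2 D u /\ L2 D u1,
      \int[mu]_(x in D) csq (u x) <= M * \int[mu]_(x in D) csq (f x) &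
      forall x, B x -> csq (u x) <= M * \int[mu]_(y in D) csq (f y) /\
                       csq (u1 x) <= M * \int[mu]_(y in D) csq (f y)].

Lemma edge_bound_int L nu : 0 < L -> nu != 0 ->
  exists M, 0 <= M /\ edge_bound `[0, L] `[0, L] nu M.
Proof.
move=> L0 nu0; have hL := hdom_cc L0.
have [M1 [M10 H1]] := fo_bound nu L0; have [M2 [M20 H2]] := fo_bound (- nu) L0.
pose a : C := (2 * nu)^-1; pose b : C := 2^-1.
pose K := (csq a + csq b) * (2 * (M1 + M2)).
have ac : 0 <= csq a + csq b := addr_ge0 (csq_ge0 a) (csq_ge0 b).
have M0 : 0 <= 2 * (M1 + M2) by apply: mulr_ge0 => //; exact: addr_ge0.
have K0 : 0 <= K := mulr_ge0 ac M0.
have L1 : 0 <= 1 + L by rewrite addr_ge0// ltW.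
have ca : csq a <= csq a + csq b by rewrite lerDl csq_ge0.
have cb : csq b <= csq a + csq b by rewrite lerDr csq_ge0.
have KE (c F : R) : c * (2 * (M1 * F + M2 * F)) = c * (2 * (M1 + M2)) * F by ring.
(* The pointwise bound has constant [K], and its integral over the edge [K * L]. *)
exists (K * (1 + L)); split; first exact: mulr_ge0.
move=> f f2; have fl := L2_loc hL f2.
have [Aq _] := fo_AC nu 0 hL fl; have [Ap _] := fo_AC (- nu) 0 hL fl.
set q := fo_sol nu 0 f in Aq *; set p := fo_sol (- nu) 0 f in Ap *.
set F := \int[mu]_(x in _) csq (f x).
have F0 : 0 <= F by exact: csq_int_ge0.
have p2 : L2 `[0, L] p by apply: L2_cont; exact: AC_cont Ap.
have q2 : L2 `[0, L] q by apply: L2_cont; exact: AC_cont Aq.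
have bu x : `[0, L]%classic x -> csq (a * (q x - p x)) <= K * F.
  move=> xL; have := csq_comb a (H1 f f2 x xL) (_ : csq (- p x) <= M2 * F).
  rewrite csqN => /(_ (H2 f f2 x xL)) H; apply: (le_trans H).
  by rewrite KE; apply: ler_wpM2r => //; exact: ler_wpM2r.
have bu1 x : `[0, L]%classic x -> csq (b * (q x + p x)) <= K * F.
  move=> xL; apply: le_trans (csq_comb b (H1 f f2 x xL) (H2 f f2 x xL)) _.
  by rewrite KE; apply: ler_wpM2r => //; exact: ler_wpM2r.
have KL : K * F <= K * (1 + L) * F.
  by rewrite ler_wpM2r// ler_peMr// lerDl ltW.
have W := fo_W2 hL nu0 Ap Aq.
have u2 : L2 `[0, L] (fun x => a * (q x - p x)) by apply: L2Z => //; exact: L2B.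
have u12 : L2 `[0, L] (fun x => b * (q x + p x)) by apply: L2Z => //; exact: L2D.
exists (fun x => a * (q x - p x)), (fun x => b * (q x + p x)); split => //.
- apply: (@le_trans _ _ (\int[mu]_(x in `[0, L]) (K * F))).
    by apply: le_Rintegral => //; [exact: L2_csq|exact: rint_cst].
  have -> : \int[mu]_(x in `[0, L]) (K * F) = \int[mu]_(x in `]0, L]) (K * F).
    rewrite -(@Rintegral_itv_obnd_cbnd R 0 (BRight L)) //.
    by apply: rintS (rint_cst 0 L (K * F)) => // x /=; rewrite !in_itv /= => /andP[/ltW -> ->].
  rewrite (Rint_cst_oc _ (ltW L0)) subr0 mulrAC ler_wpM2r// ler_wpM2l//.
  by rewrite lerDr.
- by move=> x xL; split; apply: le_trans KL; [exact: bu|exact: bu1].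
Qed.

(** Each first-order factor has a square-integrable solution: for the decaying rate [nu] the one
    starting from zero, for the growing rate [- nu] the one of [grow_exists], fixed at infinity. *)
Lemma edge_bound_lead nu : complex.Re nu < 0 ->
  exists M, 0 <= M /\ edge_bound Iy [set 0] nu M.
Proof.
move=> re0; pose m := - complex.Re nu.
have m0 : 0 < m by rewrite oppr_gt0.
have lq : complex.Re nu = - m by rewrite opprK.
have lp : complex.Re (- nu) = m by rewrite /m; case: (nu).
have nu0 : nu != 0 by apply/eqP => E; move: re0; rewrite E ltxx.
have hI := @hdom_cy R; have mI : mset Iy := hdom_meas hI.
have mi : 0 < m^-1 by rewrite invr_gt0.
pose a : C := (2 * nu)^-1; pose b : C := 2^-1.
(* [A] adds the L^2 constants of [q] and [p], and [B] is the constant for [p 0]; [q 0] is zero. *)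
pose A := m^-1 * m^-1 + 2 * (m^-1 * m^-1); pose B := 2 * m^-1.
have A0 : 0 <= A by rewrite addr_ge0 ?mulr_ge0 ?ltW.
have B0 : 0 <= B by rewrite mulr_ge0 ?ltW.
have ac : 0 <= csq a + csq b := addr_ge0 (csq_ge0 a) (csq_ge0 b).
exists ((csq a + csq b) * (2 * (A + B))); split.
  by apply: mulr_ge0 => //; apply: mulr_ge0 => //; exact: addr_ge0.
move=> f f2; have fl := L2_loc hI f2.
have [Aq q0] := fo_AC nu 0 hI fl.
have [q2 bq] := decay_L2 m0 lq f2 Aq.
have [p [Ap p2 p0 bp]] := grow_exists m0 lp f2.
set q := fo_sol nu 0 f in Aq q0 q2 bq *.
set F := \int[mu]_(x in _) csq (f x) in bq p0 bp *.
have F0 : 0 <= F by exact: csq_int_ge0.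
move: bq; rewrite q0 csq0 add0r => bq.
have W := fo_W2 hI nu0 Ap Aq.
have u2 : L2 Iy (fun x => a * (q x - p x)) by apply: L2Z => //; exact: L2B.
have u12 : L2 Iy (fun x => b * (q x + p x)) by apply: L2Z => //; exact: L2D.
have le (c X Y : R) : 0 <= c -> c <= csq a + csq b -> 0 <= X -> 0 <= Y -> X <= A * F -> Y <= B * F ->
   c * (2 * (X + Y)) <= (csq a + csq b) * (2 * (A + B)) * F.
  move=> c0 cab X0 Y0 XA YB; rewrite -mulrA; apply: ler_pM => //.
    by apply: mulr_ge0 => //; exact: addr_ge0.
  by rewrite -mulrA ler_pM2l// (mulrDl A B) lerD.
have ca : csq a <= csq a + csq b by rewrite lerDl csq_ge0.
have cb : csq b <= csq a + csq b by rewrite lerDr csq_ge0.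
exists (fun x => a * (q x - p x)), (fun x => b * (q x + p x)); split => //.
- apply: le_trans (csq_int_comb a mI q2 (L2N mI p2) bq _) _.
    rewrite (@Rint_eq _ _ _ (fun x => csq (p x))); first exact: bp.
    by move=> x _; rewrite csqN.
  have -> : m^-1 * (m^-1 * F) + 2 * (m^-1 * (m^-1 * F)) = A * F + 0 by rewrite /A; ring.
  apply: le => //; [exact: csq_ge0|exact: mulr_ge0|exact: mulr_ge0].
- move=> x ->; rewrite q0; split.
  + apply: le_trans (csq_comb a (_ : csq 0 <= 0) (_ : csq (- p 0) <= B * F)) _.
    * by rewrite csq0.
    * by rewrite csqN /B -mulrA.
    by apply: le => //; [exact: csq_ge0|exact: mulr_ge0|exact: mulr_ge0].
  + apply: le_trans (csq_comb b (_ : csq 0 <= 0) (_ : csq (p 0) <= B * F)) _.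
    * by rewrite csq0.
    * by rewrite /B -mulrA.
    by apply: le => //; [exact: csq_ge0|exact: mulr_ge0|exact: mulr_ge0].
Qed.

End SecondOrder.

(** * The operators in terms of edgewise solutions *)

Section GraphOps.
Variables (R : realType) (G : qgraph R).
Local Notation mu := (@lebesgue_measure R).
Local Notation C := R[i].
Implicit Types (f g h u : gfun G) (v : vtx G) (kap z : C).

Lemma hdom_edom (e : edge G) : hdom (edom e).
Proof. by case: e => [i|l]; [apply: hdom_cc; exact: len_gt0|exact: hdom_cy]. Qed.

Lemma mset_edom (e : edge G) : measurable (edom e : set (measurableTypeR R)).
Proof. exact: hdom_meas (hdom_edom e). Qed.

(** Two ends for an internal edge and one for a lead: also the number of exponentials available
    there, since only the decaying one is kept on a lead. *)
Definition gend : finType := (iend G + lead G)%type.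

Definition gvtx (a : gend) : vtx G := match a with inl a => end_vtx a | inr l => Defs.root l end.

(* The factors [exp (- kap / 2)] and [exp (- 3 kap / 2)] turn the interface conditions of
   [H(kap)] into continuity and Kirchhoff conditions for these scaled traces. *)
Definition tval kap f (a : gend) : C :=
  match a with inl a => end_val f a | inr l => cexp (- (kap / 2%:R)) * f (inr l) 0 end.

Definition tder kap (f1 : gfun G) (a : gend) : C :=
  match a with
  | inl a => if a.2 then - f1 (inl a.1) (len a.1) else f1 (inl a.1) 0
  | inr l => cexp (- (3%:R * kap / 2%:R)) * f1 (inr l) 0
  end.

Definition vcond kap f (f1 : gfun G) :=
  (forall a b, gvtx a = gvtx b -> tval kap f a = tval kap f b) /\
  (forall v, \sum_(a : gend | gvtx a == v) tder kap f1 a = 0).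

(** On a lead the equation [- exp (- 2 kap) f'' = h] is solved for [f'']. *)
Definition cfac kap (e : edge G) : C := match e with inl _ => 1 | inr _ => cexp (2%:R * kap) end.

Definition esol kap f (f1 : gfun G) h := forall e,
  W2 (edom e) (f e) (f1 e) (fun x => - (cfac kap e * h e x)) /\ L2 (edom e) (f e) /\ L2 (edom e) (f1 e).

Definition gW2 f (f1 : gfun G) := forall e, AC (edom e) (f e) (f1 e) /\ ccontinuous_on (edom e) (f1 e).

Lemma esol_gW2 kap f (f1 : gfun G) h : esol kap f f1 h -> gW2 f f1.
Proof. by move=> H e; have [[A B] _] := H e; split => //; apply: AC_cont B; exact: hdom_edom. Qed.

Lemma end_derivE kap f (f1 : gfun G) (a : iend G) : gW2 f f1 -> end_deriv f a = tder kap f1 (inl a).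
Proof.
move=> H; case: a => i b; have [A c] := H (inl i); rewrite /end_deriv /=; case: b => /=.
- exact: (AC_rderivL (len_gt0 i) A c).
- exact: (AC_rderiv0 (hdom_edom (inl i)) A c).
Qed.

Lemma lead_derivE f (f1 : gfun G) (l : lead G) : gW2 f f1 -> rderiv0 (f (inr l)) = f1 (inr l) 0.
Proof. by move=> H; have [A c] := H (inr l); exact: (AC_rderiv0 (hdom_edom (inr l)) A c). Qed.

Lemma kirchhoffE kap f (f1 : gfun G) v : gW2 f f1 ->
  \sum_(a : gend | gvtx a == v) tder kap f1 a =
  N_int f v + cexp (- (3%:R * kap / 2%:R)) * N_ext f v.
Proof.
move=> H; rewrite big_sumType /=; congr (_ + _).
- by apply: eq_bigr => a _; rewrite (end_derivE kap _ H).
- by rewrite /N_ext mulr_sumr; apply: eq_bigr => l _; rewrite (lead_derivE _ H).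
Qed.

Lemma N_ext0 f v : v \notin ext G -> N_ext f v = 0.
Proof.
move=> vn; rewrite /N_ext big_pred0// => l; apply/negP => /eqP E.
by move: vn; rewrite -E root_ext.
Qed.

(** Internal vertices carry no lead and external ones at least one, so the two groups of conditions
    merge into one. An end at which to read the common value comes from [attached] or [ext_root]. *)
Lemma vcond_Hs kap f (f1 : gfun G) : gW2 f f1 ->
  vcond kap f f1 <->
  (forall v, v \notin ext G -> (exists z, D_int f v z) /\ N f v = 0) /\
  (forall v, v \in ext G ->
        (exists z z1, [/\ D_int f v z, D_ext f v z1 &
                         z - cexp (- (kap / 2%:R)) * z1 = 0]) /\
        N_int f v + cexp (- (3%:R * kap / 2%:R)) * N_ext f v = 0).
Proof.
move=> H; split => [[V K]|[I E]].
- split => v vx.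
  + split; last by have := K v; rewrite (kirchhoffE kap v H) /N N_ext0// mulr0 addr0.
    have [[e et]|[l lv]] := attached v; last by move: vx; rewrite -lv root_ext.
    have [a av] : exists a : iend G, end_vtx a = v.
      by case: et => et; [exists (e, false)|exists (e, true)].
    by exists (end_val f a) => b bv; apply: (V (inl b) (inl a)); rewrite /= av bv.
  + split; last by have := K v; rewrite (kirchhoffE kap v H).
    have [l lv] := ext_root vx.
    exists (cexp (- (kap / 2%:R)) * f (inr l) 0), (f (inr l) 0); split; last by rewrite subrr.
    * by move=> a av; apply: (V (inl a) (inr l)); rewrite /= av lv.
    * move=> l' lv'; apply: (mulfI (cexp_neq0 (- (kap / 2%:R)))).
      by apply: (V (inr l') (inr l)); rewrite /= lv' lv.
- split.
  + have T v : exists z, forall a, gvtx a = v -> tval kap f a = z.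
      have [vx|vx] := boolP (v \in ext G).
        have [[z [z1 [Di De E1]]] _] := E v vx; exists z => -[a|l] /= av; first exact: Di.
        by rewrite (De l av); apply/eqP; rewrite eq_sym -subr_eq0 E1.
      have [[z Di] _] := I v vx; exists z => -[a|l] /= av; first exact: Di.
      by move: vx; rewrite -av root_ext.
    by move=> a b ab; have [z Z] := T (gvtx b); rewrite !Z.
  + move=> v; rewrite (kirchhoffE kap v H); have [vx|vx] := boolP (v \in ext G).
      by have [_] := E v vx.
    by have [_] := I v vx; rewrite /N N_ext0// addr0 mulr0 addr0.
Qed.

Lemma AC_ae D (f g g' : R -> C) : hdom D -> AC D f g -> L2 D g' ->
  {ae mu, forall x, D x -> g x = g' x} -> AC D f g'.
Proof.
move=> hD [A B] g2 ae; have gl := L2_loc hD g2; split.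
- apply: (acR_ae hD A) => [x Dx|]; first by have [] := L2loc_rint hD gl Dx.
  by apply: ae_imp ae => x E Dx; rewrite /re E.
- apply: (acR_ae hD B) => [x Dx|]; first by have [] := L2loc_rint hD gl Dx.
  by apply: ae_imp ae => x E Dx; rewrite /im E.
Qed.

(** On the leads [op_Hs] determines [h] only almost everywhere. With [h] in L^2, the second
    derivative can be exchanged for the representative given by [h]. *)
Lemma op_HsP kap f h : gL2 h ->
  op_Hs kap f h <-> exists f1, esol kap f f1 h /\ vcond kap f f1.
Proof.
move=> h2; split.
- case=> Hi Hl cf Vi Ve.
  have [f1 E] : exists f1 : gfun G, esol kap f f1 h.
    have : forall e, exists k : R -> C, W2 (edom e) (f e) k (fun x => - (cfac kap e * h e x)) /\
      L2 (edom e) (f e) /\ L2 (edom e) k.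
      case=> [i|l].
        have [k [W [a b c]]] := W22_AC (hdom_edom (inl i)) (cf (inl i)) (Hi i).
        exists k; split => //; case: W => A B; split => //.
        by apply: AC_eq B => // [|x _]; [exact: hdom_edom (inl i)|rewrite /gopp mul1r].
      have [q [Wq ae]] := Hl l.
      have [k [[A B] [a b c]]] := W22_AC (hdom_edom (inr l)) (cf (inr l)) Wq.
      exists k; split => //; split => //.
      apply: (AC_ae (hdom_edom (inr l)) B).
        by apply: L2N; [exact: mset_edom (inr l)|apply: L2Z; [exact: mset_edom (inr l)|exact: h2]].
      apply: ae_imp ae => x E Dx; rewrite (E Dx) /= mulNr mulrN opprK mulrA -mulrA.
      by rewrite mulrA cexpN mul1r.
    by move=> /choice[k H]; exists k.
  by exists f1; split => //; apply/(vcond_Hs kap (esol_gW2 E)).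
- move=> [f1 [E V]].
  have /(vcond_Hs kap (esol_gW2 E))[Vi Ve] := V.
  have W e : ccontinuous_on (edom e) (f e) /\ W22_deriv2 (edom e) (f e) (fun x => - (cfac kap e * h e x)).
    have [We [a b]] := E e; apply: AC_W22 We a b _; first exact: hdom_edom.
    by apply: L2N; [exact: mset_edom|apply: L2Z => //; exact: mset_edom].
  split => //.
  + move=> i; have [_] := W (inl i); rewrite (_ : (fun x => _) = gopp h (inl i)) //.
    by apply/funext => x; rewrite mul1r.
  + move=> l; exists (fun x => - (cfac kap (inr l) * h (inr l) x)); split; first by have [] := W (inr l).
    by apply: aeW => x _; rewrite mulNr mulrN opprK mulrA [X in X * _]mulrC cexpN mul1r.
  + by move=> e; have [] := W e.
Qed.

Lemma cfac0 e : cfac 0 e = 1.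
Proof. by case: e => // l; rewrite /= mulr0 cexp0. Qed.

Lemma vcond0P f (f1 : gfun G) : gW2 f f1 ->
  vcond 0 f f1 <-> (forall v, exists z, D_int f v z /\ D_ext f v z) /\ (forall v, N f v = 0).
Proof.
have E1 : cexp (- (3%:R * 0 / 2%:R)) = 1 :> C by rewrite mulr0 mul0r oppr0 cexp0.
have E2 : cexp (- (0 / 2%:R)) = 1 :> C by rewrite mul0r oppr0 cexp0.
move=> W; rewrite (vcond_Hs 0 W) E1 E2; split.
- move=> [Vi Ve]; split=> v; have [vx|vx] := boolP (v \in ext G).
  + have [[z [z1 [Di De zz]]] _] := Ve v vx; exists z; split => //.
    by move/eqP: zz; rewrite mul1r subr_eq0 => /eqP ->.
  + have [[z Di] _] := Vi v vx; exists z; split => // l lv.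
    by move: vx; rewrite -lv root_ext.
  + by have [_] := Ve v vx; rewrite mul1r.
  + by have [] := Vi v vx.
- move=> [Vc Nf]; split=> v _; have [z [Di De]] := Vc v; split; rewrite ?mul1r; try exact: Nf.
  + by exists z.
  + by exists z, z; rewrite mul1r subrr.
Qed.

(** [H] is the case [kap = 0]; here the domain condition itself puts [h] into L^2. *)
Lemma op_HP f h : op_H f h <-> gL2 h /\ exists f1, esol 0 f f1 h /\ vcond 0 f f1.
Proof.
split.
- case=> Hw [cf Vc] Nf.
  have /choice[f1 W] : forall e, exists k, W2 (edom e) (f e) k (gopp h e) /\
      [/\ L2 (edom e) (f e), L2 (edom e) k & L2 (edom e) (gopp h e)].
    by move=> e; exact: W22_AC (hdom_edom e) (cf e) (Hw e).
  have E : esol 0 f f1 h.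
    move=> e; have [[A B] [l l1 _]] := W e; split => //; split => //.
    by apply: AC_eq B => // [|x _]; [exact: hdom_edom|rewrite cfac0 mul1r].
  split.
    move=> e; have [_ [_ _ h2]] := W e.
    by apply: L2_eq (L2N (mset_edom e) h2) => [|x _]; [exact: mset_edom|rewrite /gopp opprK].
  by exists f1; split => //; apply/(vcond0P (esol_gW2 E)).
- move=> [h2 [f1 [E V]]].
  have /(vcond0P (esol_gW2 E))[Vc Nf] := V.
  have W e : ccontinuous_on (edom e) (f e) /\ W22_deriv2 (edom e) (f e) (fun x => - (cfac 0 e * h e x)).
    have [We [a b]] := E e; apply: AC_W22 We a b _; first exact: hdom_edom.
    by apply: L2N; [exact: mset_edom|apply: L2Z => //; exact: mset_edom].
  split => //; last by split => // e; have [] := W e.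
  move=> e; have [_] := W e; rewrite (_ : (fun x => _) = gopp h e) //.
  by apply/funext => x; rewrite cfac0 mul1r.
Qed.

End GraphOps.

(** * Inner product and norm on the graph *)

Section InnerProduct.
Variables (R : realType) (G : qgraph R).
Local Notation mu := (@lebesgue_measure R).
Local Notation C := R[i].
Local Notation msE := (mset_edom (G:=G)).
Implicit Types (f g h u v : gfun G) (c z : C).

Definition gaxpy u c v : gfun G := fun e x => u e x + c * v e x.

Lemma gL2_axpy u c v : gL2 u -> gL2 v -> gL2 (gaxpy u c v).
Proof. by move=> Hu Hv e; apply: L2D; [exact: msE|exact: Hu|apply: L2Z; [exact: msE|exact: Hv]]. Qed.

Lemma gL2_0 : gL2 ((fun _ _ => 0) : gfun G).
Proof. by move=> e; apply: L2_0; exact: msE. Qed.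

Lemma gL2_scale c u : gL2 u -> gL2 (gscale c u).
Proof. by move=> Hu e; apply: L2Z; [exact: msE|exact: Hu]. Qed.

Lemma gaxpyN u v : gaxpy u (-1) v = gsub u v.
Proof. by apply/funext => e; apply/funext => x; rewrite /gaxpy /gsub mulN1r. Qed.

Lemma gaxpy0 c v : gaxpy (fun _ _ => 0) c v = gscale c v.
Proof. by apply/funext => e; apply/funext => x; rewrite /gaxpy /gscale add0r. Qed.

Lemma gL2_sub u v : gL2 u -> gL2 v -> gL2 (gsub u v).
Proof. by move=> Hu Hv; rewrite -gaxpyN; exact: gL2_axpy. Qed.

Lemma glin_recr n (c : 'I_n.+1 -> C) (b : 'I_n.+1 -> gfun G) :
  glin c b = gaxpy (glin (fun i => c (widen_ord (leqnSn n) i)) (fun i => b (widen_ord (leqnSn n) i)))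
    (c ord_max) (b ord_max).
Proof. by apply/funext => e; apply/funext => x; rewrite /glin big_ord_recr. Qed.

Lemma glin0 (c : 'I_0 -> C) (b : 'I_0 -> gfun G) : glin c b = (fun _ _ => 0).
Proof. by apply/funext => e; apply/funext => x; rewrite /glin big_ord0. Qed.

Lemma gL2_lin n (c : 'I_n -> C) (b : 'I_n -> gfun G) : (forall i, gL2 (b i)) -> gL2 (glin c b).
Proof.
elim: n c b => [|n IH] c b Hb; first by rewrite glin0; exact: gL2_0.
by rewrite glin_recr; apply: gL2_axpy => //; exact: IH.
Qed.

Lemma inner_int f g e : gL2 f -> gL2 g -> cinteg (edom e) (fun x => f e x * conjc (g e x)).
Proof.
move=> Hf Hg; apply: L2_mul; [exact: msE|exact: Hf|apply: L2J; [exact: msE|exact: Hg]].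
Qed.

Lemma inner_axpy u c v g : gL2 u -> gL2 v -> gL2 g ->
  inner (gaxpy u c v) g = inner u g + c * inner v g.
Proof.
move=> Hu Hv Hg; rewrite /inner mulr_sumr -big_split /=; apply: eq_bigr => e _.
have I1 := inner_int e Hu Hg; have I2 := inner_int e Hv Hg.
rewrite -(cintZ c (msE e) I2) -(cintD (msE e) I1 (cintegZ c (msE e) I2)).
by apply: cint_eq => x _; rewrite /gaxpy mulrDl mulrA.
Qed.

Lemma inner0 g : inner (fun _ _ => 0) g = 0.
Proof.
rewrite /inner big1// => e _; rewrite (@cint_eq _ _ _ (fun=> 0)) => [|x _]; last by rewrite mul0r.
by rewrite /cint /re /im /= !Rintegral_cst ?mul0r //; exact: msE.
Qed.

Lemma inner_scale c v g : gL2 v -> gL2 g -> inner (gscale c v) g = c * inner v g.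
Proof. by move=> Hv Hg; rewrite -gaxpy0 inner_axpy ?inner0 ?add0r//; exact: gL2_0. Qed.

Lemma inner_sub u v g : gL2 u -> gL2 v -> gL2 g -> inner (gsub u v) g = inner u g - inner v g.
Proof. by move=> Hu Hv Hg; rewrite -gaxpyN inner_axpy// mulN1r. Qed.

Lemma inner_lin n (c : 'I_n -> C) (b : 'I_n -> gfun G) g : (forall i, gL2 (b i)) -> gL2 g ->
  inner (glin c b) g = \sum_i c i * inner (b i) g.
Proof.
move=> Hb Hg; elim: n c b Hb => [|n IH] c b Hb; first by rewrite glin0 inner0 big_ord0.
rewrite glin_recr inner_axpy// ?big_ord_recr /= ?IH //.
by apply: gL2_lin.
Qed.

Lemma innerC f g : gL2 f -> gL2 g -> inner g f = conjc (inner f g).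
Proof.
move=> Hf Hg; rewrite /inner rmorph_sum; apply: eq_bigr => e _.
apply: etrans (cintJ (msE e) (inner_int e Hf Hg)); apply: cint_eq => x _.
by rewrite rmorphM /= conjcK mulrC.
Qed.

Lemma normsqE f : normsq f = \sum_e \int[mu]_(x in edom e) csq (f e x) /\ inner f f = (normsq f)%:C.
Proof.
have E e : cint (edom e) (fun x => f e x * conjc (f e x)) = (\int[mu]_(x in edom e) csq (f e x))%:C.
  have H x : f e x * conjc (f e x) = (csq (f e x))%:C.
    by case: (f e x) => a b; rewrite /csq /=; apply: complex_ext => /=; ring.
  rewrite (cint_eq (fun x _ => H x)) /cint /re /im /=; congr (_ +i* _).
  by rewrite Rintegral_cst ?mul0r //; exact: msE.
have E2 : inner f f = (\sum_e \int[mu]_(x in edom e) csq (f e x))%:C.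
  by rewrite /inner rmorph_sum; apply: eq_bigr => e _; rewrite E.
by rewrite /normsq E2.
Qed.

Lemma normsq_ge0 f : 0 <= normsq f.
Proof. by rewrite (normsqE f).1; apply: sumr_ge0 => e _; exact: csq_int_ge0. Qed.

Lemma normsq_eq0 f : gL2 f -> normsq f = 0 -> Defs.ae_eq f (fun _ _ => 0).
Proof.
move=> Hf; rewrite (normsqE f).1 => /eqP; rewrite psumr_eq0; last by move=> e _; exact: csq_int_ge0.
move=> /allP H e; have /implyP/(_ isT)/eqP E := H e (mem_index_enum e).
have fi := L2_csq (Hf e).
have E' : (\int[mu]_(x in edom e) `|(csq (f e x))%:E|)%E = 0%E.
  transitivity (\int[mu]_(x in edom e) (csq (f e x))%:E)%E.
    by apply: eq_integral => x _; rewrite gee0_abs ?lee_fin ?csq_ge0.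
  by rewrite -(fineK (integrable_fin_num (msE e) fi)); congr EFin.
have m : measurable_fun (edom e : set (measurableTypeR R)) (fun x => (csq (f e x))%:E).
  by have /integrableP[] := fi.
have := (ae_eq_integral_abs _ (msE e) m).1 E'.
by apply: ae_imp => x K Dx; have [/csq_eq0] := K Dx.
Qed.

Lemma inner_ae f f' g : gL2 f -> gL2 f' -> gL2 g -> Defs.ae_eq f f' -> inner f g = inner f' g.
Proof.
move=> Hf Hf' Hg ff; apply: eq_bigr => e _.
have [r1 i1] := inner_int e Hf Hg; have [r2 i2] := inner_int e Hf' Hg.
rewrite /cint; congr (_ +i* _); congr fine; apply: ae_eq_integral; try exact: msE;
  try (by apply/measurable_EFinP; exact: rint_measurable).
- by apply: ae_imp (ff e) => x E Dx; rewrite /re E.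
- by apply: ae_imp (ff e) => x E Dx; rewrite /im E.
Qed.

Lemma inner_eq0 f g : gL2 f -> gL2 g -> Defs.ae_eq f (fun _ _ => 0) -> inner f g = 0.
Proof. by move=> Hf Hg H; rewrite (inner_ae Hf gL2_0 Hg H) inner0. Qed.

Lemma normsq_ae0 f : gL2 f -> Defs.ae_eq f (fun _ _ => 0) -> normsq f = 0.
Proof. by move=> Hf H; rewrite /normsq inner_eq0. Qed.

Lemma normsq0 : normsq ((fun _ _ => 0) : gfun G) = 0.
Proof. by rewrite /normsq inner0. Qed.

Lemma normsq_axpy u c v : gL2 u -> gL2 v ->
  normsq (gaxpy u c v) = normsq u + 2 * complex.Re (c * inner v u) + csq c * normsq v.
Proof.
move=> Hu Hv; have H := gL2_axpy c Hu Hv.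
rewrite {1}/normsq inner_axpy// (innerC H Hu) (innerC H Hv) !inner_axpy//.
rewrite (normsqE u).2 (normsqE v).2 (innerC Hv Hu).
case: c (inner v u) H => [a b] [r s] _; rewrite /csq /=; ring.
Qed.

Lemma normsq_scale c v : gL2 v -> normsq (gscale c v) = csq c * normsq v.
Proof.
move=> Hv; rewrite /normsq inner_scale//; last exact: gL2_scale.
rewrite (innerC (gL2_scale c Hv) Hv) inner_scale// (normsqE v).2.
by case: c => a b; rewrite /csq /=; ring.
Qed.

Lemma normsqD_le u c v : gL2 u -> gL2 v ->
  normsq (gaxpy u c v) <= 2 * normsq u + 2 * (csq c * normsq v).
Proof.
move=> Hu Hv; have := normsq_ge0 (gaxpy u (- c) v).
rewrite !normsq_axpy// csqN mulNr.
have -> : complex.Re (- (c * inner v u)) = - complex.Re (c * inner v u) by case: (c * inner v u).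
by move=> H; lra.
Qed.

Lemma cauchy_schwarz f g : gL2 f -> gL2 g -> csq (inner f g) <= normsq f * normsq g.
Proof.
move=> Hf Hg; have [g0|gn0] := eqVneq (normsq g) 0.
  rewrite (innerC Hg Hf) csq_conj (inner_eq0 Hg Hf (normsq_eq0 Hg g0)) csq0.
  by rewrite g0 mulr0.
have gp : 0 < normsq g by rewrite lt_def gn0 normsq_ge0.
(* The coefficient that minimises the norm of [gaxpy f t g]. *)
pose t : C := - ((normsq g)^-1)%:C * inner f g.
have := normsq_ge0 (gaxpy f t g); rewrite normsq_axpy// (innerC Hf Hg) /t.
have -> : complex.Re (- ((normsq g)^-1)%:C * inner f g * conjc (inner f g)) = - (normsq g)^-1 * csq (inner f g).
  by case: (inner f g) => a b; rewrite /csq /=; ring.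
have -> : csq (- ((normsq g)^-1)%:C * inner f g) = (normsq g)^-1 ^+ 2 * csq (inner f g).
  by rewrite csqM csqN /csq /= expr0n addr0.
move=> H; rewrite -(ler_pM2l (_ : 0 < (normsq g)^-1)) ?invr_gt0// mulrCA mulVf// mulr1.
move: H; rewrite (_ : _ + _ + _ = normsq f - (normsq g)^-1 * csq (inner f g)) ?subr_ge0 //.
by field.
Qed.

(** Iterates [normsqD_le]; the exponential constant is harmless because the sums have a fixed number
    of terms. *)
Lemma normsq_sum_le (T : Type) (r : seq T) (c : T -> C) (b : T -> gfun G) : (forall i, gL2 (b i)) ->
  let w := fun e x => \sum_(i <- r) c i * b i e x in
  gL2 w /\ normsq w <= 2 ^+ size r * \sum_(i <- r) csq (c i) * normsq (b i).
Proof.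
move=> Hb; elim: r => [|t r [IL IH]] /=.
  have -> : (fun e x => \sum_(i <- [::]) c i * b i e x) = (fun _ _ => 0) :> gfun G.
    by apply/funext => e; apply/funext => x; rewrite big_nil.
  by rewrite big_nil mulr0 normsq0; split; [exact: gL2_0|].
set w := (fun e x => _) in IL IH.
have -> : (fun e x => \sum_(i <- t :: r) c i * b i e x) = gaxpy w (c t) (b t) :> gfun G.
  by apply/funext => e; apply/funext => x; rewrite big_cons addrC.
split; first exact: gL2_axpy.
rewrite big_cons exprS; apply: le_trans (normsqD_le (c t) IL (Hb t)) _.
rewrite -(mulrDr 2) -mulrA ler_pM2l// addrC (mulrDr (2 ^+ _)); apply: lerD => //.
by rewrite ler_peMl ?mulr_ge0 ?csq_ge0 ?normsq_ge0// exprn_ege1// ler1n.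
Qed.

Lemma csq_sum_le (T : Type) (r : seq T) (P : pred T) (F : T -> C) :
  csq (\sum_(i <- r | P i) F i) <= 2 ^+ size r * \sum_(i <- r) csq (F i).
Proof.
elim: r => [|t r IH] /=; first by rewrite !big_nil csq0 mulr0.
rewrite !big_cons exprS -mulrA.
have h0 : 0 <= \sum_(i <- r) csq (F i) by apply: sumr_ge0 => i _; exact: csq_ge0.
have h1 : 1 <= (2 : R) ^+ size r by rewrite exprn_ege1// ler1n.
have h2 := csq_ge0 (F t).
have h3 : csq (F t) <= 2 ^+ size r * csq (F t) by rewrite ler_peMl.
rewrite (mulrDr (2 ^+ _)); case: ifP => _.
  by apply: le_trans (csqD_le _ _) _; rewrite -(mulrDr 2) ler_pM2l// lerD.
apply: (le_trans IH); rewrite mulrDr -[leLHS]add0r; apply: lerD; first by rewrite !mulr_ge0// exprn_ge0.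
by rewrite ler_peMl ?ler1n// mulr_ge0// exprn_ge0.
Qed.

Lemma ae_eq_sub0 u v : Defs.ae_eq (gsub u v) (fun _ _ => 0) -> Defs.ae_eq u v.
Proof.
move=> H e; apply: ae_imp (H e) => x E Dx; apply/eqP; rewrite -subr_eq0; apply/eqP.
exact: E Dx.
Qed.

End InnerProduct.

(** * Square systems and null spaces over finite index types *)

Section LinearAlgebra.
Variable K : fieldType.

Let mx (S T : finType) (m : S -> T -> K) : 'M[K]_(#|T|, #|S|) :=
  \matrix_(j, i) m (enum_val i) (enum_val j).
Let rv (T : finType) (a : T -> K) : 'rV[K]_#|T| := \row_j a (enum_val j).

Let mulE (S T : finType) (m : S -> T -> K) (v : 'rV[K]_#|T|) i :
  (v *m mx m) 0 i = \sum_t m (enum_val i) t * v 0 (enum_rank t).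
Proof.
rewrite mxE (reindex enum_rank) /=; last by apply: onW_bij; exact: enum_rank_bij.
by apply: eq_bigr => t _; rewrite mxE enum_rankK mulrC.
Qed.

(** One inverse [n] serves all right-hand sides, so bounds on solutions are uniform in the data. *)
Lemma square_solve (T : finType) (m : T -> T -> K) :
  (forall a : T -> K, (forall s, \sum_t m s t * a t = 0) -> forall t, a t = 0) ->
  exists n : T -> T -> K, forall b s, \sum_t m s t * (\sum_r n t r * b r) = b s.
Proof.
move=> inj; have fr : row_free (mx m).
  apply: inj_row_free => v v0; apply/rowP => j; rewrite mxE.
  have := inj (fun t => v 0 (enum_rank t)) _ (enum_val j); rewrite enum_valK; apply=> s.
  by have := mulE m v (enum_rank s); rewrite v0 mxE enum_rankK => <-.
have u : mx m \in unitmx by rewrite -row_free_unit.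
exists (fun t r => invmx (mx m) (enum_rank r) (enum_rank t)) => b s.
have E t : (rv b *m invmx (mx m)) 0 (enum_rank t) = \sum_r invmx (mx m) (enum_rank r) (enum_rank t) * b r.
  rewrite mxE (reindex enum_rank) /=; last by apply: onW_bij; exact: enum_rank_bij.
  by apply: eq_bigr => r _; rewrite mxE enum_rankK mulrC.
under eq_bigr do rewrite -E.
by have := mulE m (rv b *m invmx (mx m)) (enum_rank s); rewrite mulmxKV// mxE !enum_rankK => <-.
Qed.

(** Applied to the vertex conditions on edgewise exponentials, it yields a basis of [E]. *)
Lemma null_basis (S T : finType) (m : S -> T -> K) : exists (d : nat) (B : 'I_d -> T -> K),
  [/\ forall i s, \sum_t m s t * B i t = 0,
      forall c : 'I_d -> K, (forall t, \sum_i c i * B i t = 0) -> forall i, c i = 0 &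
      forall a : T -> K, (forall s, \sum_t m s t * a t = 0) ->
        exists c : 'I_d -> K, forall t, a t = \sum_i c i * B i t].
Proof.
pose N := kermx (mx m).
have [W [WN Wfree]] : exists W : 'M[K]_(\rank N, #|T|), (W :=: N)%MS /\ row_free W.
  by exists (row_base N); split; [exact: eq_row_base|exact: row_base_free].
exists (\rank N), (fun i t => W i (enum_rank t)).
have WE (c : 'I_(\rank N) -> K) t : \sum_i c i * W i (enum_rank t) = ((\row_i c i) *m W) 0 (enum_rank t).
  by rewrite mxE; apply: eq_bigr => i _; congr (_ * _); rewrite mxE.
split.
- move=> i s.
  have W0 : W *m mx m = 0 by apply/eqP; rewrite -sub_kermx WN.
  have := mulE m (row i W) (enum_rank s); rewrite -row_mul W0 !mxE enum_rankK => E.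
  by rewrite [RHS]E; apply: eq_bigr => t _; rewrite mxE.
- move=> c c0 i.
  have E : (\row_i c i) *m W = 0.
    by apply/rowP => j; rewrite -(enum_valK j) -WE c0 mxE.
  have /rowP/(_ i) : \row_i c i = 0 :> 'rV_(\rank N).
    by apply: (row_free_inj Wfree); rewrite E mul0mx.
  by rewrite !mxE.
- move=> a a0.
  have : (rv a <= W)%MS.
    rewrite WN sub_kermx; apply/eqP/rowP => i; rewrite mulE mxE -[RHS](a0 (enum_val i)).
    by apply: eq_bigr => t _; rewrite mxE enum_rankK.
  move=> /submxP[D aE]; exists (fun i => D 0 i) => t; rewrite WE.
  rewrite (_ : \row_i D 0 i = D); first by rewrite -aE mxE enum_rankK.
  by apply/rowP => i; rewrite mxE.
Qed.

End LinearAlgebra.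

(** * Isolated semisimple eigenvalues *)

Section CircleIntegrals.
Variable R : realType.
Local Notation mu := (@lebesgue_measure R).
Local Notation C := R[i].
Local Notation I2 := (`[0, 2%:R * (pi : R)]%classic : set R).
Implicit Types (F : R -> C) (a : nat -> C).

Lemma csqX (z : C) n : csq (z ^+ n) = csq z ^+ n.
Proof. by elim: n => [|n IH]; [rewrite !expr0 csq1|rewrite exprS csqM IH -exprS]. Qed.

Lemma csq_real (r : R) : csq r%:C = r ^+ 2.
Proof. by rewrite /csq /= expr0n addr0. Qed.

Lemma pi2_gt0 : 0 < 2%:R * (pi : R).
Proof. by rewrite mulr_gt0// pi_gt0. Qed.

Lemma csq_circ (t : R) : csq (cexp (0 +i* t)) = 1.
Proof. by rewrite csq_cexp /= mulr0 expR0. Qed.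

Lemma circ_exp (m : nat) (t : R) : cexp (0 +i* t) ^+ m = cexp ((0 +i* m%:R) * t%:C).
Proof.
elim: m => [|m IH]; first by rewrite expr0 (_ : 0 +i* 0 = 0) ?mul0r ?cexp0.
rewrite exprS IH -cexpD; congr cexp; apply/eqP; rewrite eq_complex /= !mulr0 !mul0r !subr0 !addr0 eqxx /=.
by rewrite !add0r -add1n natrD mulrDl mul1r.
Qed.

Lemma circ_int (m : nat) : cinteg I2 (fun t => cexp (0 +i* t) ^+ m.+1) /\
  cint I2 (fun t => cexp (0 +i* t) ^+ m.+1) = 0.
Proof.
have hD := hdom_cc pi2_gt0.
pose z : C := 0 +i* m.+1%:R.
have z0 : z != 0 by rewrite eq_complex /= negb_and pnatr_eq0 orbT.
have E : (fun t => cexp (0 +i* t) ^+ m.+1) = (fun t : R => cexp (z * t%:C)) :> (R -> C).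
  by apply/funext => t; rewrite circ_exp.
rewrite E; have ci : cinteg I2 (fun t : R => cexp (z * t%:C)) by apply: L2_cinteg; exact: cexp_L2.
split => //; apply: (mulfI z0); rewrite mulr0 -cintZ//.
have e2pi : cexp (z * (2%:R * pi)%:C) = 1.
  by rewrite -circ_exp (_ : cexp _ = 1) ?expr1n// /cexp /= expR0 mulr_natl cos2pi sin2pi !mulr0 mul1r.
have D2 : I2 (2%:R * pi) by rewrite /= in_itv /= lexx ltW ?pi2_gt0.
(* The integrand times [z] is the derivative of [cexp (z * t)], which equals 1 at both ends. *)
have [A B] := AC_cexp z hD.
have [_ E1] := A _ D2; have [_ E2] := B _ D2.
move: E1 E2; rewrite /re /im e2pi mulr0 cexp0 /= => E1 E2.
rewrite /cint; apply: complex_ext => /=.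
- by apply: (addrI 1); rewrite addr0; exact: esym E1.
- by apply: (addrI 0); rewrite addr0; exact: esym E2.
Qed.

Lemma cint_circ_cst (c : C) : cinteg I2 (fun=> c) /\ cint I2 (fun=> c) = (2%:R * pi)%:C * c.
Proof.
have E (k : R) : \int[mu]_(t in I2) k = k * (2%:R * pi).
  have := Rint_cst_oc k (ltW pi2_gt0); rewrite subr0 => <-.
  rewrite -(@Rintegral_itv_obnd_cbnd R 0 (BRight (2%:R * pi))) //.
  by apply: rintS (rint_cst 0 (2%:R * pi) k) => // x /=; rewrite !in_itv /= => /andP[/ltW -> ->].
split; first by split; exact: rint_cst.
rewrite /cint /re /im !E; case: c => x y; apply/eqP; rewrite eq_complex /=.
by apply/andP; split; apply/eqP; ring.
Qed.

(** A partial sum of a power series in [z - lam] on the circle, times the factor [i r exp (i t)] of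
    [dz]. Every term contains a positive power of [exp (i t)]. *)
Definition circ_poly a (r : R) (N : nat) (t : R) : C :=
  \sum_(n < N) (r%:C * cexp (0 +i* t)) ^+ n * a n * ((0 +i* 1) * r%:C * cexp (0 +i* t)).

Lemma circ_poly_int a r N : cinteg I2 (circ_poly a r N) /\ cint I2 (circ_poly a r N) = 0.
Proof.
elim: N => [|N [ci c0]].
  have -> : circ_poly a r 0 = (fun=> 0) by apply/funext => t; rewrite /circ_poly big_ord0.
  by have [H ->] := cint_circ_cst 0; rewrite mulr0.
pose k : C := r%:C ^+ N * a N * ((0 +i* 1) * r%:C).
have -> : circ_poly a r N.+1 = (fun t => circ_poly a r N t + k * cexp (0 +i* t) ^+ N.+1).
  by apply/funext => t; rewrite /circ_poly big_ord_recr /= exprMn exprS /k; congr (_ + _); ring.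
have [ei e0] := circ_int N.
have ki : cinteg I2 (fun t => k * cexp (0 +i* t) ^+ N.+1) by apply: cintegZ.
by split; [exact: cintegD|rewrite cintD// cintZ// e0 c0 mulr0 addr0].
Qed.

Lemma geometric_sq (K q : R) (x : nat -> R) : 0 <= q -> q < 1 ->
  (forall n, x n ^+ 2 <= K * q ^+ n) -> x n @[n --> \oo] --> (0 : R).
Proof.
move=> q0 q1 H; apply/cvgr0Pnorm_le => e e0.
have cv : K * q ^+ n @[n --> \oo] --> K * 0.
  by apply: cvgM; [exact: cvg_cst|apply: cvg_expr; rewrite ger0_norm].
rewrite mulr0 in cv; move/cvgr0Pnorm_le : cv => /(_ (e ^+ 2) (exprn_gt0 2 e0)).
apply: filterS => n Hn; have e1 := ltW e0.
rewrite -(ler_pXn2r (n := 2))// ?nnegrE ?normr_ge0//.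
rewrite real_normK ?num_real//; apply: le_trans (H n) _; apply: le_trans Hn; exact: ler_norm.
Qed.

(** Nothing is assumed on the dependence of [F] on [t]: measurability passes to the limit from the
    polynomials, and the integral by dominated convergence. *)
Lemma circ_limit a r F (K q : R) : 0 <= q -> q < 1 ->
  (forall N t, I2 t -> csq (F t - circ_poly a r N t) <= K * q ^+ N) ->
  cinteg I2 F /\ cint I2 F = 0.
Proof.
move=> q0 q1 H.
have K0 : 0 <= K.
  have D2 : I2 0 by rewrite /= in_itv /= lexx ltW ?pi2_gt0.
  by have h := H 0%N 0 D2; rewrite expr0 mulr1 in h; exact: le_trans (csq_ge0 _) h.
(* As [circ_poly a r 0] is zero, the case [N = 0] bounds [csq (F t)] by [K]; the difference at [N]
   obeys the same bound, and [csqD_le] doubles both. *)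
have bd N t : I2 t -> csq (circ_poly a r N t) <= 4 * K.
  move=> It.
  have -> : circ_poly a r N t = (F t - circ_poly a r 0 t) + - (F t - circ_poly a r N t).
    by rewrite [circ_poly a r 0 t]big_ord0; ring.
  apply: le_trans (csqD_le _ _) _; rewrite csqN.
  have h0 := H 0%N t It; rewrite expr0 mulr1 in h0.
  have h1 : K * q ^+ N <= K by rewrite ler_piMr// exprn_ile1// ltW.
  by have h2 := H N t It; lra.
have comp (p : C -> R) : (forall z, p z ^+ 2 <= csq z) -> {morph p : x y / x - y} ->
    (forall N, rint I2 (fun t => p (circ_poly a r N t)) /\ \int[mu]_(t in I2) p (circ_poly a r N t) = 0) ->
    rint I2 (fun t => p (F t)) /\ \int[mu]_(t in I2) p (F t) = 0.
  move=> psq pB pi.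
  (* The dominating constant comes from [|x| <= x ^ 2 + 1] and the bound [4 * K] on the square. *)
  have [] := @Rdominated_cvg R I2 (fun N t => p (circ_poly a r N t)) (fun t => p (F t)) (fun=> 4 * K + 1).
  - exact: measurable_itv.
  - by move=> N; have [/rint_measurable] := pi N.
  - exact: rint_cst.
  - move=> N t It; have := bd N t It; have := psq (circ_poly a r N t).
    move: (p _) (csq _) => x y xy yK.
    rewrite ler_norml; apply/andP; split; have := sqr_ge0 (x - 1); have := sqr_ge0 (x + 1); nra.
  - move=> t It; apply/subr_cvg0; apply: (@geometric_sq K q (fun N => p (circ_poly a r N t) - p (F t))) => // N.
    by rewrite /= -(pB _ _) -opprB; apply: le_trans (psq _) _; rewrite csqN; exact: H.
  move=> Fi cv; split => //.
  have E : (fun N => \int[mu]_(t in I2) p (circ_poly a r N t)) = (fun=> 0) :> (nat -> R).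
    by apply/funext => N; have [] := pi N.
  by rewrite E in cv; apply: (cvg_unique _ cv (cvg_cst 0)); exact: Rhausdorff.
have [rF r0] : rint I2 (re F) /\ \int[mu]_(t in I2) re F t = 0.
  apply: (comp (@complex.Re R)).
  - by case=> x y; rewrite /csq /= lerDl sqr_ge0.
  - by case=> x y [x' y'].
  - by move=> N; have [[ri _] [r0 _]] := circ_poly_int a r N.
have [iF i0] : rint I2 (im F) /\ \int[mu]_(t in I2) im F t = 0.
  apply: (comp (@complex.Im R)).
  - by case=> x y; rewrite /csq /= lerDr sqr_ge0.
  - by case=> x y [x' y'].
  - by move=> N; have [[_ ii] [_ i0]] := circ_poly_int a r N.
by split => //; rewrite /cint r0 i0.
Qed.

End CircleIntegrals.

(** * Reduction by the eigenspace and the Riesz projection *)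

Section IsolatedSemisimple.
Variables (R : realType) (G : qgraph R).
Local Notation mu := (@lebesgue_measure R).
Local Notation C := R[i].
Variables (A : operator G) (lam : C) (d : nat) (phi : 'I_d -> gfun G).
Implicit Types (f g h u v : gfun G) (c z w : C).

Definition orth u := forall j, inner u (phi j) = 0.

Hypothesis A_L2 : forall u h, A u h -> gL2 u.
Hypothesis A0 : A (fun _ _ => 0) (fun _ _ => 0).
Hypothesis A_lin : forall u v h g c, gL2 h -> gL2 g -> A u h -> A v g -> A (gaxpy u c v) (gaxpy h c g).
Hypothesis A_phi : forall j, A (phi j) (gscale lam (phi j)).
(* [phi j] also lies in the kernel of the adjoint of [A - lam], so the span of [phi] reduces [A]. *)
Hypothesis A_sym : forall u h j, gL2 h -> A u h -> inner h (phi j) = lam * inner u (phi j).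
Hypothesis phi_free : forall a : 'I_d -> C, normsq (glin a phi) = 0 -> forall i, a i = 0.
Hypothesis A_ker : forall u, Defs.kernel A lam u -> exists a, Defs.ae_eq u (glin a phi).

(* The bordered problem: the correction [glin a phi] makes it solvable even at [z = lam]. *)
Definition solvable z := exists M : R, 0 <= M /\ forall f, gL2 f -> exists u a,
  [/\ A u (gsub (gaxpy f z u) (glin a phi)), orth u & normsq u <= M * normsq f].

(** A Fredholm alternative near [lam]: injectivity on the orthogonal complement of the [phi j]
    yields bounded solvability. *)
Hypothesis A_solvable : exists eps : R, 0 < eps /\ forall z, csq (z - lam) < eps ->
  (forall u, Defs.kernel A z u -> orth u -> normsq u = 0) -> solvable z.

Lemma phi_L2 j : gL2 (phi j).
Proof. exact: A_L2 (A_phi j). Qed.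
Let Lphi := phi_L2.
Lemma lin_L2 (a : 'I_d -> C) : gL2 (glin a phi).
Proof. exact: gL2_lin. Qed.
Let Llin := lin_L2.

Lemma orth_lin u (a : 'I_d -> C) : gL2 u -> orth u -> inner u (glin a phi) = 0 /\ inner (glin a phi) u = 0.
Proof.
move=> Hu Ou; have E : inner (glin a phi) u = 0.
  rewrite inner_lin// big1// => i _.
  by rewrite (innerC Hu (Lphi i)) Ou conjc0 mulr0.
by split => //; rewrite (innerC (Llin a) Hu) E conjc0.
Qed.

Lemma lin_orth0 (a : 'I_d -> C) : orth (glin a phi) -> forall i, a i = 0.
Proof.
move=> O; apply: phi_free; rewrite /normsq.
by have [-> _] := orth_lin a (Llin a) O.
Qed.

Lemma lin_zero (a : 'I_d -> C) : (forall i, a i = 0) -> glin a phi = (fun _ _ => 0).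
Proof.
move=> a0; apply/funext => e; apply/funext => x; rewrite /glin big1// => i _.
by rewrite a0 mul0r.
Qed.

(** The coefficients solve a square system with the Gram matrix of [phi]: a combination in its null
    space is orthogonal to itself, so [phi_free] gives injectivity. *)
Lemma orth_proj f : gL2 f -> exists a, orth (gsub f (glin a phi)).
Proof.
move=> Hf.
pose m (s t : 'I_d) := inner (phi t) (phi s).
have inj (a : 'I_d -> C) : (forall s, \sum_t m s t * a t = 0) -> forall t, a t = 0.
  move=> a0; apply: lin_orth0 => j; rewrite inner_lin// -[RHS](a0 j).
  by apply: eq_bigr => i _; rewrite mulrC.
have [n nP] := square_solve inj.
exists (fun t => \sum_r n t r * inner f (phi r)) => j.
rewrite inner_sub// inner_lin// -(nP (fun r => inner f (phi r)) j) -sumrB big1// => i _.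
by rewrite mulrC subrr.
Qed.

Lemma orth_pythagoras f (a : 'I_d -> C) : gL2 f -> orth (gsub f (glin a phi)) ->
  normsq f = normsq (glin a phi) + normsq (gsub f (glin a phi)).
Proof.
move=> Hf O; have Hg := gL2_sub Hf (Llin a).
have E : f = gaxpy (glin a phi) 1 (gsub f (glin a phi)).
  by apply/funext => e; apply/funext => x; rewrite /gaxpy /gsub mul1r addrC subrK.
rewrite {1}E normsq_axpy// mul1r.
have [-> _] := orth_lin a Hg O.
by rewrite /csq /= mulr0 addr0 expr1n expr0n addr0 mul1r.
Qed.

Lemma A_lin_phi (a : 'I_d -> C) : A (glin a phi) (gscale lam (glin a phi)).
Proof.
suff H : forall n (b : 'I_n -> gfun G) (a : 'I_n -> C), (forall i, gL2 (b i)) ->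
    (forall i, A (b i) (gscale lam (b i))) -> A (glin a b) (gscale lam (glin a b)).
  by apply: H.
elim=> [|n IH] b {}a Hb Ab.
  rewrite glin0 (_ : gscale lam _ = (fun _ _ => 0)) //.
  by apply/funext => e; apply/funext => x; rewrite /gscale mulr0.
rewrite glin_recr.
set b' := (fun i => b _); set a' := (fun i => a _).
have -> : gscale lam (gaxpy (glin a' b') (a ord_max) (b ord_max)) =
    gaxpy (gscale lam (glin a' b')) (a ord_max) (gscale lam (b ord_max)).
  by apply/funext => e; apply/funext => x; rewrite /gscale /gaxpy; ring.
apply: A_lin => //; [|exact: gL2_scale|by apply: IH => i; [exact: Hb|exact: Ab]].
by apply: gL2_scale; apply: gL2_lin => i; exact: Hb.
Qed.

Lemma orth_axpy u c v : gL2 u -> gL2 v -> orth u -> orth v -> orth (gaxpy u c v).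
Proof. by move=> Hu Hv Ou Ov j; rewrite inner_axpy// Ou Ov mulr0 addr0. Qed.

Lemma A_axpy_z u v f g z c : gL2 f -> gL2 g -> A u (gaxpy f z u) -> A v (gaxpy g z v) ->
  A (gaxpy u c v) (gaxpy (gaxpy f c g) z (gaxpy u c v)).
Proof.
move=> Hf Hg Au Av.
have -> : gaxpy (gaxpy f c g) z (gaxpy u c v) = gaxpy (gaxpy f z u) c (gaxpy g z v).
  by apply/funext => e; apply/funext => x; rewrite /gaxpy; ring.
by apply: A_lin => //; apply: gL2_axpy => //; [exact: A_L2 Au|exact: A_L2 Av].
Qed.

Lemma orth_rhs z u f : gL2 f -> orth u -> A u (gaxpy f z u) -> orth f.
Proof.
move=> Hf Ou Au j; have Hu := A_L2 Au.
have := A_sym j (gL2_axpy z Hf Hu) Au; rewrite inner_axpy// Ou !mulr0 addr0 //.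
Qed.

(** For orthogonal data the correction disappears: pairing the equation with each [phi j] and using
    [A_sym] shows that [glin a phi] is orthogonal to all of them. *)
Lemma solvable_orth z : solvable z -> exists M : R, 0 <= M /\ forall f, gL2 f -> orth f ->
  exists u, [/\ A u (gaxpy f z u), orth u & normsq u <= M * normsq f].
Proof.
move=> [M [M0 H]]; exists M; split => // f Hf Of.
have [u [a [Au Ou uM]]] := H f Hf; exists u; split => //.
have Hu := A_L2 Au.
have Hh := gL2_sub (gL2_axpy z Hf Hu) (Llin a).
have a0 : forall i, a i = 0.
  apply: lin_orth0 => j; have := A_sym j Hh Au.
  rewrite inner_sub ?inner_axpy //; last exact: gL2_axpy.
  by rewrite Of Ou !mulr0 add0r sub0r => /eqP; rewrite oppr_eq0 => /eqP.
move: Au; rewrite (lin_zero a0) (_ : gsub _ _ = gaxpy f z u) //.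
by apply/funext => e; apply/funext => x; rewrite /gsub subr0.
Qed.

Lemma ker_orth_lam u : Defs.kernel A lam u -> orth u -> normsq u = 0.
Proof.
move=> Ku Ou; have Hu := A_L2 Ku; have [a ua] := A_ker Ku.
rewrite /normsq (inner_ae Hu (Llin a) Hu ua).
by have [_ ->] := orth_lin a Hu Ou.
Qed.

Lemma coercive : exists M : R, 0 < M /\
  (forall v g, gL2 g -> orth v -> A v (gaxpy g lam v) -> normsq v <= M * normsq g) /\
  (forall f, gL2 f -> orth f -> exists u, [/\ A u (gaxpy f lam u), orth u & normsq u <= M * normsq f]).
Proof.
have [eps [eps0 S]] := A_solvable.
have /solvable_orth[M [M0 H]] : solvable lam.
  by apply: S; [rewrite subrr csq0|exact: ker_orth_lam].
(* Any solution differs from the constructed one by a function of norm zero, at the price of a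
   factor 2; the added 1 makes the constant positive. *)
have M1 : 0 < 2 * M + 1 by rewrite ltr_wpDl// mulr_ge0.
exists (2 * M + 1); split => //; split.
- move=> v g Hg Ov Av; have Hv := A_L2 Av.
  have [u [Au Ou uM]] := H g Hg (orth_rhs Hg Ov Av).
  have Hu := A_L2 Au.
  have K : Defs.kernel A lam (gaxpy v (-1) u).
    have := A_axpy_z (-1) Hg Hg Av Au; rewrite (_ : gaxpy g (-1) g = (fun _ _ => 0)) ?gaxpy0 //.
    by apply/funext => e; apply/funext => x; rewrite /gaxpy mulN1r subrr.
  have := ker_orth_lam K (orth_axpy (-1) Hv Hu Ov Ou) => E.
  have vE : v = gaxpy (gaxpy v (-1) u) 1 u.
    by apply/funext => e; apply/funext => x; rewrite /gaxpy; ring.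
  have := normsqD_le 1 (A_L2 K) Hu; rewrite -vE E mulr0 add0r.
  by rewrite csq1; have := normsq_ge0 g; nra.
- move=> f Hf Of; have [u [Au Ou uM]] := H f Hf Of; exists u; split => //.
  by have := normsq_ge0 f; nra.
Qed.

Section Near.
Variables (M : R) (M0 : 0 < M).
Hypothesis coer : forall v g, gL2 g -> orth v -> A v (gaxpy g lam v) -> normsq v <= M * normsq g.

(** The term [(z - lam) v] is moved to the data. The bound [8^-1] lets it contribute at most a
    quarter of [normsq v], which is absorbed on the left. *)
Lemma coercive_near z v g : csq (z - lam) * M <= 8^-1 -> gL2 g -> orth v -> A v (gaxpy g z v) ->
  normsq v <= 4 * M * normsq g.
Proof.
move=> zM Hg Ov Av; have Hv := A_L2 Av.
have E : gaxpy g z v = gaxpy (gaxpy g (z - lam) v) lam v.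
  by apply/funext => e; apply/funext => x; rewrite /gaxpy; ring.
rewrite E in Av.
have := coer (gL2_axpy (z - lam) Hg Hv) Ov Av.
have := normsqD_le (z - lam) Hg Hv; have := normsq_ge0 v; have := normsq_ge0 g.
move: (csq_ge0 (z - lam)) zM.
move: (csq (z - lam)) (normsq v) (normsq g) (normsq (gaxpy g (z - lam) v)) => q a b c q0 qM b0 a0 c1 c2.
have h1 : M * c <= M * (2 * b + 2 * (q * a)) by rewrite ler_wpM2l// ltW.
have h2 : q * M * a <= 8^-1 * a by rewrite ler_wpM2r.
by lra.
Qed.

Lemma ker_near z : csq (z - lam) * M <= 8^-1 -> forall u, Defs.kernel A z u -> orth u -> normsq u = 0.
Proof.
move=> zM u Ku Ou; apply/eqP; rewrite eq_le normsq_ge0 andbT.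
have Au : A u (gaxpy (fun _ _ => 0) z u) by rewrite gaxpy0.
have := coercive_near zM (@gL2_0 R G) Ou Au; by rewrite normsq0 mulr0.
Qed.

(** On the span of [phi] the resolvent is explicit, and what remains has orthogonal data. The factor
    -1 translates [(z - A) u = f] into the form [A u = g + z u]; orthogonality of [u1] follows from
    [A_sym] since [z] differs from [lam]. *)
Lemma resolves_split z f u (a : 'I_d -> C) : z != lam -> gL2 f -> orth (gsub f (glin a phi)) ->
  resolves A z f u -> let u1 := gsub u (gscale (z - lam)^-1 (glin a phi)) in
  orth u1 /\ A u1 (gaxpy (gscale (-1) (gsub f (glin a phi))) z u1).
Proof.
move=> zl Hf Of Au u1; have Hu := A_L2 Au.
have zl0 : z - lam != 0 by rewrite subr_eq0.
have Hh := gL2_sub (gL2_scale z Hu) Hf.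
have Au1 : A u1 (gaxpy (gscale (-1) (gsub f (glin a phi))) z u1).
  have := A_lin (- (z - lam)^-1) Hh (gL2_scale lam (Llin a)) Au (A_lin_phi a).
  congr (A _ _); apply/funext => e; apply/funext => x.
    by rewrite /u1 /gaxpy /gsub /gscale mulNr.
  by rewrite /u1 /gaxpy /gsub /gscale; move: (glin a phi e x) => y; field.
split => // j; have Hu1 := A_L2 Au1.
have Hg : gL2 (gscale (-1) (gsub f (glin a phi))) by apply: gL2_scale; exact: gL2_sub.
have := A_sym j (gL2_axpy z Hg Hu1) Au1.
rewrite inner_axpy// inner_scale//; last exact: gL2_sub.
rewrite Of mulr0 add0r => /eqP; rewrite -subr_eq0 -mulrBl mulf_eq0 (negbTE zl0) /=.
by move=> /eqP.
Qed.

Lemma resolvent_near z : z != lam -> csq (z - lam) * M <= 8^-1 -> solvable z -> in_resolvent_set A z.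
Proof.
move=> zl zM Sz; have zl0 : z - lam != 0 by rewrite subr_eq0.
split.
- move=> f Hf; have [a Of] := orth_proj Hf.
  have [K [K0 H]] := solvable_orth Sz.
  have Hf1 := gL2_scale (-1) (gL2_sub Hf (Llin a)).
  have Of1 : orth (gscale (-1) (gsub f (glin a phi))).
    by move=> j; rewrite inner_scale ?Of ?mulr0//; exact: gL2_sub.
  have [u1 [Au1 _ _]] := H _ Hf1 Of1.
  have := A_lin (z - lam)^-1 (gL2_axpy z Hf1 (A_L2 Au1)) (gL2_scale lam (Llin a)) Au1 (A_lin_phi a).
  set u := gaxpy u1 _ _ => Au; exists u; move: Au; congr (A _ _).
  apply/funext => e; apply/funext => x.
  by rewrite /u /gaxpy /gsub /gscale; move: (glin a phi e x) => y; field.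
- move=> u Ku; have Hu := A_L2 Ku.
  apply: normsq_eq0 => //; apply: (ker_near zM) => // j.
  have := A_sym j (gL2_scale z Hu) Ku; rewrite inner_scale// => /eqP.
  by rewrite -subr_eq0 -mulrBl mulf_eq0 (negbTE zl0) /= => /eqP.
- exists (2 * csq (z - lam)^-1 + 2 * (4 * M)) => f u Hf Au.
  have [a Of] := orth_proj Hf; have Hf1 := gL2_sub Hf (Llin a).
  have [Ou1 Au1] := resolves_split zl Hf Of Au.
  set u1 := gsub u _ in Ou1 Au1.
  have Hu1 := A_L2 Au1; have Hu0 := gL2_scale (z - lam)^-1 (Llin a).
  have B1 := coercive_near zM (gL2_scale (-1) Hf1) Ou1 Au1.
  have uE : u = gaxpy (gscale (z - lam)^-1 (glin a phi)) 1 u1.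
    by apply/funext => e; apply/funext => x; rewrite /u1 /gaxpy /gsub mul1r addrC subrK.
  rewrite uE; apply: le_trans (normsqD_le 1 Hu0 Hu1) _.
  rewrite (normsq_scale _ (Llin a)) (orth_pythagoras Hf Of).
  move: B1; rewrite (normsq_scale _ Hf1) csqN csq1 mul1r.
  move: (normsq_ge0 (glin a phi)) (normsq_ge0 (gsub f (glin a phi))) (csq_ge0 (z - lam)^-1).
  move: (normsq (glin a phi)) (normsq (gsub f (glin a phi))) (csq (z - lam)^-1) (normsq u1) => s t q b s0 t0 q0 B1.
  have h1 : 0 <= q * t by rewrite mulr_ge0.
  have h2 : 0 <= M * s by rewrite mulr_ge0// ltW.
  by lra.
Qed.

End Near.

Lemma circle_sub (r t : R) : circle lam r t - lam = r%:C * cexp (0 +i* t).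
Proof. by rewrite /circle addrC addKr. Qed.

Lemma csq_circle_sub (r t : R) : csq (circle lam r t - lam) = r ^+ 2.
Proof. by rewrite circle_sub csqM csq_circ mulr1 csq_real. Qed.

Lemma circle_neq (r t : R) : 0 < r -> circle lam r t != lam.
Proof.
move=> r0; rewrite -subr_eq0; apply/eqP => E; have := csq_circle_sub r t.
by rewrite E csq0 => /esym/eqP; rewrite sqrf_eq0 gt_eqF.
Qed.

(** On the circle, [dz / (z - lam) = i dt]. *)
Lemma circle_weight (r t : R) (c : C) : 0 < r ->
  (circle lam r t - lam)^-1 * c * ((0 +i* 1) * r%:C * cexp (0 +i* t)) = (0 +i* 1) * c.
Proof.
move=> r0; have := circle_neq t r0; rewrite -subr_eq0 circle_sub => n0.
have n1 : r%:C != 0 :> C by apply: contraNneq n0 => ->; rewrite mul0r.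
by field; rewrite cexp_neq0 n1.
Qed.

Lemma cint_circle_mean (c : C) :
  (2%:R * pi%:C * (0 +i* 1))^-1 * ((2%:R * pi)%:C * ((0 +i* 1) * c)) = c.
Proof.
have i0 : (0 +i* 1 : C) != 0 by rewrite eq_complex /= oner_eq0 andbF.
have p0 : pi%:C != 0 :> C by rewrite eq_complex /= eqxx andbT gt_eqF ?pi_gt0.
have -> : (2%:R * pi)%:C = 2%:R * pi%:C :> C.
  by rewrite rmorphM (rmorph_nat (real_complex R) 2).
by move: (pi%:C) p0 => s s0; field; rewrite i0 s0.
Qed.

Lemma phi_riesz (r : R) j : 0 < r -> riesz A lam r (phi j) (phi j).
Proof.
move=> r0; split; first exact: Lphi.
exists (fun t => gscale (circle lam r t - lam)^-1 (phi j)); split.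
- move=> t _; rewrite /resolves.
  have z0 : circle lam r t - lam != 0 by rewrite subr_eq0 circle_neq.
  have := A_lin (circle lam r t - lam)^-1 (@gL2_0 R G) (gL2_scale lam (Lphi j)) A0 (A_phi j).
  rewrite gaxpy0; congr (A _ _); apply/funext => e; apply/funext => x.
  by rewrite /gaxpy /gscale /gsub; field.
- move=> g Hg; rewrite -[LHS]cint_circle_mean; congr (_ * _).
  have [_ <-] := cint_circ_cst ((0 +i* 1) * inner (phi j) g).
  apply: cint_eq => t _; rewrite inner_scale//.
  by rewrite circle_weight.
Qed.

Section RieszRange.
Variables (M : R) (M0 : 0 < M).
Hypothesis coer : forall v g, gL2 g -> orth v -> A v (gaxpy g lam v) -> normsq v <= M * normsq g.
Hypothesis surj : forall f, gL2 f -> orth f ->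
  exists u, [/\ A u (gaxpy f lam u), orth u & normsq u <= M * normsq f].

(* Iterating the reduced resolvent gives the Taylor coefficients of the
   regular part of the resolvent at [lam], hence a vanishing circle integral. *)
Lemma regular_part_int (r : R) f1 (u1 : R -> gfun G) g : 0 < r -> r ^+ 2 * M <= 8^-1 ->
  gL2 f1 -> orth f1 -> gL2 g ->
  (forall t, 0 <= t <= 2%:R * pi -> orth (u1 t) /\ A (u1 t) (gaxpy f1 (circle lam r t) (u1 t))) ->
  let F t := inner (u1 t) g * ((0 +i* 1) * r%:C * cexp (0 +i* t)) in
  cinteg `[0, 2%:R * pi] F /\ cint `[0, 2%:R * pi] F = 0.
Proof.
move=> r0 rM Hf Of Hg Hu F.
(* [S] inverts [A - lam] on the orthogonal complement of the [phi j]; elsewhere its value is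
   arbitrary. *)
have /choice[S HS] : forall h, exists v, gL2 h /\ orth h ->
    [/\ A v (gaxpy h lam v), orth v & normsq v <= M * normsq h].
  move=> h.
  have [[Hh Oh]|nh] := pselect (gL2 h /\ orth h); last by exists h => /nh.
  by have [v Hv] := surj Hh Oh; exists v.
pose s n := iter n S f1.
have sP n : [/\ gL2 (s n), orth (s n) & normsq (s n) <= M ^+ n * normsq f1].
  elim: n => [|n [Hn On Bn]]; first by rewrite /s /= expr0 mul1r.
  have [Av Ov Bv] := HS _ (conj Hn On); split => //; first exact: A_L2 Av.
  rewrite exprS -mulrA; apply: le_trans Bv _; apply: ler_wpM2l => //; exact: ltW.
have sL n : gL2 (s n) by have [] := sP n.
have sA n : A (s n.+1) (gaxpy (s n) lam (s n.+1)).
  by have [Hn On _] := sP n; have [] := HS _ (conj Hn On).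
pose w t : C := r%:C * cexp (0 +i* t).
pose U N t := glin (fun n : 'I_N => w t ^+ n) (fun n : 'I_N => s n.+1).
have US N t : U N.+1 t = gaxpy (U N t) (w t ^+ N) (s N.+1).
  by apply/funext => e; apply/funext => x; rewrite /U /glin /gaxpy big_ord_recr.
have UL N t : gL2 (U N t) by apply: gL2_lin.
(* By [A s_(n+1) = s_n + lam s_(n+1)], applying [A] to the partial sum telescopes, leaving the
   residual [w ^ N s_N]. *)
pose rhs N t := gsub (gaxpy (gaxpy f1 (w t) (U N t)) lam (U N t)) (gscale (w t ^+ N) (s N)).
have rL N t : gL2 (rhs N t).
  by apply: gL2_sub; [apply: gL2_axpy => //; apply: gL2_axpy|apply: gL2_scale].
have UA N t : A (U N t) (rhs N t).
  elim: N => [|N IH].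
    rewrite /U glin0 (_ : rhs 0%N t = (fun _ _ => 0)) //.
    apply/funext => e; apply/funext => x; rewrite /rhs /U glin0 /gsub /gaxpy /gscale /s /= expr0.
    by ring.
  rewrite US; have := A_lin (w t ^+ N) (rL N t) (gL2_axpy lam (sL N) (sL N.+1)) IH (sA N).
  congr (A _ _); apply/funext => e; apply/funext => x.
  by rewrite /rhs US /gsub /gaxpy /gscale exprS; ring.
have UO N t : orth (U N t).
  move=> j; rewrite inner_lin//; apply: big1 => n _.
  by have [_ -> _] := sP n.+1; rewrite mulr0.
(* Linearity of [inner] requires [u1 t] in L^2, which is known only for [t] in the interval of
   integration; hence the disjunction. *)
have FE N t : F t - circ_poly (fun n => inner (s n.+1) g) r N t =
    inner (gaxpy (u1 t) (-1) (U N t)) g * ((0 +i* 1) * r%:C * cexp (0 +i* t)) \/ ~ gL2 (u1 t).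
  have [Hut|] := pselect (gL2 (u1 t)); [left|by right].
  rewrite inner_axpy// inner_lin// /F /circ_poly -mulr_suml mulN1r mulrBl.
  by congr (_ - _ * _); apply: eq_bigr.
(* The error [V] solves the equation with the residual as data: [coercive_near] gives [4 * M], the
   bound on [s N] gives [(r ^ 2 * M) ^ N <= 8 ^ - N], Cauchy-Schwarz gives [normsq g], and [dz]
   gives [r ^ 2]. *)
apply: (@circ_limit R (fun n => inner (s n.+1) g) r F (4 * M * normsq f1 * normsq g * r ^+ 2) 8^-1).
- by rewrite invr_ge0.
- by rewrite invf_lt1// ltr1n.
move=> N t It; have t2 : 0 <= t <= 2%:R * pi by move: It; rewrite /= in_itv.
have [Ou Au] := Hu t t2; have Hut := A_L2 Au.
have [->|//] := FE N t.
set V := gaxpy (u1 t) (-1) (U N t).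
have HV : gL2 V by apply: gL2_axpy.
have OV : orth V by apply: orth_axpy.
have AV : A V (gaxpy (gscale (w t ^+ N) (s N)) (circle lam r t) V).
  have := A_lin (-1) (gL2_axpy _ Hf Hut) (rL N t) Au (UA N t).
  congr (A _ _); apply/funext => e; apply/funext => x.
  have -> : circle lam r t = lam + w t by [].
  by rewrite /V /rhs /gsub /gaxpy /gscale; ring.
have zM : csq (circle lam r t - lam) * M <= 8^-1 by rewrite csq_circle_sub.
have BV := coercive_near M0 coer zM (gL2_scale _ (sL N)) OV AV.
have wN : csq (w t ^+ N) = (r ^+ 2) ^+ N.
  by rewrite csqX /w csqM csq_circ mulr1 csq_real.
rewrite (normsq_scale _ (sL N)) wN in BV; have [_ _ Bs] := sP N.
have r2 : 0 <= r ^+ 2 by rewrite sqr_ge0.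
have BV2 : normsq V <= 4 * M * normsq f1 * 8^-1 ^+ N.
  apply: (le_trans BV); rewrite -!(mulrA (4 * M)); apply: ler_wpM2l.
    by apply: mulr_ge0 => //; exact: ltW.
  apply: (@le_trans _ _ ((r ^+ 2) ^+ N * (M ^+ N * normsq f1))).
    by apply: ler_wpM2l => //; apply: exprn_ge0.
  rewrite mulrA -exprMn mulrC; apply: ler_wpM2l; first exact: normsq_ge0.
  by apply: lerXn2r => //; rewrite nnegrE ?invr_ge0// mulr_ge0// ltW.
rewrite !csqM csq_circ mulr1 csq_real csqi.
rewrite mul1r mulrAC; apply: ler_wpM2r => //.
apply: le_trans (cauchy_schwarz HV Hg) _; rewrite mulrAC; apply: ler_wpM2r => //.
exact: normsq_ge0.
Qed.

(** For any admissible family [u], the part on the span of [phi] integrates to the projection of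
    [f], and the regular part to zero. *)
Lemma riesz_range (r : R) f p : 0 < r -> r ^+ 2 * M <= 8^-1 -> gL2 f -> riesz A lam r f p ->
  exists a, Defs.ae_eq p (glin a phi).
Proof.
move=> r0 rM Hf [Hp [u [Hu Hint]]].
have [a Of] := orth_proj Hf; exists a.
have Hf1 := gL2_scale (-1) (gL2_sub Hf (Llin a)).
have Of1 : orth (gscale (-1) (gsub f (glin a phi))).
  by move=> j; rewrite inner_scale ?Of ?mulr0//; exact: gL2_sub.
pose u1 t := gsub (u t) (gscale (circle lam r t - lam)^-1 (glin a phi)).
have Hu1 t : 0 <= t <= 2%:R * pi -> orth (u1 t) /\
    A (u1 t) (gaxpy (gscale (-1) (gsub f (glin a phi))) (circle lam r t) (u1 t)).
  by move=> /Hu; apply: resolves_split => //; exact: circle_neq.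
(* The weak identity is applied to the difference of the two sides as test function. *)
suff E g : gL2 g -> inner p g = inner (glin a phi) g.
  apply: ae_eq_sub0; apply: normsq_eq0; first exact: gL2_sub.
  have Hg := gL2_sub Hp (Llin a).
  by rewrite /normsq inner_sub// E// subrr.
move=> Hg; rewrite Hint// -[RHS]cint_circle_mean; congr (_ * _).
have [iF F0] := regular_part_int r0 rM Hf1 Of1 Hg Hu1.
have [ic <-] := cint_circ_cst ((0 +i* 1) * inner (glin a phi) g).
rewrite -[RHS]addr0 -F0 -cintD//; apply: cint_eq => t It.
have t2 : 0 <= t <= 2%:R * pi by move: It; rewrite /= in_itv.
have Hut := A_L2 (Hu t t2).
have E : inner (u1 t) g = inner (u t) g - (circle lam r t - lam)^-1 * inner (glin a phi) g.
  by rewrite inner_sub ?inner_scale//; exact: gL2_scale.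
rewrite E [X in _ + X]mulrBl (circle_weight t (inner (glin a phi) g) r0).
by rewrite addrC subrK.
Qed.

End RieszRange.

Lemma alg_mult_isolated : alg_mult A lam d.
Proof.
have [eps [eps0 S]] := A_solvable.
have [M [M0 [coer surj]]] := coercive.
(* The square of the radius: smaller than [eps] for [A_solvable], and at most [1 / (8 M)] for
   [coercive_near]. *)
pose q := Num.min (eps / 2) (8 * M)^-1.
have q0 : 0 < q by rewrite lt_min divr_gt0//= invr_gt0 mulr_gt0.
exists (Num.sqrt q).
have r2 : Num.sqrt q ^+ 2 = q by rewrite sqr_sqrtr// ltW.
have r0 : 0 < Num.sqrt q by rewrite sqrtr_gt0.
have qM : q * M <= 8^-1.
  have : q <= (8 * M)^-1 by rewrite ge_min lexx orbT.
  move=> /(ler_wpM2r (ltW M0)) /le_trans; apply.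
  by rewrite invfM -mulrA mulVf ?mulr1// gt_eqF.
split => //.
- move=> z /andP[z0 zr].
  have zl : z != lam by rewrite -subr_eq0 -normr_gt0.
  have zq : csq (z - lam) <= q.
    have : Num.sqrt (csq (z - lam)) <= Num.sqrt q by move: zr; rewrite normc_def lecR.
    by rewrite ler_sqrt// ltW.
  have zM : csq (z - lam) * M <= 8^-1.
    by apply: le_trans qM; apply: ler_wpM2r => //; exact: ltW.
  apply: (resolvent_near M0 coer) => //; apply: S; last exact: (ker_near M0 coer).
  apply: (le_lt_trans zq); apply: (@le_lt_trans _ _ (eps / 2)); first by rewrite ge_min lexx.
  by rewrite ltr_pdivrMr// ltr_pMr// ltr1n.
- exists phi; split.
  + by move=> j; exists (phi j); split => //; exact: phi_riesz.
  + by move=> a /(normsq_ae0 (Llin a)); exact: phi_free.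
  + by move=> p [f [Hf Rf]]; apply: (riesz_range M0 coer surj r0 _ Hf Rf); rewrite r2.
Qed.

End IsolatedSemisimple.

(** * Flux and Green identities *)

Section VertexConditions.
Variables (R : realType) (G : qgraph R).
Local Notation mu := (@lebesgue_measure R).
Local Notation C := R[i].
Local Notation gend := (@gend R G).
Implicit Types (f g h u : gfun G) (kap z : C) (s t : gend) (v : vtx G).

(** At each vertex the common value factors out of the sum of the derivatives, which is zero. *)
Lemma vertex_sum (val der : gend -> C) :
  (forall a b, gvtx a = gvtx b -> val a = val b) ->
  (forall v, \sum_(a | gvtx a == v) der a = 0) -> \sum_a der a * val a = 0.
Proof.
move=> V D; rewrite (partition_big (@gvtx R G) predT) //=; apply: big1 => v _.
have [a0 /eqP av|none] := pickP (fun a : gend => gvtx a == v).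
  rewrite (eq_bigr (fun a => der a * val a0)) => [|a /eqP E]; last by rewrite (V a a0) ?E.
  by rewrite -mulr_suml D mul0r.
by rewrite big_pred0.
Qed.

(** One chosen end per vertex. The default is never taken, since [s] itself passes the test. *)
Definition rep (s : gend) : gend := odflt s [pick a | gvtx a == gvtx s].

Lemma rep_vtx s : gvtx (rep s) = gvtx s.
Proof. by rewrite /rep; case: pickP => [a /eqP|]. Qed.

Lemma rep_eq s t : gvtx s = gvtx t -> rep s = rep t.
Proof.
move=> st; rewrite /rep st; case: pickP => //= H.
by have := H t; rewrite eqxx.
Qed.

(* The vertex conditions indexed by the ends of the edges, so that there are as many equations as
   unknown coefficients in [hom]: the Kirchhoff sum at one end [rep s] of each vertex, and
   continuity with [rep s] at the other ends. *)
Definition end_cond kap u (u1 : gfun G) (s : gend) : C :=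
  if s == rep s then \sum_(a | gvtx a == gvtx s) tder kap u1 a
  else tval kap u s - tval kap u (rep s).

Lemma end_condP kap u u1 : (forall s, end_cond kap u u1 s = 0) <-> vcond kap u u1.
Proof.
split=> [H|[V K] s]; last first.
  rewrite /end_cond; case: ifP => _; first exact: K.
  by rewrite (V s (rep s)) ?rep_vtx ?subrr.
have T s : tval kap u s = tval kap u (rep s).
  have := H s; rewrite /end_cond; case: eqP => [<-|_] // /eqP.
  by rewrite subr_eq0 => /eqP.
split=> [a b ab|v]; first by rewrite T (rep_eq ab) -T.
have [s sv] : exists s : gend, gvtx s = v.
  have [[e [et|et]]|[l lv]] := attached v.
  - by exists (inl (e, false)).
  - by exists (inl (e, true)).
  - by exists (inr l).
have := H (rep s); rewrite /end_cond (rep_eq (rep_vtx s)) eqxx rep_vtx sv //.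
Qed.

Lemma tval_axpy kap u c (v : gfun G) s : tval kap (gaxpy u c v) s = tval kap u s + c * tval kap v s.
Proof. by case: s => [[i b]|l] //=; rewrite /gaxpy; ring. Qed.

Lemma tder_axpy kap u c (v : gfun G) s : tder kap (gaxpy u c v) s = tder kap u s + c * tder kap v s.
Proof. by case: s => [[i []]|l] /=; rewrite /gaxpy; ring. Qed.

Lemma end_cond_axpy kap u u1 c (v v1 : gfun G) s :
  end_cond kap (gaxpy u c v) (gaxpy u1 c v1) s = end_cond kap u u1 s + c * end_cond kap v v1 s.
Proof.
rewrite /end_cond; case: ifP => _; last by rewrite !tval_axpy; ring.
by rewrite mulr_sumr -big_split /=; apply: eq_bigr => a _; rewrite tder_axpy.
Qed.

Lemma end_pt i b : (edom (inl i : edge G)) (if b then len i else 0).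
Proof. by rewrite /= in_itv /=; case: b; rewrite ?lexx /= ?ltW ?len_gt0. Qed.

(** The expression [u' conj p - u conj p'] is absolutely continuous, and its increment along the
    edge is the integral of its derivative. Outgoing derivatives supply the signs at the two
    ends. *)
Lemma lagrange_edge (k : R) i u u1 h p p1 :
  W2 (edom (inl i)) (u (inl i)) (u1 (inl i)) (fun x => - h (inl i) x) ->
  W2 (edom (inl i)) (p (inl i)) (p1 (inl i)) (fun x => - (k%:C * p (inl i) x)) ->
  cint (edom (inl i)) (fun x => h (inl i) x * conjc (p (inl i) x) -
    k%:C * (u (inl i) x * conjc (p (inl i) x))) =
  \sum_(b : bool) (tder 0 u1 (inl (i, b)) * conjc (tval 0 p (inl (i, b))) -
    tval 0 u (inl (i, b)) * conjc (tder 0 p1 (inl (i, b)))).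
Proof.
move=> [A B] [A' B']; pose e : edge G := inl i; rewrite -/e; have hD := hdom_edom e.
have H := ACB (ACM hD B (AC_conj A')) (ACM hD A (AC_conj B')).
have Dl : edom e (len i) by exact: (end_pt i true).
have E x : h e x * conjc (p e x) - k%:C * (u e x * conjc (p e x)) =
   - (- h e x * conjc (p e x) + u1 e x * conjc (p1 e x) -
     (u1 e x * conjc (p1 e x) + u e x * conjc (- (k%:C * p e x)))).
  by rewrite rmorphN rmorphM /= oppr0 -[k +i* 0]/(k%:C); ring.
have [[ri E1] [ii E2]] := (H.1 _ Dl, H.2 _ Dl).
have -> : cint (edom e) (fun x => h e x * conjc (p e x) - k%:C * (u e x * conjc (p e x))) =
   - cint `[0, len i] (fun x => - h e x * conjc (p e x) + u1 e x * conjc (p1 e x) -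
     (u1 e x * conjc (p1 e x) + u e x * conjc (- (k%:C * p e x)))).
  by rewrite (cint_eq (fun x _ => E x)) (cint_eq (fun x _ => esym (mulN1r _))) cintZ ?mulN1r//; exact: mset_edom e.
rewrite big_bool /= /end_val /=.
have -> : cint `[0, len i] (fun x => - h e x * conjc (p e x) + u1 e x * conjc (p1 e x) -
     (u1 e x * conjc (p1 e x) + u e x * conjc (- (k%:C * p e x)))) =
   (u1 e (len i) * conjc (p e (len i)) - u e (len i) * conjc (p1 e (len i))) -
   (u1 e 0 * conjc (p e 0) - u e 0 * conjc (p1 e 0)).
  apply: complex_ext => /=.
  - rewrite [LHS]/= -[LHS](addKr (re (fun x => u1 e x * conjc (p e x) - u e x * conjc (p1 e x)) 0)) -E1 addrC.
    by rewrite /re; case: (u1 e (len i) * _ - _) (u1 e 0 * _ - _) => [a b] [a' b'].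
  - rewrite [LHS]/= -[LHS](addKr (im (fun x => u1 e x * conjc (p e x) - u e x * conjc (p1 e x)) 0)) -E2 addrC.
    by rewrite /im; case: (u1 e (len i) * _ - _) (u1 e 0 * _ - _) => [a b] [a' b'].
by rewrite !rmorphN /=; ring.
Qed.

Lemma skew (x y : C) : x * conjc y - conjc (x * conjc y) = x * conjc y - y * conjc x.
Proof. by case: x y => [a b] [a' b']; apply: complex_ext => /=; ring. Qed.

(* Imaginary part of the Lagrange identity over [G_0]. *)
Lemma flux kap (k c : R) f f1 : c != 0 ->
  (forall i, W2 (edom (inl i)) (f (inl i)) (f1 (inl i)) (fun x => - (k%:C * f (inl i) x))) ->
  vcond kap f f1 ->
  (forall l, tder kap f1 (inr l) = (0 +i* c) * tval kap f (inr l)) ->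
  forall l, tval kap f (inr l) = 0.
Proof.
move=> c0 W [V K] L.
pose w a := tder kap f1 a * conjc (tval kap f a).
have S0 : \sum_a w a = 0.
  by apply: vertex_sum => // a b ab; rewrite (V a b ab).
have S : \sum_a (w a - conjc (w a)) = 0.
  rewrite sumrB S0 sub0r; apply/eqP; rewrite oppr_eq0; apply/eqP.
  by rewrite -(rmorph_sum (@conjc R)) S0 rmorph0.
(* With [p = f] and real [k] the integrand of the Lagrange identity vanishes, so the two ends of
   each internal edge cancel. *)
have Si : \sum_(a : iend G) (w (inl a) - conjc (w (inl a))) = 0.
  rewrite -(pair_big predT predT (fun i b => w (inl (i, b)) - conjc (w (inl (i, b))))) /=.
  apply: big1 => i _; have := lagrange_edge (h := fun e x => k%:C * f e x) (W i) (W i).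
  rewrite (@cint_eq _ _ _ (fun=> 0)) => [|x _]; last by rewrite mulrA subrr.
  rewrite {1}/cint /re /im /= !Rintegral_cst ?mul0r// => H.
  rewrite -[RHS]/(0 +i* 0) H; apply: eq_bigr => b _.
  exact: skew.
(* All leads contribute with the sign of [c], so a zero total forces each term to vanish. *)
have wl l : complex.Im (w (inr l) - conjc (w (inr l))) = 2 * c * csq (tval kap f (inr l)).
  by rewrite /w L; case: (tval kap f (inr l)) => a b; rewrite /csq /=; ring.
have Sl : \sum_l (2 * c * csq (tval kap f (inr l))) = 0.
  transitivity (complex.Im (\sum_l (w (inr l) - conjc (w (inr l))))).
    by rewrite raddf_sum; apply: eq_bigr => l _; rewrite -wl.
  by rewrite big_sumType /= Si add0r in S; rewrite S.
move=> l; apply: csq_eq0; move/eqP: Sl; rewrite -mulr_sumr mulf_eq0 mulf_eq0 pnatr_eq0 (negbTE c0) /=.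
rewrite psumr_eq0 => [/allP /(_ l (mem_index_enum l)) /implyP /(_ isT) /eqP|l' _] //.
exact: csq_ge0.
Qed.

(** Neither the leads nor their ends contribute, because [p] and [p1] vanish there. Of the two
    boundary sums, one vanishes by the Kirchhoff condition for [u] with continuity of [p], the other
    with the roles exchanged. *)
Lemma green kap (k : R) u u1 h p p1 : gL2 h -> esol kap u u1 h -> vcond kap u u1 ->
  gL2 p ->
  (forall i, W2 (edom (inl i)) (p (inl i)) (p1 (inl i)) (fun x => - (k%:C * p (inl i) x))) ->
  vcond kap p p1 ->
  (forall l x, 0 <= x -> p (inr l) x = 0) -> (forall l, p1 (inr l) 0 = 0) ->
  inner h p = k%:C * inner u p.
Proof.
move=> Hh E [Vu Ku] Hp W [Vp Kp] p0 p10.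
have Hu : gL2 u by move=> e; have [_ []] := E e.
have -> : inner h p = k%:C * inner u p + \sum_a (tder kap u1 a * conjc (tval kap p a) - tval kap u a * conjc (tder kap p1 a)).
  have Z1 : \sum_l (tder kap u1 (inr l) * conjc (tval kap p (inr l)) -
      tval kap u (inr l) * conjc (tder kap p1 (inr l))) = 0.
    by apply: big1 => l _; rewrite /= p0// p10 !mulr0 conjc0 !mulr0 subrr.
  have Z (q : gfun G) : \sum_l cint (edom (inr l : edge G)) (fun x => q (inr l) x * conjc (p (inr l) x)) = 0.
    apply: big1 => l _; rewrite (@cint_eq _ _ _ (fun=> 0)) => [|x].
      by rewrite /cint /re /im /= !Rintegral_cst ?mul0r//; exact: (mset_edom (inr l)).
    by rewrite /= in_itv /= andbT => /p0 ->; rewrite conjc0 mulr0.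
  rewrite /inner !big_sumType /= !Z Z1 !addr0 mulr_sumr.
  rewrite -(pair_big predT predT (fun i b => tder kap u1 (inl (i, b)) * conjc (tval kap p (inl (i, b))) -
     tval kap u (inl (i, b)) * conjc (tder kap p1 (inl (i, b))))) /= -big_split /=.
  apply: eq_bigr => i _.
  have We : W2 (edom (inl i)) (u (inl i)) (u1 (inl i)) (fun x => - h (inl i) x).
    have [[A B] _] := E (inl i); split => //; apply: AC_eq B => // [|x _]; first exact: hdom_edom (inl i).
    by rewrite mul1r.
  have I1 := inner_int (inl i) Hh Hp; have I2 := inner_int (inl i) Hu Hp.
  have mI := mset_edom (inl i : edge G).
  have <- := lagrange_edge We (W i).
  rewrite -cintZ// -cintD//.
  - by apply: cint_eq => x _; ring.
  - exact: cintegZ.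
  - have := cintegD mI I1 (cintegZ (- k%:C) mI I2).
    by congr (cinteg _ _); apply/funext => x; rewrite mulNr.
rewrite sumrB (vertex_sum (val := fun a => conjc (tval kap p a))) // => [|a b ab]; last by rewrite (Vp a b ab).
rewrite (eq_bigr (fun a => conjc (tder kap p1 a) * tval kap u a)) => [|a _]; last by rewrite mulrC.
rewrite (vertex_sum (val := tval kap u)) ?subr0 ?addr0 // => v.
by rewrite -(rmorph_sum (@conjc R)) Kp rmorph0.
Qed.

End VertexConditions.

(** * The bordered linear system *)

Section EdgewiseSolutions.
Variables (R : realType) (G : qgraph R) (theta : R) (s : R[i]).
Local Notation mu := (@lebesgue_measure R).
Local Notation C := R[i].
Local Notation gend := (@gend R G).
Local Notation kap := (0 +i* theta : C).
Implicit Types (f g u : gfun G) (a : gend -> C).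

(** The spectral parameter is [s ^+ 2]; the choice of the root [s] decides whether the exponential
    on the leads decays. *)
Definition rate (e : edge G) : C :=
  match e with inl _ => (0 +i* 1) * s | inr _ => (0 +i* 1) * s * cexp kap end.

Definition hom a : gfun G := fun e x =>
  match e with
  | inl i => a (inl (i, false)) * exp_sol (rate e) x + a (inl (i, true)) * exp_sol (- rate e) x
  | inr l => a (inr l) * exp_sol (rate e) x
  end.

Definition hom1 a : gfun G := fun e x =>
  match e with
  | inl i => a (inl (i, false)) * (rate e * exp_sol (rate e) x) +
             a (inl (i, true)) * (- rate e * exp_sol (- rate e) x)
  | inr l => a (inr l) * (rate e * exp_sol (rate e) x)
  end.

Lemma rate_sq e : rate e ^+ 2 = - (s ^+ 2 * cfac kap e).
Proof.
have i2 : (0 +i* 1 : C) ^+ 2 = -1 by exact: sqr_i.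
case: e => [i|l] /=; first by rewrite exprMn i2 mulr1 mulN1r.
rewrite !exprMn i2 mulN1r mulNr; congr (- (_ * _)).
by rewrite expr2 -cexpD -mulr2n mulr_natl.
Qed.

Lemma csq_cexp_im (z : C) : complex.Re z = 0 -> csq (cexp z) = 1.
Proof. by move=> z0; rewrite csq_cexp z0 mulr0 expR0. Qed.

(** [kap] is purely imaginary, so this factor, like those in the traces, has modulus one and leaves
    the estimates unchanged. *)
Lemma csq_cfac (e : edge G) : csq (cfac kap e) = 1.
Proof.
case: e => [i|l] /=; first exact: csq1.
apply: csq_cexp_im; rewrite -(rmorph_nat (real_complex R) 2).
by rewrite /= mulr0 mul0r subr0.
Qed.

Lemma Re_natdiv (n m : nat) : complex.Re (- (n%:R * kap / m.+1%:R)) = 0.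
Proof.
have -> : - (n%:R * kap / m.+1%:R) = (- (n%:R / m.+1%:R))%:C * kap :> C.
  by rewrite rmorphN rmorphM fmorphV !rmorph_nat; ring.
by rewrite /= mulr0 mul0r subr0.
Qed.

Lemma csq_tval f (t : gend) : csq (tval kap f t) =
  match t with inl b => csq (end_val f b) | inr l => csq (f (inr l) 0) end.
Proof.
case: t => [//|l] /=; rewrite csqM csq_cexp_im ?mul1r//.
by have := Re_natdiv 1 1; rewrite mul1r.
Qed.

Lemma csq_tder f (t : gend) : csq (tder kap f t) =
  match t with inl b => csq (f (inl b.1) (if b.2 then len b.1 else 0)) | inr l => csq (f (inr l) 0) end.
Proof.
case: t => [[i []]|l] /=; rewrite ?csqN// csqM csq_cexp_im ?mul1r//.
exact: Re_natdiv 3 1.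
Qed.

Hypothesis s0 : s != 0.

Lemma rate_neq0 e : rate e != 0.
Proof.
have i0 : (0 +i* 1 : C) != 0 by rewrite eq_complex /= oner_eq0 andbF.
by case: e => [i|l] /=; rewrite !mulf_neq0 ?cexp_neq0.
Qed.

Lemma hom_axpy a (c : C) a' :
  hom (fun t => a t + c * a' t) = gaxpy (hom a) c (hom a') /\
  hom1 (fun t => a t + c * a' t) = gaxpy (hom1 a) c (hom1 a').
Proof.
by split; apply/funext => -[i|l]; apply/funext => x; rewrite /hom /hom1 /gaxpy; ring.
Qed.

Hypothesis decay : complex.Re ((0 +i* 1) * s * cexp kap) < 0.

Lemma hom_esol a : esol kap (hom a) (hom1 a) (gscale (s ^+ 2) (hom a)).
Proof.
move=> e; have hD := hdom_edom e.
have E x : - (cfac kap e * gscale (s ^+ 2) (hom a) e x) = rate e ^+ 2 * hom a e x.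
  by rewrite rate_sq /gscale; ring.
have [A B] := exp_W2 (rate e) hD; have [A' B'] := exp_W2 (- rate e) hD.
case: e hD E A B A' B' => [i|l] hD E A B A' B'.
- have W : W2 (edom (inl i)) (hom a (inl i)) (hom1 a (inl i)) (fun x => - (cfac kap (inl i) * gscale (s ^+ 2) (hom a) (inl i) x)).
    split; first by apply: ACD; exact: ACZ.
    apply: AC_eq (ACD (ACZ (a (inl (i, false))) hD B) (ACZ (a (inl (i, true))) hD B')) => // x _.
    by rewrite E /hom; ring.
  split => //; case: W => C1 C2; split; apply: L2_cont; [exact: AC_cont hD C1|exact: AC_cont hD C2].
- split.
    split; first exact: ACZ.
    by apply: AC_eq (ACZ (a (inr l)) hD B) => // x _; rewrite E /hom; ring.
  have e2 : L2 (edom (inr l : edge G)) (exp_sol (rate (inr l))).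
    by apply: (@cexp_decay _ (- complex.Re (rate (inr l)))); rewrite ?oppr_gt0 ?opprK.
  by split; do ?apply: L2Z => //; exact: mset_edom (inr l).
Qed.

Lemma hom_unique u u1 : esol kap u u1 (gscale (s ^+ 2) u) ->
  exists a, forall e x, edom e x -> u e x = hom a e x /\ u1 e x = hom1 a e x.
Proof.
move=> H.
have W e : W2 (edom e) (u e) (u1 e) (fun x => rate e ^+ 2 * u e x).
  have [[A B] _] := H e; split => //; apply: AC_eq B => // [|x _]; first exact: hdom_edom.
  by rewrite rate_sq /gscale; ring.
exists (fun t => match t with
  | inl (i, false) => (2 * rate (inl i))^-1 * (u1 (inl i) 0 + rate (inl i) * u (inl i) 0)
  | inl (i, true) => - ((2 * rate (inl i))^-1 * (u1 (inl i) 0 - rate (inl i) * u (inl i) 0))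
  | inr l => u (inr l) 0 end) => -[i|l] x Dx.
- have [-> ->] := hom_sol (hdom_edom (inl i)) (rate_neq0 (inl i)) (W (inl i)) Dx.
  by split; rewrite /hom /hom1; ring.
- have [_ [L1 L2']] := H (inr l).
  exact: (lead_hom (rate_neq0 (inr l)) (ltW decay) (W (inr l)) L1 L2' Dx).
Qed.

Lemma hom_ae0 a : Defs.ae_eq (hom a) (fun _ _ => 0) -> forall t, a t = 0.
Proof.
move=> ae; have H := hom_esol a.
have z e : (forall x, edom e x -> hom a e x = 0) /\ hom1 a e 0 = 0.
  have hD := hdom_edom e; have [[A B] _] := H e.
  have u0 := ae_cont0 hD (AC_cont hD A) (ae e).
  split => //; rewrite -(AC_rderiv0 hD A (AC_cont hD B)).
  have A0 : AC (edom e) (hom a e) (fun=> 0).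
    by apply: AC_eq (AC_cst (edom e) 0) => // x Dx; rewrite u0.
  by rewrite (AC_rderiv0 hD A0 (AC_cont hD (AC_cst _ 0))).
have ex0 n : exp_sol n 0 = 1 :> C by rewrite /exp_sol mulr0 cexp0.
case=> [[i b]|l].
- have [/(_ 0 (hdom0 (hdom_edom (inl i)))) h0 h1] := z (inl i).
  move: h0 h1; rewrite /hom /hom1 !ex0 !mulr1 => h0 /eqP.
  rewrite mulrN -mulrBl mulf_eq0 (negbTE (rate_neq0 _)) orbF => /eqP h1.
  have E1 : a (inl (i, false)) = 0.
    by have : 2 * a (inl (i, false)) = 0 by [rewrite -(addr0 0) -{1}h0 -h1; ring]; move/eqP; rewrite mulf_eq0 pnatr_eq0 => /eqP.
  by case: b => //; move: h0; rewrite E1 add0r.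
- have [/(_ 0 (hdom0 (hdom_edom (inr l)))) h0 _] := z (inr l).
  by move: h0; rewrite /hom ex0 mulr1.
Qed.

Lemma particular_solution : exists M : R, 0 <= M /\ forall f, gL2 f -> exists u u1,
  [/\ esol kap u u1 (gaxpy f (s ^+ 2) u), normsq u <= M * normsq f &
      forall t, csq (tval kap u t) <= M * normsq f /\ csq (tder kap u1 t) <= M * normsq f].
Proof.
pose bd (e : edge G) : set R := match e with inl i => `[0, len i]%classic | inr _ => [set 0] end.
have /choice[M HM] : forall e, exists M, 0 <= M /\ edge_bound (edom e) (bd e) (rate e) M.
  case=> [i|l]; first exact: (edge_bound_int (len_gt0 i) (rate_neq0 (inl i))).
  exact: edge_bound_lead.
have M0 e : 0 <= M e by have [] := HM e.
exists (\sum_e M e); split; first exact: sumr_ge0.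
move=> f Hf.
have H e : exists w : (R -> C) * (R -> C),
  [/\ W2 (edom e) w.1 w.2 (fun x => rate e ^+ 2 * w.1 x - cfac kap e * f e x), L2 (edom e) w.1 /\ L2 (edom e) w.2,
      \int[mu]_(x in edom e) csq (w.1 x) <= M e * \int[mu]_(x in edom e) csq (f e x) &
      forall x, bd e x -> csq (w.1 x) <= M e * \int[mu]_(y in edom e) csq (f e y) /\
                       csq (w.2 x) <= M e * \int[mu]_(y in edom e) csq (f e y)].
  have [_ K] := HM e; have [|u [u1 [W L I B]]] := K (fun x => cfac kap e * f e x).
    by apply: L2Z => //; exact: mset_edom.
  have E : \int[mu]_(x in edom e) csq (cfac kap e * f e x) = \int[mu]_(x in edom e) csq (f e x).
    by apply: Rint_eq => x _; rewrite csqM csq_cfac mul1r.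
  by exists (u, u1); rewrite -E.
have /choice[w Hw] := H.
exists (fun e => (w e).1), (fun e => (w e).2).
have le e : M e * \int[mu]_(x in edom e) csq (f e x) <= (\sum_e M e) * normsq f.
  apply: ler_pM => //; first exact: csq_int_ge0.
  - by rewrite (bigD1 e) //= lerDl; apply: sumr_ge0.
  - by rewrite (normsqE f).1 (bigD1 e) //= lerDl; apply: sumr_ge0 => ? _; exact: csq_int_ge0.
split.
- move=> e; have [[A B] L _ _] := Hw e; split => //; split => //.
  apply: AC_eq B => // [|x _]; first exact: hdom_edom.
  by rewrite rate_sq /gaxpy; ring.
- rewrite (normsqE _).1 (normsqE f).1 mulr_sumr; apply: ler_sum => e _.
  have [_ _ I _] := Hw e; apply: (le_trans I); apply: ler_wpM2r; first exact: csq_int_ge0.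
  by rewrite (bigD1 e) //= lerDl; apply: sumr_ge0.
- move=> t; rewrite csq_tval csq_tder.
  have K e x : bd e x -> csq ((w e).1 x) <= (\sum_e M e) * normsq f /\
      csq ((w e).2 x) <= (\sum_e M e) * normsq f.
    by have [_ _ _ B] := Hw e => /B[b1 b2]; split; [apply: le_trans b1 _|apply: le_trans b2 _].
  case: t => [[i b]|l]; last exact: K.
  by apply: (K (inl i)); exact: (end_pt i b).
Qed.

End EdgewiseSolutions.

Section BorderedSystem.
Variables (R : realType) (G : qgraph R) (theta : R) (s : R[i]).
Local Notation C := R[i].
Local Notation gend := (@gend R G).
Local Notation kap := (0 +i* theta : C).
Local Notation A := (@op_Hs R G kap).
Implicit Types (f g h u : gfun G).

Lemma esol_axpy kp u u1 h c v v1 g : esol kp u u1 h -> esol kp v v1 g ->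
  esol kp (gaxpy u c v) (gaxpy u1 c v1) (gaxpy h c g) :> Prop.
Proof.
move=> H K e; have hD := hdom_edom e; have mD := mset_edom e.
have [[A1 B1] [l1 m1]] := H e; have [[A2 B2] [l2 m2]] := K e.
split; last by split; apply: L2D => //; apply: L2Z.
split; first by apply: ACD => //; exact: ACZ.
by apply: AC_eq (ACD B1 (ACZ c hD B2)) => // x _; rewrite /gaxpy; ring.
Qed.

Lemma vcond_axpy kp u u1 c (v v1 : gfun G) : vcond kp u u1 -> vcond kp v v1 ->
  vcond kp (gaxpy u c v) (gaxpy u1 c v1).
Proof.
move=> /end_condP H /end_condP K; apply/end_condP => t.
by rewrite end_cond_axpy H K mulr0 addr0.
Qed.

Lemma Hs_lin kp u v h g c : gL2 h -> gL2 g -> op_Hs kp u h -> op_Hs kp v g ->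
  op_Hs kp (gaxpy u c v) (gaxpy h c g) :> Prop.
Proof.
move=> Hh Hg /(op_HsP kp u Hh)[u1 [E1 V1]] /(op_HsP kp v Hg)[v1 [E2 V2]].
apply/op_HsP; first exact: gL2_axpy.
by exists (gaxpy u1 c v1); split; [exact: esol_axpy|exact: vcond_axpy].
Qed.

Lemma Hs_0 kp : op_Hs kp (fun _ _ => 0) ((fun _ _ => 0) : gfun G) :> Prop.
Proof.
apply/op_HsP; first exact: gL2_0.
exists (fun _ _ => 0); split.
  move=> e; have hD := hdom_edom e; have c0 := AC_cst (edom e) 0.
  split; last by split; apply: L2_0; exact: mset_edom.
  by split => //; apply: AC_eq c0 => // x _; rewrite mulr0 oppr0.
have v0 a : tval kp ((fun _ _ => 0) : gfun G) a = 0 by case: a => //= l; rewrite mulr0.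
have d0 a : tder kp ((fun _ _ => 0) : gfun G) a = 0.
  by case: a => [[i []]|l] /=; rewrite ?oppr0 ?mulr0.
by split=> [a b _|v]; [rewrite !v0|apply: big1 => a _; exact: d0].
Qed.

Lemma Hs_L2 kp u h : op_Hs kp u h -> gL2 u.
Proof.
case=> Hi Hl _ _ _ [i|l]; first by have [] := Hi i.
by have [q [[]]] := Hl l.
Qed.

Lemma functional_expand (T : finType) (L : (T -> C) -> C) :
  (forall x c y, L (fun t => x t + c * y t) = L x + c * L y) ->
  forall x, L x = \sum_t x t * L (fun r => (r == t)%:R).
Proof.
move=> lin x.
have L0 : L (fun=> 0) = 0.
  have := lin (fun=> 0) (-1) (fun=> 0); rewrite (_ : (fun t : T => _) = (fun=> 0)).
    by move=> ->; rewrite mulN1r subrr.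
  by apply/funext => t; rewrite mulr0 addr0.
have E r : L (fun t => \sum_(i <- r) x i * (t == i)%:R) = \sum_(i <- r) x i * L (fun t => (t == i)%:R).
  elim: r => [|a r IH]; first by rewrite big_nil -[RHS]L0; congr L; apply/funext => t; rewrite big_nil.
  rewrite big_cons addrC -IH -lin; congr L; apply/funext => t.
  by rewrite big_cons addrC.
rewrite -E; congr L; apply/funext => t.
rewrite (bigD1 t) //= eqxx mulr1 big1 ?addr0 // => i it.
by rewrite eq_sym (negbTE it) mulr0.
Qed.

Variables (d : nat) (phi : 'I_d -> gfun G) (lam : C).
Hypothesis s0 : s != 0.
Hypothesis decay : complex.Re ((0 +i* 1) * s * cexp kap) < 0.
Hypothesis phi_L2 : forall j, gL2 (phi j).
Hypothesis A_sym : forall u h j, gL2 h -> A u h -> inner h (phi j) = lam * inner u (phi j).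
Hypothesis phi_free : forall a : 'I_d -> C, orth phi (glin a phi) -> forall i, a i = 0.
Hypothesis A_inj : forall u, Defs.kernel A (s ^+ 2) u -> orth phi u -> normsq u = 0.

Local Notation T := (gend + 'I_d)%type.

(* Ansatz: a particular solution for [f], plus [hom], minus [x_j] times particular solutions for
   [phi j]. The vertex and orthogonality conditions form a square linear system for the
   coefficients, injective by [A_inj]. *)
Lemma bordered_solvable : solvable A phi (s ^+ 2).
Proof.
pose z : C := s ^+ 2.
have [M [M0 partsol]] := particular_solution G s0 decay.
have /choice[w Hw] : forall f, exists w : gfun G * gfun G, gL2 f ->
    [/\ esol kap w.1 w.2 (gaxpy f z w.1), normsq w.1 <= M * normsq f &
      forall t, csq (tval kap w.1 t) <= M * normsq f /\ csq (tder kap w.2 t) <= M * normsq f].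
  move=> f; have [Hf|nf] := pselect (gL2 f); last by exists (f, f) => /nf.
  by have [u [u1 H]] := partsol f Hf; exists (u, u1).
pose psi j := (w (phi j)).1; pose psi1 j := (w (phi j)).2.
pose U (x : T -> C) : gfun G := gaxpy (hom theta s (fun t => x (inl t))) (-1) (glin (fun j => x (inr j)) psi).
pose U1 (x : T -> C) : gfun G := gaxpy (hom1 theta s (fun t => x (inl t))) (-1) (glin (fun j => x (inr j)) psi1).
have glin_axpy (b : 'I_d -> gfun G) x c y : glin (fun j => x j + c * y j) b = gaxpy (glin x b) c (glin y b).
  apply/funext => e; apply/funext => t; rewrite /glin /gaxpy mulr_sumr -big_split /=.
  by apply: eq_bigr => j _; ring.
have Ulin x c y : U (fun t => x t + c * y t) = gaxpy (U x) c (U y).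
  rewrite /U (hom_axpy theta s (fun t => x (inl t)) c (fun t => y (inl t))).1 glin_axpy.
  by apply/funext => e; apply/funext => t; rewrite /gaxpy; ring.
have U1lin x c y : U1 (fun t => x t + c * y t) = gaxpy (U1 x) c (U1 y).
  rewrite /U1 (hom_axpy theta s (fun t => x (inl t)) c (fun t => y (inl t))).2 glin_axpy.
  by apply/funext => e; apply/funext => t; rewrite /gaxpy; ring.
have psiE (a : 'I_d -> C) : esol kap (glin a psi) (glin a psi1) (gaxpy (glin a phi) z (glin a psi)).
  move=> e; have hD := hdom_edom e.
  have W j : AC (edom e) (psi j e) (psi1 j e) /\ AC (edom e) (psi1 j e) (fun x => - (cfac kap e * gaxpy (phi j) z (psi j) e x)).
    by have [E _ _] := Hw _ (phi_L2 j); have [[]] := E e.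
  have L (b : 'I_d -> gfun G) : (forall j, L2 (edom e) (b j e)) -> L2 (edom e) (glin a b e).
    move=> Lb; rewrite /glin.
    elim: (index_enum _) => [|i r IH].
      by apply: L2_eq (L2_0 (mset_edom e)) => [|x _]; [exact: mset_edom|rewrite big_nil].
    apply: L2_eq (L2D (mset_edom e) (L2Z (a i) (mset_edom e) (Lb i)) IH) => [|x _]; first exact: mset_edom.
    by rewrite big_cons.
  split; last by split; apply: L => j; have [E _ _] := Hw _ (phi_L2 j); have [_ []] := E e.
  split; first by apply: AC_sum => // j; apply: ACZ => //; have [] := W j.
  apply: AC_eq (AC_sum hD (fun j => ACZ (a j) hD (W j).2)) => // x _.
  rewrite /gaxpy /glin !mulr_sumr -big_split /= mulr_sumr -sumrN; apply: eq_bigr => j _; ring.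
have UE x : esol kap (U x) (U1 x) (gaxpy (gscale (-1) (glin (fun j => x (inr j)) phi)) z (U x)).
  have := esol_axpy (-1) (hom_esol decay (fun t => x (inl t))) (psiE (fun j => x (inr j))).
  by congr (esol _ _ _ _); apply/funext => e; apply/funext => t; rewrite /U /gaxpy /gscale -/z; ring.
have UL x : gL2 (U x) by move=> e; have [_ []] := UE x e.
pose Phi (x : T -> C) (r : T) : C :=
  match r with inl t => end_cond kap (U x) (U1 x) t | inr j => inner (U x) (phi j) end.
have Philin r x c y : Phi (fun t => x t + c * y t) r = Phi x r + c * Phi y r.
  case: r => [t|j]; rewrite /Phi Ulin ?U1lin; first exact: end_cond_axpy.
  by rewrite inner_axpy.
pose m (r t : T) := Phi (fun t' => (t' == t)%:R) r.
have mE x r : \sum_t m r t * x t = Phi x r.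
  rewrite (functional_expand (L := fun x => Phi x r)); last by move=> *; exact: Philin.
  by apply: eq_bigr => t _; rewrite mulrC.
have phiL (a : 'I_d -> C) : gL2 (glin a phi) by exact: gL2_lin.
have UA x (rL : gL2 (gaxpy (gscale (-1) (glin (fun j => x (inr j)) phi)) z (U x))) :
    (forall t, Phi x (inl t) = 0) -> A (U x) (gaxpy (gscale (-1) (glin (fun j => x (inr j)) phi)) z (U x)).
  by move=> H; apply/(op_HsP kap (U x) rL); exists (U1 x); split => //; apply/end_condP.
have inj x : (forall r, \sum_t m r t * x t = 0) -> forall t, x t = 0.
  move=> H; have P r : Phi x r = 0 by rewrite -mE H.
  have rL : gL2 (gaxpy (gscale (-1) (glin (fun j => x (inr j)) phi)) z (U x)).
    by apply: gL2_axpy => //; apply: gL2_scale.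
  have Au := UA x rL (fun t => P (inl t)).
  have Ou : orth phi (U x) by move=> j; exact: P (inr j).
  (* Pairing the equation with [phi j], [A_sym] eliminates everything but the border coefficients;
     what is left of [U x] is a kernel element orthogonal to [phi]. *)
  have c0 : forall j, x (inr j) = 0.
    apply: (phi_free (a := fun j => x (inr j))) => j; have := A_sym j rL Au.
    rewrite inner_axpy//; last exact: gL2_scale.
    by rewrite inner_scale// Ou !mulr0 addr0 mulN1r => /eqP; rewrite oppr_eq0 => /eqP.
  have g0 (b : 'I_d -> gfun G) : glin (fun j => x (inr j)) b = (fun _ _ => 0).
    by apply/funext => e; apply/funext => t; rewrite /glin big1// => j _; rewrite c0 mul0r.
  have Uh : U x = hom theta s (fun t => x (inl t)).
    by rewrite /U g0; apply/funext => e; apply/funext => t; rewrite /gaxpy mulr0 addr0.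
  have K : Defs.kernel A (s ^+ 2) (U x).
    move: Au; rewrite g0 /Defs.kernel; congr (A _ _); apply/funext => e; apply/funext => t.
    by rewrite /gaxpy /gscale mulr0 add0r.
  have ae := normsq_eq0 (UL x) (A_inj K Ou); rewrite Uh in ae.
  by case=> [t|j]; [exact: hom_ae0 s0 decay _ ae t|exact: c0].
have [n nP] := square_solve inj.
(* The defect of the particular solution in the vertex and orthogonality conditions, which [U (X f)]
   is to cancel. *)
pose b f (r : T) : C := match r with
  inl t => end_cond kap (w f).1 (w f).2 t | inr j => inner (w f).1 (phi j) end.
have wL f : gL2 f -> gL2 (w f).1.
  by move=> Hf e; have [E _ _] := Hw f Hf; have [_ []] := E e.
have /choice[K HK] : forall r, exists K, 0 <= K /\ forall f, gL2 f -> csq (b f r) <= K * normsq f.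
  case=> [t|j].
    (* [N] serves the Kirchhoff sums and [2 * (M + M)] the differences of traces, the two cases of
       [end_cond]. *)
    pose N : R := 2 ^+ size (index_enum gend) * (\sum_(i : gend) M).
    have N0 : 0 <= N by apply: mulr_ge0; [exact: exprn_ge0|apply: sumr_ge0].
    have M2 : 0 <= 2 * (M + M) by apply: mulr_ge0 => //; exact: addr_ge0.
    exists (N + 2 * (M + M)); split; first exact: addr_ge0.
    move=> f Hf; have [_ _ B] := Hw f Hf; rewrite /b /end_cond.
    have F0 := normsq_ge0 f.
    case: ifP => _.
      apply: le_trans (csq_sum_le _ _ _) _; rewrite (mulrDl N) -[leLHS]addr0; apply: lerD; last first.
        exact: mulr_ge0.
      rewrite -mulrA mulr_suml ler_wpM2l ?exprn_ge0//.
      by apply: ler_sum => i _; have [] := B i.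
    have [B1 _] := B t; have [B2 _] := B (rep t).
    apply: le_trans (csqD_le _ _) _; rewrite csqN (mulrDl N) -[leLHS]add0r; apply: lerD; first exact: mulr_ge0.
    by rewrite -(mulrDr 2) -mulrA ler_pM2l// (mulrDl M M) lerD.
  exists (M * normsq (phi j)); split; first by apply: mulr_ge0 => //; exact: normsq_ge0.
  move=> f Hf; have [_ B _] := Hw f Hf.
  apply: le_trans (cauchy_schwarz (wL f Hf) (phi_L2 j)) _; rewrite mulrAC.
  by rewrite ler_wpM2r ?normsq_ge0.
pose X f t := - (\sum_r n t r * b f r).
have PX f r : Phi (X f) r = - b f r.
  by rewrite -mE -(nP (b f) r) -sumrN; apply: eq_bigr => t _; rewrite mulrN.
pose KX t := 2 ^+ size (index_enum (T : finType)) * \sum_(r : T) csq (n t r) * K r.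
have KX0 t : 0 <= KX t.
  apply: mulr_ge0; [exact: exprn_ge0|apply: sumr_ge0 => r _].
  by apply: mulr_ge0; [exact: csq_ge0|have [] := HK r].
have bX f t : gL2 f -> csq (X f t) <= KX t * normsq f.
  move=> Hf; rewrite csqN; apply: le_trans (csq_sum_le _ _ _) _; rewrite -mulrA.
  rewrite ler_wpM2l ?exprn_ge0// mulr_suml; apply: ler_sum => r _.
  by rewrite csqM -mulrA ler_wpM2l ?csq_ge0//; have [_] := HK r; apply.
pose KU := 2 ^+ size (index_enum (T : finType)) * \sum_(t : T) KX t * normsq (U (fun t' => (t' == t)%:R)).
have KU0 : 0 <= KU.
  apply: mulr_ge0; [exact: exprn_ge0|apply: sumr_ge0 => t _].
  by apply: mulr_ge0 => //; exact: normsq_ge0.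
have bU f : gL2 f -> normsq (U (X f)) <= KU * normsq f.
  move=> Hf.
  (* By linearity only the norms of the finitely many functions that [U] attaches to unit vectors
     enter the constant. *)
  have -> : U (X f) = (fun e y => \sum_t X f t * U (fun t' => (t' == t)%:R) e y).
    apply/funext => e; apply/funext => y.
    by rewrite (functional_expand (L := fun x => U x e y)) // => x c x'; rewrite Ulin.
  have [_ B] := normsq_sum_le (index_enum (T : finType)) (X f) (fun t => UL (fun t' => (t' == t)%:R)).
  apply: (le_trans B); rewrite -mulrA ler_wpM2l ?exprn_ge0// mulr_suml; apply: ler_sum => t _.
  by rewrite mulrAC ler_wpM2r ?normsq_ge0 ?bX.
exists (2 * M + 2 * KU); split; first by apply: addr_ge0; exact: mulr_ge0.
move=> f Hf; have [E B _] := Hw f Hf; have Lw := wL f Hf.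
exists (gaxpy (w f).1 1 (U (X f))), (fun j => X f (inr j)); split.
- have rL : gL2 (gsub (gaxpy f (s ^+ 2) (gaxpy (w f).1 1 (U (X f)))) (glin (fun j => X f (inr j)) phi)).
    by apply: gL2_sub => //; apply: gL2_axpy => //; apply: gL2_axpy.
  apply/(op_HsP kap _ rL); exists (gaxpy (w f).2 1 (U1 (X f))); split.
    have := esol_axpy 1 E (UE (X f)).
    by congr (esol _ _ _ _); apply/funext => e; apply/funext => t; rewrite /gsub /gaxpy /gscale /z; ring.
  apply/end_condP => t; rewrite end_cond_axpy mul1r.
  by have := PX f (inl t); rewrite /Phi => ->; rewrite subrr.
- move=> j; rewrite inner_axpy// mul1r.
  by have := PX f (inr j); rewrite /Phi => ->; rewrite subrr.
- apply: le_trans (normsqD_le 1 Lw (UL _)) _; rewrite csq1 mul1r (mulrDl (2 * M)) -(mulrA 2 M) -(mulrA 2 KU).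
  by apply: lerD; rewrite ler_pM2l//; exact: bU.
Qed.

End BorderedSystem.

(** * Real resonances *)

Section RealResonances.
Variables (R : realType) (G : qgraph R) (k : R).
Local Notation C := R[i].
Local Notation K := `|k|.
Local Notation lam := ((k ^+ 2)%:C : C).
Implicit Types (f g u : gfun G) (kap z : C) (theta : R).

Hypothesis k0 : k != 0.

(** The space [E]. The choice [vcond 0] stands for all [kap], because traces on the leads are
    zero. *)
Definition inner_eigen f (f1 : gfun G) :=
  [/\ forall i, W2 (edom (inl i)) (f (inl i)) (f1 (inl i)) (fun x => - (lam * f (inl i) x)),
      forall l x, 0 <= x -> f (inr l) x = 0 /\ f1 (inr l) x = 0 &
      vcond 0 f f1].

Lemma vcond_lead0 kap kap' f (f1 : gfun G) : (forall l, f (inr l) 0 = 0 /\ f1 (inr l) 0 = 0) ->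
  vcond kap f f1 -> vcond kap' f f1.
Proof.
move=> z [V D].
have tE a : tval kap' f a = tval kap f a by case: a => // l; rewrite /= (z l).1 !mulr0.
have dE a : tder kap' f1 a = tder kap f1 a by case: a => // l; rewrite /= (z l).2 !mulr0.
by split=> [a b ab|v]; [rewrite !tE; exact: V|rewrite (eq_bigr _ (fun a _ => dE a)) D].
Qed.

Lemma inner_eigen_esol kap f f1 : inner_eigen f f1 -> esol kap f f1 (gscale lam f) /\ vcond kap f f1.
Proof.
move=> [W Z V]; split; last first.
  by apply: vcond_lead0 V => l; exact: Z.
case=> [i|l].
- have [A B] := W i; have hD := hdom_edom (inl i).
  split; last by split; apply: L2_cont; [exact: AC_cont hD A|exact: AC_cont hD B].
  by split => //; apply: AC_eq B => // x _; rewrite mul1r.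
- have hD := hdom_edom (inr l); have mD := mset_edom (inr l).
  have Z' x : edom (inr l) x -> f (inr l) x = 0 /\ f1 (inr l) x = 0.
    by rewrite /= in_itv /= andbT; exact: Z.
  have A0 := AC_cst (edom (inr l)) 0; split.
    split; apply: AC_eq A0 => // x Dx; have [e1 e2] := Z' x Dx => //.
    by rewrite /gscale e1 !mulr0 oppr0.
  by split; apply: L2_eq (L2_0 mD) => // x Dx; have [e1 e2] := Z' x Dx.
Qed.

Lemma inner_eigen_L2 f f1 : inner_eigen f f1 -> gL2 f.
Proof. by move=> /(inner_eigen_esol 0)[E _] e; have [_ []] := E e. Qed.

(** On a lead the exponent [i k] has real part zero, so [lead_hom_real] applies. *)
Lemma inner_eigen_H f : Defs.kernel (@op_H R G) lam f <-> exists f1, inner_eigen f f1.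
Proof.
split=> [/op_HP[_ [f1 [E V]]]|[f1 I]]; last first.
  apply/op_HP; split; first by apply: gL2_scale; exact: inner_eigen_L2 I.
  by exists f1; exact: inner_eigen_esol.
exists f1; split => //.
- move=> i; have [[A B] _] := E (inl i); split => //.
  by apply: AC_eq B => // [|x _]; [exact: hdom_edom (inl i)|rewrite mul1r].
- move=> l x x0; have [[A B] [l0 l1]] := E (inr l).
  apply: (@lead_hom_real _ (f (inr l)) (f1 (inr l)) (0 +i* k)) => //.
  + by rewrite eq_complex /= (negbTE k0) andbF.
  + split => //; apply: AC_eq B => // [|y _]; first exact: hdom_edom (inr l).
    rewrite cfac0 mul1r /gscale -mulNr; congr (_ * _).
    by apply: complex_ext => /=; ring.
  + by rewrite /= in_itv /= x0.
Qed.

Section Rotated.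
Variables (theta : R) (th : 0 < theta < pi).
Local Notation kap := (0 +i* theta : C).

Lemma normk_sq : (K%:C : C) ^+ 2 = lam.
Proof. by rewrite -rmorphXn /= real_normK// num_real. Qed.

Lemma normk_neq0 : K%:C != 0 :> C.
Proof. by rewrite eq_complex /= normr_eq0 (negbTE k0). Qed.

Lemma Re_decay : complex.Re ((0 +i* 1) * K%:C * cexp kap) = - (K * sin theta).
Proof. by rewrite /cexp /= expR0; ring. Qed.

Lemma decay_gt0 : 0 < K * sin theta.
Proof. by rewrite mulr_gt0 ?normr_gt0//; apply: sin_gt0_pi. Qed.

Lemma decay_normk : complex.Re ((0 +i* 1) * K%:C * cexp kap) < 0.
Proof. by rewrite Re_decay oppr_lt0 decay_gt0. Qed.

(** The product of the squared distances of the two roots of [z] from [|k|] is [csq (z - lam)], so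
    one of them is below [eta]. As [eta] is the square of the decay rate at [|k|], this root keeps a
    positive rate. *)
Lemma decaying_root : exists eps : R, 0 < eps /\ forall z, csq (z - lam) < eps ->
  exists s, [/\ s != 0, s ^+ 2 = z & complex.Re ((0 +i* 1) * s * cexp kap) < 0].
Proof.
pose eta := (K * sin theta) ^+ 2; have eta0 : 0 < eta by rewrite exprn_gt0// decay_gt0.
exists (eta ^+ 2); split; first exact: exprn_gt0.
move=> z zl; suff [s [sz sK]] : exists s, s ^+ 2 = z /\ csq (s - K%:C) < eta.
  exists s; have D : complex.Re ((0 +i* 1) * s * cexp kap) < 0.
    pose w := (0 +i* 1) * (s - K%:C) * cexp kap.
    have we : csq w < eta.
      by rewrite /w !csqM csq_cexp_im// mulr1 csqi mul1r.
    have -> : (0 +i* 1) * s * cexp kap = (0 +i* 1) * K%:C * cexp kap + w by rewrite /w; ring.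
    rewrite raddfD -[X in X + _ < _]/(complex.Re _) -[X in _ + X < _]/(complex.Re _) Re_decay addrC subr_lt0.
    have wr : complex.Re w ^+ 2 < eta by apply: le_lt_trans we; rewrite lerDl sqr_ge0.
    rewrite ltNge; apply/negP => le; move: wr; rewrite ltNge; apply/negP/negPn.
    by rewrite lerXn2r ?nnegrE// ?(ltW decay_gt0)// (le_trans (ltW decay_gt0)).
  by split => //; apply: contraTneq D => ->; rewrite mulr0 mul0r /= ltxx.
have P : csq (sqrtc z - K%:C) * csq (- sqrtc z - K%:C) = csq (z - lam).
  by rewrite -csqM -csqN; congr csq; rewrite -normk_sq -{3}(sqr_sqrtc z); ring.
have [lt1|ge1] := ltP (csq (sqrtc z - K%:C)) eta; first by exists (sqrtc z); rewrite sqr_sqrtc.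
exists (- sqrtc z); rewrite sqrrN sqr_sqrtc; split => //.
rewrite ltNge; apply/negP => ge2; move: zl; rewrite ltNge; apply/negP/negPn.
by rewrite -P expr2 ler_pM// ltW.
Qed.

(* The rotated lead condition [f'(0) = i K e^{kap} f(0)] makes the flux identity applicable. *)
Lemma inner_eigen_Hs f : Defs.kernel (@op_Hs R G kap) lam f <-> exists f1, inner_eigen f f1.
Proof.
split=> [Kf|[f1 I]]; last first.
  apply/op_HsP; first by apply: gL2_scale; exact: inner_eigen_L2 I.
  by exists f1; exact: inner_eigen_esol.
have /op_HsP : gL2 (gscale lam f) by apply: gL2_scale; exact: Hs_L2 Kf.
move=> /(_ kap f)[/(_ Kf)[f1 [E V]] _]; exists f1.
have [a H] : exists a, forall e x, edom e x -> f e x = hom theta K%:C a e x /\ f1 e x = hom1 theta K%:C a e x.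
  apply: (hom_unique normk_neq0 decay_normk); rewrite normk_sq //; exact: E.
have D0 l : edom (inr l : edge G) 0 by exact: hdom0 (hdom_edom (inr l)).
have W i : W2 (edom (inl i)) (f (inl i)) (f1 (inl i)) (fun x => - (lam * f (inl i) x)).
  have [[A B] _] := E (inl i); split => //.
  by apply: AC_eq B => // [|x _]; [exact: hdom_edom (inl i)|rewrite mul1r].
have a0 l : a (inr l) = 0.
  have F : forall l, tval kap f (inr l) = 0.
    apply: (@flux R G kap (k ^+ 2) K f f1) => //; first by rewrite normr_eq0.
    move=> l'; have [e1 e2] := H (inr l') 0 (D0 l').
    rewrite /= e1 e2 /=.
    (* The outgoing derivative brings a factor [exp kap], which turns the weight [exp (- 3 kap / 2)]
       of derivatives into the weight [exp (- kap / 2)] of values; the constant in the flux identity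
       is therefore the real number [|k|]. *)
    have -> : - (kap / 2%:R) = - (3%:R * kap / 2%:R) + kap by field.
    rewrite cexpD (_ : 0 +i* K = (0 +i* 1) * K%:C); first by ring.
    by apply: complex_ext => /=; ring.
  have /eqP := F l; have [e1 _] := H (inr l) 0 (D0 l).
  rewrite /= e1 mulf_eq0 (negbTE (cexp_neq0 _)) /= /exp_sol mulr0 cexp0 mulr1.
  by move=> /eqP.
have Z l x : 0 <= x -> f (inr l) x = 0 /\ f1 (inr l) x = 0.
  move=> x0; have [|-> ->] := H (inr l) x; first by rewrite /= in_itv /= x0.
  by rewrite /= a0 !mul0r.
by split => //; apply: vcond_lead0 V => l; exact: Z.
Qed.

End Rotated.

Lemma vcond_eq kap u u1 (v v1 : gfun G) :
  (forall e x, edom e x -> u e x = v e x /\ u1 e x = v1 e x) -> vcond kap u u1 -> vcond kap v v1.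
Proof.
move=> H [V D].
have tE a : tval kap v a = tval kap u a.
  case: a => [[i b]|l] /=; first by have [] := H (inl i) _ (end_pt i b).
  by have [-> _] := H (inr l) 0 (hdom0 (hdom_edom _)).
have dE a : tder kap v1 a = tder kap u1 a.
  case: a => [[i b]|l] /=; last by have [_ ->] := H (inr l) 0 (hdom0 (hdom_edom _)).
  by case: b (H (inl i) _ (end_pt i b)) => -[_ ->].
by split=> [a b ab|w]; [rewrite !tE; exact: V|rewrite (eq_bigr _ (fun a _ => dE a)) D].
Qed.

Lemma inner_eigen_dim : exists n, has_dim (fun f => exists f1, inner_eigen f f1) n.
Proof.
(* Any angle in []0, pi[] would do: for each of them [E] is the kernel of the rotated operator, cut
   out of the finite-dimensional family [hom] by the end conditions. *)
pose theta : R := pi / 2.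
have th : 0 < theta < pi.
  by rewrite /theta divr_gt0 ?pi_gt0//= ltr_pdivrMr// ltr_pMr ?pi_gt0// ltr1n.
pose kap := 0 +i* theta; pose h := @hom R G theta K%:C; pose h1 := @hom1 R G theta K%:C.
have decay := decay_normk th.
have E a : esol kap (h a) (h1 a) (gscale lam (h a)).
  by rewrite -normk_sq; exact: hom_esol decay a.
have hL a : gL2 (h a) by move=> e; have [_ []] := E a e.
pose m (r t : @gend R G) := end_cond kap (h (fun t' => (t' == t)%:R)) (h1 (fun t' => (t' == t)%:R)) r.
have mE a r : \sum_t m r t * a t = end_cond kap (h a) (h1 a) r.
  rewrite (functional_expand (L := fun a => end_cond kap (h a) (h1 a) r)).
    by apply: eq_bigr => t _; rewrite mulrC.
  by move=> x c y; have [e1 e2] := hom_axpy theta K%:C x c y; rewrite /h /h1 e1 e2 end_cond_axpy.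
have [n [B [B0 Bfree Bspan]]] := null_basis m.
have lin (c : 'I_n -> C) : glin c (fun i => h (B i)) = h (fun t => \sum_i c i * B i t).
  apply/funext => e; apply/funext => x.
  case: e => [i|l]; rewrite /glin /h /hom ?mulr_suml -?big_split /=; apply: eq_bigr => j _; ring.
exists n, (fun i => h (B i)); split.
- move=> i; apply/(inner_eigen_Hs th); apply/op_HsP; first exact: gL2_scale.
  by exists (h1 (B i)); split => //; apply/end_condP => r; rewrite -mE.
- move=> c; rewrite lin => ae; apply: Bfree => t.
  exact: (hom_ae0 normk_neq0 decay ae t).
- move=> f /(inner_eigen_Hs th) Kf.
  have /op_HsP : gL2 (gscale lam f) by apply: gL2_scale; exact: Hs_L2 Kf.
  move=> /(_ kap f)[/(_ Kf)[f1 [Ef V]] _].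
  rewrite -normk_sq in Ef.
  have [a Ha] := hom_unique normk_neq0 decay Ef.
  have [c ac] : exists c : 'I_n -> C, forall t, a t = \sum_i c i * B i t.
    apply: Bspan => r; rewrite mE; apply/end_condP: r.
    exact: vcond_eq Ha V.
  exists c => e; rewrite lin; apply: aeW => x Dx; rewrite (Ha e x Dx).1.
  by congr (h _ e x); apply/funext.
Qed.

Lemma inner_eigen_alg_mult theta n : 0 < theta < pi ->
  has_dim (fun f => exists f1, inner_eigen f f1) n -> alg_mult (@op_Hs R G (0 +i* theta)) lam n.
Proof.
move=> th [phi [phiI free span]]; pose A := @op_Hs R G (0 +i* theta).
have phiL j : gL2 (phi j) by have [p1] := phiI j; exact: inner_eigen_L2.
have A_sym u h j : gL2 h -> A u h -> inner h (phi j) = lam * inner u (phi j).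
  move=> Hh /(op_HsP _ _ Hh)[u1 [E V]]; have [p1 I] := phiI j.
  have [W Z _] := I; have [_ Vp] := inner_eigen_esol (0 +i* theta) I.
  apply: (green Hh E V (phiL j) W Vp) => [l x x0|l]; first by have [] := Z l x x0.
  by have [] := Z l 0 (lexx 0).
have phi_free (a : 'I_n -> C) : normsq (glin a phi) = 0 -> forall i, a i = 0.
  by move=> a0; apply: free; apply: normsq_eq0 => //; exact: gL2_lin.
have A_phi j : A (phi j) (gscale lam (phi j)) by apply/(inner_eigen_Hs th).
apply: (@alg_mult_isolated R G A lam n phi) => //.
- exact: Hs_L2.
- exact: Hs_0.
- by move=> *; exact: Hs_lin.
- by move=> u /(inner_eigen_Hs th); exact: span.
have [eps [eps0 root]] := decaying_root th; exists eps; split => // z /root[s [s0 <- D]] inj.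
apply: (bordered_solvable s0 D phiL A_sym) => //.
exact: (lin_orth0 (@Hs_L2 R G _) A_phi phi_free).
Qed.

Lemma real_multiplicities : exists n, [/\ res_alg_mult G k%:C n, res_geo_mult G k%:C n & geo_mult (@op_H R G) lam n].
Proof.
have [n D] := inner_eigen_dim; exists n.
have geo (A : operator G) : (forall f, Defs.kernel A lam f <-> exists f1, inner_eigen f f1) -> geo_mult A lam n.
  move=> H; suff: Defs.kernel A lam = (fun f => exists f1, inner_eigen f f1) by rewrite /geo_mult => ->.
  by apply/funext => f; apply/propext.
split; last by apply: geo; exact: inner_eigen_H.
- by move=> theta [th _]; rewrite -rmorphXn; exact: inner_eigen_alg_mult.
- by move=> theta [th _]; rewrite -rmorphXn; apply: geo => f; exact: inner_eigen_Hs.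
Qed.

Lemma resonance_inner_eigen f : [/\
    forall e, exists q, weak_deriv (edom e) (f e) q /\
      weak_deriv (edom e) q (fun x => - (k%:C ^+ 2 * f e x)),
    gcontinuous f,
    forall v, Defs.N f v = 0 &
    forall (l : lead G) x, 0 <= x ->
      f (inr l) x = f (inr l) 0 * cexp ((0 +i* 1) * k%:C * x%:C)] ->
  exists f1, inner_eigen f f1.
Proof.
rewrite -rmorphXn => -[Hw [cf Vc] Nf Hl].
have /choice[f1 W] : forall e, exists q, W2 (edom e) (f e) q (fun x => - (lam * f e x)).
  move=> e; have [q [W1 W2']] := Hw e.
  by have [q' [_ ? ?]] := weak_AC2 (hdom_edom e) (cf e) W1 W2'; exists q'.
have gW : gW2 f f1 by move=> e; have [A B] := W e; split => //; exact: AC_cont (hdom_edom e) B.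
have V : vcond 0 f f1 by apply/(vcond0P gW).
have D0 l : edom (inr l : edge G) 0 by exact: hdom0 (hdom_edom (inr l)).
(* The outgoing form on the lead gives [f' = i k f] at its origin, so the flux identity applies with
   [c = k], of either sign. *)
have f1E l : f1 (inr l) 0 = (0 +i* k) * f (inr l) 0.
  have hD := hdom_edom (inr l); have [A c] := gW (inr l).
  pose nu : C := (0 +i* 1) * k%:C.
  have A1 : AC (edom (inr l)) (f (inr l)) (fun x => f (inr l) 0 * (nu * exp_sol nu x)).
    apply: AC_eq (ACZ (f (inr l) 0) hD (exp_W2 nu hD).1) => // x.
    by rewrite /= in_itv /= andbT => /Hl ->.
  rewrite -(AC_rderiv0 hD A c) (AC_rderiv0 hD A1); last first.
    exact: AC_cont hD (ACZ (f (inr l) 0) hD (exp_W2 nu hD).2).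
  rewrite /exp_sol mulr0 cexp0 mulr1 mulrC; congr (_ * _).
  by apply: complex_ext => /=; ring.
have f0 l : f (inr l) 0 = 0.
  have := @flux R G 0 (k ^+ 2) k f f1 k0 (fun i => W (inl i)) V.
  have E1 : cexp (- (3%:R * 0 / 2%:R)) = 1 :> C by rewrite mulr0 mul0r oppr0 cexp0.
  have E2 : cexp (- (0 / 2%:R)) = 1 :> C by rewrite mul0r oppr0 cexp0.
  move=> /= F; have := F _ l; rewrite E2 mul1r; apply => l'.
  by rewrite E1 !mul1r f1E.
(* On the leads the derivative is reset to zero, as [f] vanishes there; the vertex sums see only its
   value at the origin, which was already zero. *)
exists (fun e => match e with inl i => f1 (inl i) | inr _ => fun=> 0 end); split => //.
- by move=> l x /Hl ->; rewrite f0 mul0r.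
- have [Vv Vd] := V; split => // v; rewrite -[RHS](Vd v); apply: eq_bigr => -[//|l] _ /=.
  by rewrite f1E f0 !mulr0.
Qed.

Lemma real_resonanceP : is_resonance G k%:C <-> is_eigenvalue (@op_H R G) lam.
Proof.
split=> [[_ [f [[e [x [Dx fx]]] Hw gc Nf Hl]]]|[f [Kf nz]]].
- have /resonance_inner_eigen /inner_eigen_H Kf := And4 Hw gc Nf Hl.
  exists f; split => // ae; move: fx.
  (* A resonance state is nonzero at a point, an eigenfunction nonzero modulo null sets; continuity
     on closed edges reconciles the two. *)
  by rewrite (ae_cont0 (hdom_edom e) (gc.1 e) (ae e) Dx) eqxx.
- have [f1 [_ Z _]] := (inner_eigen_H f).1 Kf; have [W gc Nf] := Kf.
  split; first by rewrite eq_complex /= (negbTE k0).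
  exists f; split => //.
  + apply: contrapT => H; apply: nz => e; apply: aeW => x Dx; apply/eqP/negPn/negP => fx.
    by apply: H; exists e, x.
  + by rewrite -rmorphXn => e; have [_ _ [g [_ Wf Wg]]] := W e; exists g.
  + by move=> l x x0; rewrite (Z l x x0).1 (Z l 0 (lexx 0)).1 mul0r.
Qed.

End RealResonances.

Theorem theorem2p3 (R : realType) (G : qgraph R) :
  (forall k : R, k != 0 -> is_resonance G k%:C ->
     exists n : nat, res_alg_mult G k%:C n /\ res_geo_mult G k%:C n)
  /\
  (forall k : R, k != 0 ->
     (is_resonance G k%:C <-> is_eigenvalue (@op_H R G) (k ^+ 2)%:C) /\
     (is_resonance G k%:C ->
        exists n : nat,
          [/\ res_alg_mult G k%:C n, res_geo_mult G k%:C n &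
              geo_mult (@op_H R G) (k ^+ 2)%:C n])).
Proof.
split=> k k0; first by move=> _; have [n []] := real_multiplicities G k0; exists n.
by split=> [|_]; [exact: real_resonanceP|exact: real_multiplicities].
Qed.
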